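(* Let $0=t_0<t_1<\cdots<t_n=T$, let $h(x_{t_1},\ldots,x_{t_n})$ be the payoff of a discretely-monitored path-dependent derivative, let $r$ be the interest rate, $\sigma>0$ the (effective) volatility, and let $V_0^\delta,V_1^\delta,V_3^\varepsilon$ be the real market group parameters. Let $W$ be a Brownian motion and let $X$ be the geometric Brownian motion $dX_s=rX_s\,ds+\sigma X_s\,dW_s$. Let $P_0$ be the zero-order price and $P_1^{\varepsilon,\delta}$ the first-order correction, as defined in the context. For each $j\in\{0,\ldots,n-1\}$ and $s\in[t_j,t_{j+1})$, let $a(s,\cdot)$ and $b(s,\cdot)$ be deterministic square-integrable functions on $[s,T]$ such that $$\int_s^{t_k}a(s,u)\,du=1\ \text{ for all } k\in\{j+1,\ldots,n\},\qquad \int_s^{t_{j+1}}b(s,u)\,du=1,\qquad \int_{t_k}^{t_{k+1}}b(s,u)\,du=1\ \text{ for all }k\in\{j+1,\ldots,n-1\}.$$ Define $$F_j=-\sigma(t_{j+1}-s)+W_{t_{j+1}}-W_s,\qquad F_k=-\sigma(t_{k+1}-t_k)+W_{t_{k+1}}-W_{t_k}\quad (k\in\{j+1,\ldots,n-1\}),$$ $$\pi_{\Delta,j}(s,T)=\frac1\sigma\int_s^Ta(s,u)\,dW_u,$$ $$\pi_{3,j}(s,T)=\pi_{\Delta,j}^3(s,T)-\pi_{\Delta,j}^2(s,T)-\frac1{\sigma^2}\bigl(3\pi_{\Delta,j}(s,T)-1\bigr)\int_s^Ta^2(s,u)\,du,$$ $$\pi_{\sigma,j}(s,T)=\frac1\sigma\left(-\int_s^Tb(s,u)\,du+F_j\int_s^{t_{j+1}}b(s,u)\,dW_u+\sum_{k=j+1}^{n-1}F_k\int_{t_k}^{t_{k+1}}b(s,u)\,dW_u\right),$$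 $$\pi_{\Delta\sigma,j}(s,T)=\pi_{\sigma,j}(s,T)\pi_{\Delta,j}(s,T)-\frac1{\sigma^2}\left(\int_s^Tb(s,u)\,dW_u+F_j\int_s^{t_{j+1}}a(s,u)b(s,u)\,du+\sum_{k=j+1}^{n-1}F_k\int_{t_k}^{t_{k+1}}a(s,u)b(s,u)\,du\right),$$ $$\pi_{\mathcal H,j}^{\varepsilon,\delta}(s,T)=2V_0^\delta\,\pi_{\sigma,j}(s,T)+2V_1^\delta\,\pi_{\Delta\sigma,j}(s,T)+V_3^\varepsilon\,\pi_{3,j}(s,T).$$ Then, for every $i\in\{0,\ldots,n-1\}$ and $t\in[t_i,t_{i+1})$, the weight $$\pi^{\varepsilon,\delta}(t,T)=1+\int_t^{t_{i+1}}\pi_{\mathcal H,i}^{\varepsilon,\delta}(s,T)\,ds+\sum_{j=i+1}^{n-1}\int_{t_j}^{t_{j+1}}\pi_{\mathcal H,j}^{\varepsilon,\delta}(s,T)\,ds,$$ which does not depend on the payoff $h$, satisfies $$(P_0+P_1^{\varepsilon,\delta})(t,x_1,\ldots,x_i,x)=\mathbb E_{t,x}\left[e^{-r(T-t)}\,h(x_1,\ldots,x_i,X_{t_{i+1}},\ldots,X_{t_n})\,\pi^{\varepsilon,\delta}(t,T)\right].$$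
   Context: $\mathbb E_{t,x}$ denotes expectation conditional on $X_t=x$, where $X$ is the geometric Brownian motion with drift $r$ and volatility $\sigma$ driven by $W$ (in the underlying multiscale stochastic volatility model, $\sigma$ is the effective volatility $\overline\sigma$; $V_0^\delta,V_1^\delta,V_3^\varepsilon$ are small real constants arising from that model). Zero-order price: for $t\in[t_i,t_{i+1})$, $$P_0(t,x_1,\ldots,x_i,x)=\mathbb E_{t,x}\left[e^{-r(T-t)}h(x_1,\ldots,x_i,X_{t_{i+1}},\ldots,X_{t_n})\right].$$ Operator $\mathcal H$: $$\mathcal H=2V_0^\delta\frac{\partial}{\partial\sigma}+2V_1^\delta D_1\frac{\partial}{\partial\sigma}+V_3^\varepsilon D_1D_2,\qquad D_k=x^k\frac{\partial^k}{\partial x^k},$$ where $D_k$ always acts on the last variable of the function, and $\partial/\partial\sigma$ is the derivative of $P_0$ with respect to the volatility parameter $\sigma$ of $X$. First-order correction: for $t\in[t_i,t_{i+1})$, $$P_1^{\varepsilon,\delta}(t,x_1,\ldots,x_i,x)=\int_t^{t_{i+1}}e^{-r(s-t)}\mathbb E_{t,x}\left[\mathcal HP_0(s,x_1,\ldots,x_i,X_s)\right]ds+\sum_{j=i+1}^{n-1}\int_{t_j}^{t_{j+1}}e^{-r(s-t)}\mathbb E_{t,x}\left[\mathcal HP_0(s,x_1,\ldots,x_i,X_{t_{i+1}},\ldots,X_{t_j},X_s)\right]ds.$$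
   Formalization: In π_{Δσ,j} the term ∫_s^T b dW is corrected to ∫_s^{t_{j+1}} b dW (printed form fails for j<n−1); hπ_H is assumed ds×P-integrable, or else s-integrals stop at t_{j+1}−η and the formula holds as η→0; h is Borel, with P_0 integrable for every volatility, and prices are positive. *)

(* Defs.v *)
From HB Require Import structures.
From mathcomp Require Import all_boot all_order all_algebra.
From mathcomp Require Import all_classical all_reals all_analysis.

Set Implicit Arguments.
Unset Strict Implicit.
Unset Printing Implicit Defensive.

Import Order.TTheory GRing.Theory Num.Theory.
Import numFieldNormedType.Exports.

Local Open Scope classical_set_scope.
Local Open Scope ring_scope.

Section BrownianMotion.
Context (d : measure_display) (Omega : measurableType d) (R : realType).
Variable P : probability Omega R.

Definition mutually_independent (m : nat) (Z : 'I_m -> Omega -> R) : Prop :=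
  forall B : 'I_m -> set R, (forall k, measurable (B k)) ->
    P (\bigcap_(k in [set: 'I_m]) (Z k @^-1` B k)) =
    (\prod_(k < m) P (Z k @^-1` B k))%E.

(* Only the values [W u] with [0 <= u] are constrained. *)
Definition brownian_motion (W : R -> Omega -> R) : Prop :=
  [/\ forall u, 0 <= u -> measurable_fun setT (W u),
      {ae P, forall w, W 0 w = 0},
      (* the second parameter of [normal_prob] is the standard deviation *)
      forall u v, 0 <= u -> u < v -> forall B, measurable B ->
        P ((fun w => W v w - W u w) @^-1` B) =
        normal_prob 0 (Num.sqrt (v - u)) B,
      forall (m : nat) (u : nat -> R), 0 <= u 0%N ->
        (forall k, (k < m)%N -> u k <= u k.+1) ->
        mutually_independent
          (fun (k : 'I_m) w => W (u k.+1) w - W (u k) w) &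
      {ae P, forall w, {within `[0, +oo[, continuous (fun u => W u w)}}].

Definition square_integrable (A : set R) (f : R -> R) : Prop :=
  measurable_fun A f /\
  (\int[lebesgue_measure]_(u in A) ((f u) ^+ 2)%:E < +oo)%E.

(* A list of triples (c, (u, v)) encodes the step function
   sum of the c * 1_{]u, v]}. *)
Definition step_fun (l : seq (R * (R * R))) (x : R) : R :=
  \sum_(p <- l) p.1 * \1_`]p.2.1, p.2.2] x.

Definition step_integral (W : R -> Omega -> R) (l : seq (R * (R * R)))
    (w : Omega) : R :=
  \sum_(p <- l) p.1 * (W p.2.2 w - W p.2.1 w).

(* [I] is a version of the Wiener integral of the deterministic function [f]
   over [lo, hi]: the L2(P)-limit of the integrals of step functions
   converging to [f] in L2([lo, hi]). *)
Definition wiener_integral (W : R -> Omega -> R) (lo hi : R) (f : R -> R)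
    (I : Omega -> R) : Prop :=
  measurable_fun setT I /\
  exists l : nat -> seq (R * (R * R)),
    [/\ forall m, {in l m, forall p,
          [/\ lo <= p.2.1, p.2.1 <= p.2.2 & p.2.2 <= hi]},
        (\int[lebesgue_measure]_(u in `[lo, hi])
           ((step_fun (l m) u - f u) ^+ 2)%:E)%E @[m --> \oo] --> 0%E &
        (\int[P]_w ((step_integral W (l m) w - I w) ^+ 2)%:E)%E
           @[m --> \oo] --> 0%E].

(* The geometric Brownian motion with drift [r] and volatility [v] started
   at [x] at time [t], at time [s >= t].  The law of the whole path given
   X_t = x, jointly with the increments of [W] after [t], is that of this
   process, so that E_{t,x} is the [P]-expectation of functionals of it. *)
Definition gbm (W : R -> Omega -> R) (r v t x s : R) (w : Omega) : R :=
  x * expR ((r - v ^+ 2 / 2) * (s - t) + v * (W s w - W t w)).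

End BrownianMotion.

Section Pricing.
Context (d : measure_display) (Omega : measurableType d) (R : realType).
Variables (P : probability Omega R) (W : R -> Omega -> R).
Variables (n : nat) (tm : nat -> R).
Variables (r sigma V0 V1 V3 : R).

Local Notation mu := (@lebesgue_measure R).
Local Notation T := (tm n).

(* Monitoring dates 0 = t_0 < ... < t_n. *)
Definition monitoring_grid : Prop :=
  tm 0%N = 0 /\ forall k, (k < n)%N -> tm k < tm k.+1.

(* For [s] in [t_j, t_{j+1}), the intervals from [cell_start s j k] to
   [t_{k+1}], [j <= k < n], are [s, t_{j+1}], [t_{j+1}, t_{j+2}], ...,
   [t_{n-1}, t_n]. *)
Definition cell_start (s : R) (j k : nat) : R := if k == j then s else tm k.

(* Observed prices are indexed from 0: the index [k] stands for the price at
   the date t_{k+1}.  Those with [k < i], i.e. x_1, ..., x_i, are given by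
   [y]; the later ones are read on the path [X]. *)
Definition observed (i : nat) (y : nat -> R) (X : R -> R) (k : nat) : R :=
  if (k < i)%N then y k else X (tm k.+1).

Definition fixings (i : nat) (y : nat -> R) (X : R -> R) : n.-tuple R :=
  [tuple observed i y X k | k < n].

Section Prices.
Variable h : n.-tuple R -> R.

(* Every zero-order price, at every volatility [v > 0], is the expectation of
   an integrable random variable. *)
Definition admissible_payoff : Prop :=
  measurable_fun setT h /\
  forall (v : R) (i : nat) (s : R) (y : nat -> R) (x : R),
    0 < v -> (i < n)%N -> tm i <= s < tm i.+1 ->
    (forall k, (k < i)%N -> 0 < y k) -> 0 < x ->
    P.-integrable setT
      (fun w => (h (fixings i y (fun u => gbm W r v s x u w)))%:E).

Definition P0 (v : R) (i : nat) (s : R) (y : nat -> R) (x : R) : R :=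
  \int[P]_w (expR (- r * (T - s)) *
             h (fixings i y (fun u => gbm W r v s x u w))).

Definition Dop (k : nat) (f : R -> R) (x : R) : R := x ^+ k * derive1n k f x.

Definition vega (i : nat) (s : R) (y : nat -> R) (x : R) : R :=
  derive1 (fun v => P0 v i s y x) sigma.

Definition HP0 (i : nat) (s : R) (y : nat -> R) (x : R) : R :=
  2 * V0 * vega i s y x +
  2 * V1 * Dop 1 (vega i s y) x +
  V3 * Dop 1 (Dop 2 (P0 sigma i s y)) x.

Definition P1 (i : nat) (t : R) (y : nat -> R) (x : R) : R :=
  \sum_(i <= j < n)
    \int[mu]_(s in `[cell_start t i j, tm j.+1[)
      (expR (- r * (s - t)) *
       \int[P]_w
         HP0 j s (observed i y (fun u => gbm W r sigma t x u w))
           (gbm W r sigma t x s w)).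

End Prices.

Section Weights.
(* [a s u], [b s u] are a(s, u), b(s, u).  [IA s] is a version of the Wiener
   integral of a(s, .) over [s, T], and [IB s k] one of the Wiener integral
   of b(s, .) over [cell_start s j k, t_{k+1}].  The versions are data: a
   Wiener integral is only defined up to a null set for each [s], whereas the
   weights are integrated in [s] for fixed [w]. *)
Variables (a b : R -> R -> R) (IA : R -> Omega -> R)
  (IB : R -> nat -> Omega -> R).

Definition weight_functions : Prop :=
  forall (j : nat) (s : R), (j < n)%N -> tm j <= s < tm j.+1 ->
    [/\ square_integrable `[s, T] (a s),
        square_integrable `[s, T] (b s),
        forall k, (j < k <= n)%N -> \int[mu]_(u in `[s, tm k]) a s u = 1 &
        forall k, (j <= k < n)%N ->
          \int[mu]_(u in `[cell_start s j k, tm k.+1]) b s u = 1].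

Definition wiener_versions : Prop :=
  forall (j : nat) (s : R), (j < n)%N -> tm j <= s < tm j.+1 ->
    wiener_integral P W s T (a s) (IA s) /\
    forall k, (j <= k < n)%N ->
      wiener_integral P W (cell_start s j k) (tm k.+1) (b s) (IB s k).

Definition Fincr (j : nat) (s : R) (k : nat) (w : Omega) : R :=
  - sigma * (tm k.+1 - cell_start s j k) +
  W (tm k.+1) w - W (cell_start s j k) w.

Definition pi_Delta (s : R) (w : Omega) : R := sigma^-1 * IA s w.

Definition pi_3 (s : R) (w : Omega) : R :=
  pi_Delta s w ^+ 3 - pi_Delta s w ^+ 2 -
  sigma ^- 2 * (3 * pi_Delta s w - 1) *
    \int[mu]_(u in `[s, T]) (a s u ^+ 2).

Definition pi_sigma (j : nat) (s : R) (w : Omega) : R :=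
  sigma^-1 *
  (- (\int[mu]_(u in `[s, T]) b s u) +
   \sum_(j <= k < n) Fincr j s k w * IB s k w).

(* The first term of the bracket is the Wiener integral of b(s, .) over
   [s, t_{j+1}], not over [s, T]: it comes from
     sum over k of (int a(s, u) du) * (int b(s, u) dW_u),
   both integrals over [cell_start s j k, t_{k+1}], where the a-integral is 1
   for k = j and 0 for k > j.  With [s, T] the representation formula fails
   for j < n - 1, e.g. for n = 2 and h (x_1, x_2) = x_2. *)
Definition pi_Delta_sigma (j : nat) (s : R) (w : Omega) : R :=
  pi_sigma j s w * pi_Delta s w -
  sigma ^- 2 *
  (IB s j w +
   \sum_(j <= k < n) Fincr j s k w *
     \int[mu]_(u in `[cell_start s j k, tm k.+1]) (a s u * b s u)).

Definition pi_H (j : nat) (s : R) (w : Omega) : R :=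
  2 * V0 * pi_sigma j s w + 2 * V1 * pi_Delta_sigma j s w + V3 * pi_3 s w.

(* [weight 0 i t] is the weight; for [eta > 0] the integrals in [s] are
   truncated at distance [eta] from their upper limits.  The truncation
   matters when V3 <> 0: the constraint on [a] forces
   int_s^T a(s, u)^2 du >= 1 / (t_{j+1} - s), so that E |pi_3 s| is at least
   of order (t_{j+1} - s)^(-3/2) and the integrals in [s] can converge only
   as improper ones. *)
Definition weight (eta : R) (i : nat) (t : R) (w : Omega) : R :=
  1 + \sum_(i <= j < n)
        \int[mu]_(s in `[cell_start t i j, tm j.+1 - eta[) pi_H j s w.

Definition weight_integrable (h : n.-tuple R -> R) (eta : R) (i : nat)
    (t : R) (y : nat -> R) (x : R) : Prop :=
  forall j, (i <= j < n)%N ->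
    (mu \x P)%E.-integrable
      (`[cell_start t i j, tm j.+1 - eta[ `*` setT)
      (fun z => (h (fixings i y (fun u => gbm W r sigma t x u z.2)) *
                 pi_H j z.1 z.2)%:E).

Definition weighted_price (h : n.-tuple R -> R) (eta : R) (i : nat)
    (t : R) (y : nat -> R) (x : R) : R :=
  \int[P]_w (expR (- r * (T - t)) *
             h (fixings i y (fun u => gbm W r sigma t x u w)) *
             weight eta i t w).

End Weights.

End Pricing.

(* Main.v *)
(** Write the payoff as a function H(Z) of the Brownian increments Z over the
    cells left by the date t, with x entering only through a shift of the first
    increment.  By the Cameron-Martin formula and by scaling the increments,
    the derivatives of P0 in x and in the volatility are expectations of H(Z)
    times polynomials in Z; the Markov property then turns each term of P1
    into E[H(Z) q_s], where q_s is such a polynomial in the increments of the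
    grid refined by s.

    Both q_s and the weight pi_H have the same conditional expectation given
    Z.  Indeed the normalisations of a and b fix the components of the Wiener
    integrals along Z; the remainders are orthogonal to Z, hence have vanishing
    odd conditional moments and constant second ones, and the deterministic
    corrections in pi_3, pi_sigma and pi_Delta_sigma cancel the second moments
    that depend on a and b.  This is [weight_cexp]; q_s is its instance with
    a and b constant on the cells.  The common value is affine in s, so that
    Fubini gives the formula for the truncated weights and the truncation can
    be removed. *)
Require Import Defs.
From HB Require Import structures.
From mathcomp Require Import all_boot all_order all_algebra.
From mathcomp Require Import all_classical all_reals all_analysis.
From mathcomp Require Import measurable_realfun.
From mathcomp Require Import ring lra.
Import Order.TTheory GRing.Theory Num.Theory.
Import numFieldNormedType.Exports.
Local Open Scope classical_set_scope.
Local Open Scope ring_scope.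

Set Implicit Arguments.
Unset Strict Implicit.
Unset Printing Implicit Defensive.

(** No conditional expectation is constructed: [cexp] only records that two variables have the same
    expectation against the payoff. The delicate point is the claim on the remainders. A Wiener
    integral is known only as an L2 limit of step integrals, so its independence from Z is not at
    hand. For a step function orthogonal to the cells, the Cameron-Martin shift leaves Z fixed and
    yields exactly the Laplace transform of the step integral weighted by a function of Z.
    Truncation carries this to the limit as an inequality only. Comparing both expansions at 0 up to
    order three is enough: the first moment vanishes, the second is at most V, and the third
    vanishes once the second equals V. The bound for a complementary test function forces that
    equality; polarisation then gives the mixed products of at most three factors met in the
    weights. Integrability of the payoff against polynomials has a single source: admissibility at
    volatility 2 sigma provides a Gaussian exponential moment at volatility sigma, which also
    permits differentiation under the expectation. *)

Section TupleMeasure.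
Context (R : realType).

Definition tuple_rect (d : measure_display) (T : measurableType d) (p : nat)
    (B : 'I_p -> set T) : set (p.-tuple T) :=
  [set z | forall k, B k (tnth z k)].

Definition tuple_rects (d : measure_display) (T : measurableType d) (p : nat) :
    set_system (p.-tuple T) :=
  [set A | exists2 B : 'I_p -> set T, (forall k, measurable (B k)) &
           A = tuple_rect B].

Lemma tuple_rectE (d : measure_display) (T : measurableType d) p
    (B : 'I_p -> set T) :
  tuple_rect B = \bigcap_(k in [set: 'I_p]) ((@tnth p T)^~ k @^-1` B k).
Proof. by apply/seteqP; split => z /= zB k; [move=> _|]; exact: zB. Qed.

Lemma measurable_tuple_rect (d : measure_display) (T : measurableType d) p
    (B : 'I_p -> set T) : (forall k, measurable (B k)) ->
  measurable (tuple_rect B).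
Proof.
move=> mB; rewrite tuple_rectE; apply: fin_bigcap_measurable => // k _.
by rewrite -[X in measurable X]setTI; exact: measurable_tnth.
Qed.

(** The sigma-algebra of tuples is generated by preimages under single coordinates, which are not
    stable under intersection. Such a preimage is a rectangle with all sides but one equal to
    [setT], so the rectangles, which form a pi-system, generate the same sigma-algebra. *)
Lemma measurable_tupleE (d : measure_display) (T : measurableType d) (p : nat) :
  @measurable _ (p.-tuple T) = <<s @tuple_rects d T p >>.
Proof.
apply/seteqP; split; last first.
  apply: smallest_sub; first exact: sigma_algebra_measurable.
  by move=> _ [B mB ->]; exact: measurable_tuple_rect.
apply: smallest_sub; first exact: smallest_sigma_algebra.
move=> A; rewrite -bigcup_seq => -[i /= _ [C mC <-]].
apply: sub_sigma_algebra; exists (fun k => if k == i then C else setT).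
  by move=> k; case: ifP.
apply/seteqP; split => z /=; first by move=> [_ Cz] k; case: eqP => [->|].
by move=> /(_ i); rewrite eqxx.
Qed.

Lemma tuple_rects_setI (d : measure_display) (T : measurableType d) (p : nat) :
  setI_closed (@tuple_rects d T p).
Proof.
move=> _ _ [B mB ->] [C mC ->]; exists (fun k => B k `&` C k).
  by move=> k; exact: measurableI.
apply/seteqP; split => z /=; first by move=> [zB zC] k; split; [exact: zB|exact: zC].
by move=> zBC; split => k; case: (zBC k).
Qed.

(** Pi-lambda argument. Since the whole space is itself a rectangle, of finite measure, the constant
    sequence [setT] serves as the exhausting sequence. *)
Lemma tuple_measure_unique (d : measure_display) (T : measurableType d) p
    (m1 m2 : {measure set (p.-tuple T) -> \bar R}) :
  (m1 setT < +oo)%E ->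
  (forall B : 'I_p -> set T, (forall k, measurable (B k)) ->
    m1 (tuple_rect B) = m2 (tuple_rect B)) ->
  forall A, measurable A -> m1 A = m2 A.
Proof.
move=> m1oo m12; have setTE : @setT (p.-tuple T) = tuple_rect (fun=> setT).
  by apply/seteqP; split.
apply: (measure_unique (@tuple_rects d T p) (fun=> setT)) => //.
- exact: measurable_tupleE.
- exact: tuple_rects_setI.
- by move=> _; exists (fun=> setT).
- exact: bigcup_const.
- by move=> _ [B mB ->]; exact: m12.
Qed.

End TupleMeasure.

(** * Independence of two blocks of an independent family *)

Section Independence.
Context (R : realType) (d : measure_display) (Omega : measurableType d).
Variable P : probability Omega R.

Definition indep_rv (d1 d2 : measure_display) (T1 : measurableType d1)
    (T2 : measurableType d2) (X : Omega -> T1) (Y : Omega -> T2) : Prop :=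
  forall A B, measurable A -> measurable B ->
    P (X @^-1` A `&` Y @^-1` B) = (P (X @^-1` A) * P (Y @^-1` B))%E.

(** The family is indexed by [nat] rather than by ['I_p], so that tails and blocks such as
    [fun k => X (p + k)%N] need no casts between ordinals. *)
Definition tup (p : nat) (X : nat -> Omega -> R) (w : Omega) : p.-tuple R :=
  [tuple X k w | k < p].

Lemma tnth_tup p X w (k : 'I_p) : tnth (tup p X w) k = X k w.
Proof. by rewrite tnth_mktuple. Qed.

Lemma measurable_tup p X : (forall k, (k < p)%N -> measurable_fun setT (X k)) ->
  measurable_fun setT (tup p X).
Proof.
move=> mX; apply/measurable_fun_tnthP => k.
rewrite (_ : _ \o _ = X k); first exact: mX.
by apply/funext => w /=; rewrite tnth_tup.
Qed.

(** Mutual independence gives the product formula on pairs of rectangles. It is extended to all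
    measurable sets one block at a time, by uniqueness of measures agreeing on rectangles. *)
Lemma tup_indep (p q : nat) (X : nat -> Omega -> R) :
  (forall k, (k < p + q)%N -> measurable_fun setT (X k)) ->
  mutually_independent P (fun k : 'I_(p + q) => X k) ->
  indep_rv (tup p X) (tup q (fun k => X (p + k)%N)).
Proof.
move=> mX iX.
set U := tup p X; set V := tup q _.
have mU : measurable_fun setT U.
  by apply: measurable_tup => k kp; apply: mX; exact: (leq_trans kp (leq_addr _ _)).
have mV : measurable_fun setT V.
  by apply: measurable_tup => k kq; apply: mX; rewrite ltn_add2l.
have mUA A : measurable A -> measurable (U @^-1` A).
  by move=> mA; rewrite -[X in measurable X]setTI; exact: mU.
have mVB B : measurable B -> measurable (V @^-1` B).
  by move=> mB; rewrite -[X in measurable X]setTI; exact: mV.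
have rr (A : 'I_p -> set R) (B : 'I_q -> set R) : (forall k, measurable (A k)) ->
  (forall k, measurable (B k)) ->
  P (U @^-1` tuple_rect A `&` V @^-1` tuple_rect B) =
  (\prod_(k < p) P (X k @^-1` A k) * \prod_(k < q) P (X (p + k)%N @^-1` B k))%E.
  move=> mA mB.
  have := iX (fun k => match fintype.split k with inl a => A a | inr b => B b end).
  rewrite big_split_ord/=.
  move=> /(_ _)/wrap[|H].
    by move=> k; case: splitP.
  transitivity (\prod_(i0 < p) P (X i0 @^-1` match fintype.split (lshift q i0) with inl a => A a | inr b => B b end) *
    \prod_(i0 < q) P (X (p + i0)%N @^-1` match fintype.split (rshift p i0) with inl a => A a | inr b => B b end))%E.
    rewrite -H; congr (P _); apply/seteqP; split => w /=.
      move=> [wA wB] k _ /=; case: splitP => a ka.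
        by have := wA a; rewrite tnth_tup -ka.
      by have := wB a; rewrite tnth_tup -ka.
    move=> wAB; split => k.
      have := wAB (lshift q k) I; rewrite tnth_tup /=.
      by case: splitP => a /= ka; [rewrite (_ : k = a)//; exact: val_inj|
        have := ltn_ord k; rewrite ka ltnNge leq_addr].
    have := wAB (rshift p k) I; rewrite tnth_tup /=.
    case: splitP => a /= ka; first by have := ltn_ord a; rewrite -ka ltnNge leq_addr.
    by rewrite (_ : k = a)//; apply: val_inj; apply/eqP; rewrite -(eqn_add2l p) ka.
  congr (_ * _)%E; apply: eq_bigr => k _; case: splitP => a /= ka.
  - by rewrite (_ : k = a)//; exact: val_inj.
  - by have := ltn_ord k; rewrite ka ltnNge leq_addr.
  - by have := ltn_ord a; rewrite -ka ltnNge leq_addr.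
  - by rewrite (_ : k = a)//; apply: val_inj; apply/eqP; rewrite -(eqn_add2l p) ka.
have pr (A : 'I_p -> set R) : (forall k, measurable (A k)) ->
    P (U @^-1` tuple_rect A) = (\prod_(k < p) P (X k @^-1` A k))%E.
  move=> mA; have := rr A (fun=> setT) mA (fun=> measurableT).
  rewrite (_ : V @^-1` _ = setT) ?setIT; last by apply/seteqP; split.
  move=> ->; rewrite [X in (_ * X)%E]big1 ?mule1// => k _.
  by rewrite preimage_setT probability_setT.
have qr (B : 'I_q -> set R) : (forall k, measurable (B k)) ->
    P (V @^-1` tuple_rect B) = (\prod_(k < q) P (X (p + k)%N @^-1` B k))%E.
  move=> mB; have := rr (fun=> setT) B (fun=> measurableT) mB.
  rewrite (_ : U @^-1` _ = setT) ?setTI; last by apply/seteqP; split.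
  move=> ->; rewrite [X in (X * _)%E]big1 ?mul1e// => k _.
  by rewrite preimage_setT probability_setT.
have fP (A : set Omega) : measurable A -> (0 <= fine (P A))%R /\ (fine (P A))%:E = P A.
  by move=> mA; split; [rewrite fine_ge0|rewrite fineK// fin_num_measure].
(* With the event [E] fixed, both sides are finite measures in [A]: the image of [P] restricted to
   [E], and [P E] times the image of [P]. The claim is applied first with [E] an event of [V], then
   with [E] a rectangle of [U]. *)
have unq (s : nat) (S : Omega -> s.-tuple R) (E : set Omega) :
  measurable_fun setT S -> measurable E ->
  (forall B : 'I_s -> set R, (forall k, measurable (B k)) ->
    P (S @^-1` tuple_rect B `&` E) = (P (S @^-1` tuple_rect B) * P E)%E) ->
  forall A, measurable A -> P (S @^-1` A `&` E) = (P (S @^-1` A) * P E)%E.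
  move=> mS mE HE A mA; have [e0 eE] := fP _ mE.
  pose m1 := pushforward (mrestr P mE) S : measure (s.-tuple R) R.
  pose m2 := mscale (NngNum e0) (pushforward P S) : measure (s.-tuple R) R.
  have : m1 mS A = m2 mS A.
    apply: tuple_measure_unique => //.
      rewrite /m1 /= /pushforward /mrestr /= preimage_setT setTI.
      by rewrite (le_lt_trans (probability_le1 P mE))// ltry.
    move=> B mB; rewrite /m1 /m2 /= /mscale/= /pushforward /mrestr /=.
    by rewrite HE// muleC eE.
  by rewrite /m1 /m2 /= /mscale/= /pushforward /mrestr /= eE muleC.
move=> A B mA mB.
apply: (@unq) => //; first exact: mVB.
move=> A' mA'; rewrite setIC muleC; apply: unq => //.
  by apply: mUA; exact: measurable_tuple_rect.
by move=> B' mB'; rewrite setIC rr// pr// qr// muleC.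
Qed.

End Independence.

(** * Fubini's theorem for a pair of independent variables *)

Section IndependenceFubini.
Context (R : realType) (d : measure_display) (Omega : measurableType d).
Variable P : probability Omega R.

Lemma integral_distributionT (d' : measure_display) (T' : measurableType d')
    (X : {mfun Omega >-> T'}) (f : T' -> \bar R) : measurable_fun [set: T'] f ->
  (\int[distribution P X]_y f y = \int[P]_w f (X w))%E.
Proof.
move=> mf; rewrite integralE [RHS]integralE; congr (_ - _)%E.
  have mp := measurable_funepos mf.
  rewrite (@ge0_integral_distribution _ _ _ _ _ P X _ mp); last exact: funepos_ge0.
  by apply: eq_integral => w _; rewrite /= !funeposE.
have mn := measurable_funeneg mf.
rewrite (@ge0_integral_distribution _ _ _ _ _ P X _ mn); last exact: funeneg_ge0.
by apply: eq_integral => w _; rewrite /= !funenegE.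
Qed.

Lemma integrable_distribution (d' : measure_display) (T' : measurableType d')
    (X : {mfun Omega >-> T'}) (f : T' -> \bar R) :
  (distribution P X).-integrable [set: T'] f ->
  P.-integrable [set: Omega] (f \o X).
Proof.
move=> /integrableP[mf fi]; apply/integrableP; split; first exact: measurableT_comp.
have ma : measurable_fun [set: T'] (abse \o f) by exact: measurableT_comp.
have := @ge0_integral_distribution _ _ _ _ _ P X _ ma (fun y => abse_ge0 _).
by move=> <-.
Qed.

(** An iterated real-valued integral applies [fine] to the inner integral at every point, whereas
    Fubini's theorem makes that integral finite only almost everywhere. *)
Lemma integral_fine (mu : {measure set Omega -> \bar R}) (g : Omega -> \bar R) :
  mu.-integrable setT g ->
  (\int[mu]_w (fine (g w))%:E = \int[mu]_w g w)%E.
Proof.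
move=> ig; apply: ae_eq_integral => //.
- by apply/measurable_EFinP/measurableT_comp => //; exact: measurable_int ig.
- exact: measurable_int ig.
- have := integrable_ae measurableT ig; apply: filterS => w /= + _.
  by move=> /(_ I); exact: fineK.
Qed.

Context (d1 d2 : measure_display) (T1 : measurableType d1)
  (T2 : measurableType d2) (X : Omega -> T1) (Y : Omega -> T2).
Hypotheses (mX : measurable_fun setT X) (mY : measurable_fun setT Y).
Hypothesis XY : indep_rv P X Y.

Let Xm : {mfun Omega >-> T1} := HB.pack X (isMeasurableFun.Build _ _ _ _ _ mX).
Let Ym : {mfun Omega >-> T2} := HB.pack Y (isMeasurableFun.Build _ _ _ _ _ mY).
Let mXY : measurable_fun setT (fun w => (X w, Y w)).
Proof. exact/measurable_fun_pair. Qed.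
Let XYm : {mfun Omega >-> (T1 * T2)%type} :=
  HB.pack (fun w => (X w, Y w)) (isMeasurableFun.Build _ _ _ _ _ mXY).

Let joint A : measurable A ->
  (distribution P Xm \x distribution P Ym)%E A = distribution P XYm A.
Proof.
move=> mA; apply: product_measure_unique => // B C mB mC; exact: XY.
Qed.

Lemma indep_ge0_integral (F : T1 * T2 -> \bar R) : measurable_fun [set: T1 * T2] F ->
  (forall z, (0 <= F z)%E) ->
  (\int[P]_w F (X w, Y w) = \int[P]_w \int[P]_w' F (X w, Y w'))%E.
Proof.
move=> mF F0.
transitivity (\int[distribution P XYm]_z F z)%E.
  by rewrite ge0_integral_distribution.
rewrite (eq_measure_integral (distribution P Xm \x distribution P Ym)%E); last first.
  by move=> A mA _; apply/esym; exact: joint.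
rewrite fubini_tonelli1// ge0_integral_distribution//; last 2 first.
- exact: measurable_fun_fubini_tonelli_F.
- by move=> x; exact: integral_ge0.
apply: eq_integral => w _ /=.
rewrite /fubini_F ge0_integral_distribution//.
by apply: measurableT_comp => //; exact: pair1_measurable.
Qed.

(** The joint law is the product of the marginals. The Markov property is used in this form:
    conditioning on [X] amounts to freezing it and averaging over an independent copy of [Y]. *)
Lemma indep_Rintegral (F : T1 * T2 -> R) : measurable_fun [set: T1 * T2] F ->
  P.-integrable setT (fun w => (F (X w, Y w))%:E) ->
  \int[P]_w F (X w, Y w) = \int[P]_w \int[P]_w' F (X w, Y w').
Proof.
move=> mF iF; have mFE : measurable_fun setT (EFin \o F) by exact/measurable_EFinP.
have iF' : (distribution P Xm \x distribution P Ym)%E.-integrable setT (EFin \o F).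
  apply/integrableP; split => //.
  rewrite (eq_measure_integral (distribution P XYm)); last first.
    by move=> A mA _; exact: joint.
  rewrite ge0_integral_distribution//; last exact: measurableT_comp.
  by move/integrableP : iF => [].
rewrite /Rintegral.
have -> : (\int[P]_w (F (X w, Y w))%:E = \int[distribution P XYm]_z (F z)%:E)%E.
  by rewrite integral_distributionT.
rewrite (eq_measure_integral (distribution P Xm \x distribution P Ym)%E); last first.
  by move=> A mA _; apply/esym; exact: joint.
rewrite -integral12_prod_meas1// integral_distributionT; last exact: (measurable_fubini_F iF').
have /integrable_distribution := integrable_fubini_F iF'.
move=> /integral_fine => iFE; congr fine; rewrite -[LHS]iFE.
apply: eq_integral => w _ /=; congr (fine _)%:E.
by rewrite /fubini_F integral_distributionT//; apply: measurableT_comp => //;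
   exact: pair1_measurable.
Qed.
End IndependenceFubini.

(** * Affine changes of variable under a centred normal law *)

Section NormalAffine.
Context (R : realType).
Local Notation mu := (@lebesgue_measure R).
Implicit Types (f : R -> \bar R) (al be dl : R).

(** The density gives the measure of sets; for functions one passes through the Radon-Nikodym
    derivative, which agrees almost everywhere with [normal_pdf] because both have the same integral
    over every measurable set. *)
Lemma ge0_integral_normal_prob (s : R) f : s != 0 ->
  measurable_fun [set: R] f -> (forall z, (0 <= f z)%E) ->
  (\int[normal_prob 0 s]_z f z = \int[mu]_z (f z * (normal_pdf 0 s z)%:E))%E.
Proof.
move=> s0 mf f0.
have dom : normal_prob 0 s `<< mu by exact: normal_prob_dominates.
rewrite -(Radon_Nikodym_SigmaFinite.change_of_variables dom)//.
apply: ae_eq_integral => //.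
- apply: emeasurable_funM => //; apply: (measurable_int mu).
  exact: Radon_Nikodym_SigmaFinite.f_integrable.
- apply: emeasurable_funM => //; apply/measurable_EFinP.
  exact: measurable_normal_pdf.
- apply: ae_eqe_mul2l => /=; apply: integral_ae_eq => //.
  + exact: Radon_Nikodym_SigmaFinite.f_integrable.
  + by apply/measurable_EFinP; exact: measurable_normal_pdf.
  + by move=> E _ mE; rewrite -Radon_Nikodym_SigmaFinite.f_integral.
Qed.

Lemma ge0_integral_affine al be f : 0 < be ->
  measurable_fun [set: R] f -> (forall z, (0 <= f z)%E) ->
  (\int[mu]_z f (al + be * z)%R = (be^-1)%:E * \int[mu]_z f z)%E.
Proof.
move=> be0 mf f0.
pose phi : measurableTypeR R -> measurableTypeR R := fun z => al + be * z.
have mphi : measurable_fun [set: measurableTypeR R] phi.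
  by apply: measurable_funD => //; exact: measurable_funM.
have b0 : 0 <= be by exact: ltW.
(* [m2] is [be] times the image of Lebesgue measure under [phi]. Agreement on half-open intervals
   identifies it with Lebesgue measure. *)
pose m2 := mscale (NngNum b0) (pushforward mu phi) : measure (measurableTypeR R) R.
have E A : measurable A -> mu A = m2 mphi A.
  apply: lebesgue_measure_unique => _ [[a b] _ <-].
  rewrite /m2 /= /mscale /= /pushforward.
  rewrite (_ : phi @^-1` _ = `](a - al) / be, (b - al) / be]%classic); last first.
    apply/seteqP; split => z; rewrite /phi /= !in_itv/= => /andP[az zb].
      by rewrite ltr_pdivrMr// ler_pdivlMr// ltrBlDl lerBrDl (mulrC z) az.
    by rewrite -ltrBlDl -lerBrDl mulrC -ltr_pdivrMr// -ler_pdivlMr// az.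
  rewrite !lebesgue_measure_itv/= !lte_fin ltr_pM2r ?invr_gt0// ltrD2r.
  case: ifPn => ab; last by rewrite mule0.
  rewrite -!EFinB -EFinM; congr (_%:E).
  by field; rewrite gt_eqF.
rewrite [in RHS](eq_measure_integral (m2 mphi)); last by move=> A mA _; exact: E.
rewrite ge0_integral_mscale// ge0_integral_pushforward//.
by rewrite /= muleA -EFinM mulVf ?gt_eqF// mul1e.
Qed.

(** Density at [z] of the law of al + be Z with respect to the law of Z, where Z is centred normal
    of variance [dl]. For be = 1 it is the Cameron-Martin factor exp (al z / dl - al^2 / (2 dl)). *)
Definition gauss_ratio al be dl (z : R) : R :=
  be^-1 * expR (z ^+ 2 / (2 * dl) - (z - al) ^+ 2 / (2 * dl * be ^+ 2)).

Lemma gauss_ratio_ge0 al be dl z : 0 < be -> 0 <= gauss_ratio al be dl z.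
Proof. by move=> b0; rewrite mulr_ge0// ?expR_ge0// invr_ge0 ltW. Qed.

Lemma measurable_gauss_ratio al be dl : measurable_fun [set: R] (gauss_ratio al be dl).
Proof.
apply: measurable_funM => //; apply: measurableT_comp => //.
apply: measurable_funB; apply: measurable_funM => //.
by apply: measurable_funX; exact: measurable_funB.
Qed.

Lemma normal_prob_affine al be dl f : 0 < dl -> 0 < be ->
  measurable_fun [set: R] f -> (forall z, (0 <= f z)%E) ->
  (\int[normal_prob 0 (Num.sqrt dl)]_z f (al + be * z)%R =
   \int[normal_prob 0 (Num.sqrt dl)]_z ((gauss_ratio al be dl z)%:E * f z))%E.
Proof.
move=> d0 b0 mf f0.
have s0 : Num.sqrt dl != 0 by rewrite gt_eqF// sqrtr_gt0.
have mphi : measurable_fun [set: R] (fun z => al + be * z).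
  by apply: measurable_funD => //; exact: measurable_funM.
have mpsi : measurable_fun [set: R] (fun z => (z - al) / be).
  by apply: measurable_funM => //; exact: measurable_funB.
rewrite !ge0_integral_normal_prob//; last 3 first.
- by apply: emeasurable_funM => //; apply/measurable_EFinP; exact: measurable_gauss_ratio.
- by move=> z; rewrite mule_ge0// lee_fin gauss_ratio_ge0.
- exact: measurableT_comp.
pose F z := (f z * (normal_pdf 0 (Num.sqrt dl) ((z - al) / be))%:E)%E.
transitivity (\int[mu]_z F (al + be * z)%R)%E.
  apply: eq_integral => z _; rewrite /F; congr (_ * (normal_pdf _ _ _)%:E)%E.
  by rewrite addrAC subrr add0r mulrAC divff ?mul1r// gt_eqF.
have mF : measurable_fun [set: R] F.
  apply: emeasurable_funM => //; apply/measurable_EFinP; apply: measurableT_comp => //.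
  exact: measurable_normal_pdf.
rewrite ge0_integral_affine//; last first.
  by move=> z; rewrite mule_ge0// lee_fin normal_pdf_ge0.
rewrite -ge0_integralZl//; last 2 first.
- by move=> z _; rewrite mule_ge0// lee_fin normal_pdf_ge0.
- by rewrite lee_fin invr_ge0 ltW.
apply: eq_integral => z _; rewrite /F muleCA [X in _ = (X * _)%E]muleC -muleA -!EFinM.
congr (_ * _%:E)%E; rewrite /gauss_ratio !normal_pdfE// /normal_fun sqr_sqrtr ?ltW//.
rewrite [LHS]mulrCA [RHS]mulrCA; congr (_ * _).
rewrite -[RHS]mulrA; congr (_ * _); rewrite -expRD; congr expR; rewrite !subr0.
by field; rewrite !gt_eqF.
Qed.

End NormalAffine.

(** * Finite-dimensional Cameron-Martin formula, with scaling *)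

Section GaussianSequence.
Context (R : realType) (d : measure_display) (Omega : measurableType d).
Variable P : probability Omega R.
Implicit Types (M : nat) (X : nat -> Omega -> R) (al be dl : nat -> R).

Definition gaussian_seq M X dl : Prop :=
  [/\ forall k, (k < M)%N -> measurable_fun [set: Omega] (X k),
      forall k, (k < M)%N -> 0 < dl k,
      forall k, (k < M)%N -> forall B, measurable B ->
        P (X k @^-1` B) = normal_prob 0 (Num.sqrt (dl k)) B &
      mutually_independent P (fun k : 'I_M => X k)].

Lemma gaussian_seqS M X dl : gaussian_seq M.+1 X dl ->
  gaussian_seq M (fun k => X k.+1) (fun k => dl k.+1).
Proof.
move=> [mX d0 lX iX]; split=> [k kM|k kM|k kM B mB|B mB].
- exact: mX.
- exact: d0.
- exact: lX.
have := iX (fun k => if unlift ord0 k is Some j then B j else setT).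
rewrite big_ord_recl unlift_none preimage_setT probability_setT mul1e.
move=> /(_ _)/wrap[k|H]; first by case: unlift.
transitivity (\prod_(i0 < M) P (X (lift ord0 i0) @^-1`
    match unlift ord0 (lift ord0 i0) with Some j => B j | None => setT end))%E.
  rewrite -H; congr (P _); apply/seteqP; split => w /= wB k _.
    by case: unliftP => //= j ->; exact: wB.
  by have := wB (lift ord0 k) I; rewrite /= liftK.
by apply: eq_bigr => k _; rewrite liftK.
Qed.

Lemma gaussian_seq_indep M X dl : gaussian_seq M.+1 X dl ->
  indep_rv P (X 0%N) (tup M (fun k => X k.+1)).
Proof.
move=> [mX _ _ iX] A B mA mB.
have mA1 : measurable ((@tnth 1 R)^~ ord0 @^-1` A).
  by rewrite -[X in measurable X]setTI; exact: measurable_tnth.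
have := @tup_indep R d Omega P 1 M X mX iX _ B mA1 mB.
rewrite (_ : tup 1 X @^-1` _ = X 0%N @^-1` A)//.
by apply/seteqP; split => w /=; rewrite tnth_tup.
Qed.

Lemma tup_cons M X w :
  tup M.+1 X w = [tuple of X 0%N w :: tup M (fun k => X k.+1) w].
Proof.
apply: eq_from_tnth => k; rewrite tnth_tup; have [->//|k0] := eqVneq k ord0.
have [j jk] : exists j : 'I_M, k = lift ord0 j.
  by case: (unliftP ord0 k) => [j ->|]; [exists j|move/eqP; rewrite (negbTE k0)].
by rewrite jk tnthS tnth_tup.
Qed.

Lemma integral_gaussian M X dl (k : nat) (f : R -> \bar R) :
  gaussian_seq M X dl -> (k < M)%N ->
  measurable_fun [set: R] f -> (forall z, (0 <= f z)%E) ->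
  (\int[P]_w f (X k w) = \int[normal_prob 0 (Num.sqrt (dl k))]_z f z)%E.
Proof.
move=> [mX d0 lX _] kM mf f0.
pose Xk : Omega -> measurableTypeR R := X k.
have mXk : measurable_fun [set: Omega] Xk by exact: mX.
pose Xm : {mfun Omega >-> measurableTypeR R} :=
  HB.pack Xk (isMeasurableFun.Build _ _ _ _ _ mXk).
have mf' : measurable_fun [set: measurableTypeR R] f by [].
rewrite -[LHS](@ge0_integral_distribution _ _ _ _ _ P Xm f mf' f0).
by apply: eq_measure_integral => A mA _; exact: lX.
Qed.

(** Induction on the number of variables: [X 0] is independent of the remaining ones, so the
    induction hypothesis transforms the tail with [X 0] frozen, and the one-dimensional formula then
    transforms [X 0]. *)
Lemma integral_gaussian_affine M X al be dl (G : M.-tuple R -> \bar R) :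
  gaussian_seq M X dl -> (forall k, (k < M)%N -> 0 < be k) ->
  measurable_fun [set: M.-tuple R] G -> (forall z, (0 <= G z)%E) ->
  (\int[P]_w G (tup M (fun k w => al k + be k * X k w)%R w) =
   \int[P]_w ((\prod_(k < M) gauss_ratio (al k) (be k) (dl k) (X k w))%:E *
              G (tup M X w)))%E.
Proof.
elim: M X al be dl G => [|M IH] X al be dl G gX be0 mG G0.
  apply: eq_integral => w _; rewrite big_ord0 mul1e; congr G.
  by apply: eq_from_tnth; case.
have gX' := gaussian_seqS gX; have iX := gaussian_seq_indep gX.
have [mX d0 lX _] := gX.
set X' := fun k => X k.+1 in gX' iX.
pose al' k := al k.+1; pose be' k := be k.+1; pose dl' k := dl k.+1.
pose F (z : R * M.-tuple R) := G [tuple of z.1 :: z.2].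
have mX0 : measurable_fun [set: Omega] (X 0%N) by exact: mX.
have mX' : measurable_fun [set: Omega] (tup M X').
  by apply: measurable_tup => k kM; exact: mX.
have mF : measurable_fun [set: R * M.-tuple R] F.
  by apply: (measurableT_comp mG); apply: measurable_cons.
pose rho (z : M.-tuple R) :=
  \prod_(k < M) gauss_ratio (al' k) (be' k) (dl' k) (tnth z k).
have mrho : measurable_fun [set: M.-tuple R] rho.
  apply: measurable_prod => k _; apply: measurableT_comp => //.
    exact: measurable_gauss_ratio.
  exact: measurable_tnth.
have rho0 z : (0 <= (rho z)%:E)%E.
  rewrite lee_fin.
  apply: prodr_ge0 => k _; apply: gauss_ratio_ge0; exact: (be0 k.+1 (ltn_ord k)).
pose aff (z : M.-tuple R) : M.-tuple R := [tuple al' k + be' k * tnth z k | k < M].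
have maff : measurable_fun [set: M.-tuple R] aff.
  apply/measurable_fun_tnthP => k.
  rewrite (_ : _ \o _ = fun z => al' k + be' k * tnth z k); last first.
    by apply/funext => z /=; rewrite tnth_mktuple.
  by apply: measurable_funD => //; apply: measurable_funM => //; exact: measurable_tnth.
have affE w : tup M (fun k w => al' k + be' k * X' k w) w = aff (tup M X' w).
  by apply: eq_from_tnth => k; rewrite !tnth_mktuple.
have mph : measurable_fun [set: R] (fun z => al 0%N + be 0%N * z).
  by apply: measurable_funD => //; exact: measurable_funM.
pose F1 (z : R * M.-tuple R) := F (al 0%N + be 0%N * z.1, aff z.2).
have mF1 : measurable_fun [set: R * M.-tuple R] F1.
  apply: (measurableT_comp mF); apply: measurable_fun_pair.
    exact: (measurableT_comp mph).
  exact: (measurableT_comp maff).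
pose F2 (z : R * M.-tuple R) :=
  ((gauss_ratio (al 0%N) (be 0%N) (dl 0%N) z.1 * rho z.2)%:E * F z)%E.
have mF2 : measurable_fun [set: R * M.-tuple R] F2.
  apply: emeasurable_funM => //; apply/measurable_EFinP; apply: measurable_funM.
    by apply: measurableT_comp => //; exact: measurable_gauss_ratio.
  exact: (measurableT_comp mrho).
transitivity (\int[P]_w F1 (X 0%N w, tup M X' w))%E.
  apply: eq_integral => w _; rewrite tup_cons; congr G; apply/val_inj; congr (_ :: _).
  exact: (congr1 val (affE w)).
rewrite indep_ge0_integral//; last by move=> z; exact: G0.
(* Integral over the tail, with its density already inserted, as a function of the value of the
   head. *)
pose K x := (\int[P]_w ((rho (tup M X' w))%:E * F (x, tup M X' w)))%E.
have mK : measurable_fun [set: R] K.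
  pose KK (z : R * Omega) := ((rho (tup M X' z.2))%:E * F (z.1, tup M X' z.2))%E.
  have mKK : measurable_fun [set: R * Omega] KK.
    apply: emeasurable_funM; first by apply/measurable_EFinP; do 2 apply: measurableT_comp => //.
    by apply: (measurableT_comp mF); apply/measurable_fun_pair => //; exact: measurableT_comp.
  have KK0 z : (0 <= KK z)%E by apply: mule_ge0; [exact: rho0|exact: G0].
  exact: (@measurable_fun_fubini_tonelli_F _ _ _ _ _ P _ mKK KK0).
have K0 x : (0 <= K x)%E by apply: integral_ge0 => w _; apply: mule_ge0; [exact: rho0|exact: G0].
transitivity (\int[P]_w K (al 0%N + be 0%N * X 0%N w)%R)%E.
  apply: eq_integral => w _; rewrite /K.
  pose G' (z : M.-tuple R) := F (al 0%N + be 0%N * X 0%N w, z).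
  have mG' : measurable_fun [set: M.-tuple R] G'.
    by apply: (measurableT_comp mF); exact: pair1_measurable.
  have := IH X' al' be' dl' G' gX'.
  move=> /(_ (fun k kM => be0 k.+1 kM) mG' (fun=> G0 _)) IHw.
  transitivity (\int[P]_w' G' (tup M (fun k w => al' k + be' k * X' k w)%R w'))%E.
    by apply: eq_integral => w' _; rewrite affE.
  rewrite IHw; apply: eq_integral => w' _; congr (_%:E * _)%E.
  by apply: eq_bigr => k _; rewrite tnth_tup.
have KA : measurable_fun [set: R] (fun z => K (al 0%N + be 0%N * z)).
  exact: measurableT_comp.
rewrite (@integral_gaussian M.+1 X dl 0%N (fun z => K (al 0%N + be 0%N * z)) gX)//.
rewrite normal_prob_affine//; [|exact: d0|exact: be0].
rewrite -(@integral_gaussian M.+1 X dl 0%N _ gX)//; last 2 first.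
- by apply: emeasurable_funM => //; apply/measurable_EFinP; exact: measurable_gauss_ratio.
- by move=> z; apply: mule_ge0; [rewrite lee_fin gauss_ratio_ge0// be0|exact: K0].
transitivity (\int[P]_w F2 (X 0%N w, tup M X' w))%E; last first.
  apply: eq_integral => w _; rewrite /F2 /F /= -tup_cons; congr (_%:E * _)%E.
  by rewrite big_ord_recl; congr (_ * _); apply: eq_bigr => k _; rewrite tnth_tup.
have g0 z : 0 <= gauss_ratio (al 0%N) (be 0%N) (dl 0%N) z.
  by rewrite gauss_ratio_ge0// be0.
rewrite indep_ge0_integral//; last first.
  move=> z; apply: mule_ge0; last exact: G0.
  by rewrite lee_fin mulr_ge0//; have := rho0 z.2; rewrite lee_fin.
apply: eq_integral => w _; rewrite /K -ge0_integralZl//.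
- by apply: eq_integral => w' _; rewrite /F2 EFinM muleA.
- apply: emeasurable_funM; first by apply/measurable_EFinP; exact: (measurableT_comp mrho).
  by apply: (measurableT_comp mF); exact: measurable_fun_pair.
- by move=> w' _; apply: mule_ge0; [exact: rho0|exact: G0].
- by rewrite lee_fin.
Qed.

End GaussianSequence.

(** * Step functions on a common refinement *)

Section StepGrid.
Context (R : realType).
Local Notation mu := (@lebesgue_measure R).
Implicit Types (p q : seq (R * (R * R))) (pts : seq R).

(** The path [phi] is arbitrary so that a single refinement lemma serves both the step integral,
    where [phi] is a path of [W], and the step function itself, where it is [cellpath x]. *)
Definition step_path (phi : R -> R) p : R :=
  \sum_(c <- p) c.1 * (phi c.2.2 - phi c.2.1).

Definition step_wf p := {in p, forall c, 0 <= c.2.1 <= c.2.2}.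

Definition step_ends p : seq R := [seq c.2.1 | c <- p] ++ [seq c.2.2 | c <- p].

Definition gridpt pts (k : nat) : R := nth 0 pts k.
Arguments gridpt : simpl never.

Lemma gridpt_ltE pts k l : sorted <%R pts -> (k < size pts)%N ->
  (l < size pts)%N -> (gridpt pts k < gridpt pts l) = (k < l)%N.
Proof. by move=> srt ks ls; exact: (lt_sorted_ltn_nth 0 srt ks ls). Qed.

Lemma gridpt_le pts k l : sorted <%R pts -> (k < size pts)%N ->
  (l < size pts)%N -> (gridpt pts k <= gridpt pts l) = (k <= l)%N.
Proof. by move=> srt ks ls; exact: (lt_sorted_leq_nth 0 srt ks ls). Qed.

(** Each increment of [phi] between two endpoints telescopes over the grid cells in between. The
    coefficients gathered on a cell add up to the value of the step function at its right end,
    because the steps are indicators of intervals open on the left and closed on the right. *)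
Lemma step_path_grid phi pts p : sorted <%R pts ->
  {subset step_ends p <= pts} -> step_wf p ->
  step_path phi p = \sum_(l < (size pts).-1)
    step_fun p (gridpt pts l.+1) * (phi (gridpt pts l.+1) - phi (gridpt pts l)).
Proof.
move=> srt sub wf; rewrite /step_fun.
under eq_bigr do rewrite mulr_suml.
rewrite exchange_big/= /step_path; apply: eq_big_seq => -[c [u v]] cp /=.
have /= /andP[u0 uv] := wf _ cp.
have ui : u \in pts by apply: sub; rewrite mem_cat; apply/orP; left; apply/mapP; exists (c, (u, v)).
have vi : v \in pts by apply: sub; rewrite mem_cat; apply/orP; right; apply/mapP; exists (c, (u, v)).
set a := index u pts; set b := index v pts.
have ga : gridpt pts a = u by exact: nth_index.
have gb : gridpt pts b = v by exact: nth_index.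
have alt : (a < size pts)%N by rewrite index_mem.
have blt : (b < size pts)%N by rewrite index_mem.
have ab : (a <= b)%N by rewrite -(gridpt_le srt)// ga gb.
rewrite -ga -gb.
rewrite -(telescope_sumr (fun l => phi (gridpt pts l)) ab).
rewrite mulr_sumr.
rewrite (big_nat_widen _ _ (size pts).-1); last by rewrite -ltnS prednK// (leq_ltn_trans _ blt).
rewrite (big_nat_widenl _ 0%N)//= big_mkord big_mkcond/=; apply: eq_bigr => l _.
have ls : (l.+1 < size pts)%N by have := ltn_ord l; rewrite ltn_predRL.
rewrite indicE; case: ifPn => [/andP[lb al]|nab].
  rewrite mem_set ?mulr1//= in_itv/= (gridpt_ltE srt)// (gridpt_le srt)// ltnS.
  by move: al => /= ->; rewrite lb.
rewrite memNset ?mulr0 ?mul0r//= in_itv/= (gridpt_ltE srt)// (gridpt_le srt)// ltnS => /andP[al lb].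
by move: nab; rewrite al lb.
Qed.

(** As a function of [y], the indicator that [x] has been reached; its increment over an interval
    ]u, v] is the indicator of that interval at [x]. *)
Definition cellpath (x y : R) : R := (x <= y)%R%:R.

Lemma step_fun_path p x : step_wf p -> step_fun p x = step_path (cellpath x) p.
Proof.
move=> wf; apply: eq_big_seq => -[c [u v]] cp /=; have /= /andP[_ uv] := wf _ cp.
congr (_ * _); rewrite indicE /cellpath; have [xu|ux] := leP x u.
  rewrite (le_trans xu uv) subrr memNset//= in_itv/= => /andP[].
  by rewrite ltNge xu.
have [xv|vx] := leP x v; first by rewrite subr0 mem_set//= in_itv/= ux.
by rewrite subr0 memNset//= in_itv/= leNgt vx andbF.
Qed.

Lemma cellpath_indic (u v x : R) : u <= v ->
  cellpath x v - cellpath x u = \1_`]u, v] x.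
Proof.
move=> uv; rewrite indicE /cellpath; have [xu|ux] := leP x u.
  rewrite (le_trans xu uv) subrr memNset//= in_itv/= => /andP[].
  by rewrite ltNge xu.
have [xv|vx] := leP x v; first by rewrite subr0 mem_set//= in_itv/= ux.
by rewrite subr0 memNset//= in_itv/= leNgt vx andbF.
Qed.

Lemma gridpt_lt pts k : sorted <%R pts -> (k < (size pts).-1)%N ->
  gridpt pts k < gridpt pts k.+1.
Proof.
move=> srt; rewrite ltn_predRL => ks.
by apply: (sorted_ltn_nth lt_trans) => //; rewrite inE// (ltn_trans _ ks).
Qed.

Definition step_ip p q : R := \int[mu]_x (step_fun p x * step_fun q x).

Lemma step_fun_grid pts p x : sorted <%R pts ->
  {subset step_ends p <= pts} -> step_wf p ->
  step_fun p x = \sum_(l < (size pts).-1)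
    step_fun p (gridpt pts l.+1) * \1_`]gridpt pts l, gridpt pts l.+1] x.
Proof.
move=> srt sub wf; rewrite step_fun_path// (step_path_grid _ srt)//.
by apply: eq_bigr => l _; rewrite cellpath_indic// ltW// gridpt_lt.
Qed.

Lemma integrable_itv_indic (u v c : R) :
  mu.-integrable setT (fun x => (c * \1_`]u, v] x)%:E).
Proof.
under eq_fun do rewrite EFinM; apply: integrableZl => //.
apply/integrableP; split; first exact/measurable_EFinP/measurable_indic.
under eq_integral do rewrite gee0_abs ?lee_fin//.
rewrite integral_indic//= setIT lebesgue_measure_itv/=.
by case: ifPn => // _; rewrite ltry.
Qed.

(** No endpoint of [q] lies strictly inside a cell, so a point of the cell and its right end are on
    the same side of every endpoint. *)
Lemma step_fun_cell pts q l x : sorted <%R pts ->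
  {subset step_ends q <= pts} -> step_wf q -> (l < (size pts).-1)%N ->
  gridpt pts l < x <= gridpt pts l.+1 ->
  step_fun q x = step_fun q (gridpt pts l.+1).
Proof.
move=> srt sub wf lM /andP[lx xl]; rewrite !step_fun_path//.
have ls : (l.+1 < size pts)%N by rewrite -ltn_predRL.
have cE v : v \in pts -> cellpath x v = cellpath (gridpt pts l.+1) v.
  move=> vi; rewrite /cellpath; congr (nat_of_bool _)%:R; apply/idP/idP => [xv|]; last exact: le_trans.
  move: (lt_le_trans lx xv); have <- : gridpt pts (index v pts) = v by exact: nth_index.
  by rewrite (gridpt_ltE srt) ?(gridpt_le srt) ?index_mem// ltnW.
apply: eq_big_seq => -[c [u v]] cq; rewrite !cE//; apply: sub; rewrite mem_cat; apply/orP.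
  by left; apply/mapP; exists (c, (u, v)).
by right; apply/mapP; exists (c, (u, v)).
Qed.

Lemma step_ip_grid pts p q : sorted <%R pts ->
  {subset step_ends p <= pts} -> {subset step_ends q <= pts} ->
  step_wf p -> step_wf q ->
  step_ip p q = \sum_(l < (size pts).-1)
    step_fun p (gridpt pts l.+1) * step_fun q (gridpt pts l.+1) *
    (gridpt pts l.+1 - gridpt pts l).
Proof.
move=> srt sp sq wp wq; rewrite /step_ip /Rintegral.
under eq_integral => x _.
  rewrite (_ : step_fun p x * step_fun q x = \sum_(l < (size pts).-1)
    step_fun p (gridpt pts l.+1) * step_fun q (gridpt pts l.+1) *
     \1_`]gridpt pts l, gridpt pts l.+1] x); last first.
    rewrite (step_fun_grid x srt sp wp) mulr_suml; apply: eq_bigr => l _.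
    rewrite indicE; case: (boolP (x \in _)) => [|_]; last by rewrite !mulr0 mul0r.
    by rewrite inE /= !mulr1 => xl; rewrite (step_fun_cell srt sq wq (ltn_ord l)).
  over.
under eq_integral do rewrite -sumEFin.
rewrite integral_sum//; last by move=> l; exact: integrable_itv_indic.
rewrite -sum_fine; last first.
  by move=> l _; exact: integrable_fin_num (integrable_itv_indic _ _ _).
apply: eq_bigr => l _.
rewrite -/(Rintegral _ _ _) RintegralZl//; last first.
  by have := integrable_itv_indic (gridpt pts l) (gridpt pts l.+1) 1; under eq_fun do rewrite mul1r.
congr (_ * _); rewrite /Rintegral integral_indic//= setIT lebesgue_measure_itv/=.
by rewrite lte_fin gridpt_lt.
Qed.


End StepGrid.

(** * Cameron-Martin formula for step integrals *)

Section BrownianSteps.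
Context (R : realType) (d : measure_display) (Omega : measurableType d).
Variables (P : probability Omega R) (W : R -> Omega -> R).
Hypothesis hW : brownian_motion P W.
Implicit Types (p q : seq (R * (R * R))).

Lemma brownian_gaussian_seq (u : nat -> R) (M : nat) : 0 <= u 0%N ->
  (forall k, (k < M)%N -> u k < u k.+1) ->
  gaussian_seq P M (fun k w => W (u k.+1) w - W (u k) w) (fun k => u k.+1 - u k).
Proof.
move=> u0 uS; have [mW _ lW iW _] := hW.
have ge0 k : (k <= M)%N -> 0 <= u k.
  elim: k => // k IH kM; apply: (le_trans (IH (ltnW kM))).
  exact/ltW/uS.
split=> [k kM|k kM|k kM B mB|].
- by apply: measurable_funB; apply: mW; apply: ge0 => //; exact: ltnW.
- by rewrite subr_gt0 uS.
- by apply: lW => //; [exact/ge0/ltnW|exact: uS].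
- by apply: iW => // k kM; exact/ltW/uS.
Qed.

Lemma measurable_step_integral p : step_wf p ->
  measurable_fun [set: Omega] (step_integral W p).
Proof.
move=> wf; have [mW _ _ _ _] := hW; rewrite /step_integral.
(* The membership test makes every summand measurable: [W v] is known to be measurable only for v >=
   0, which [step_wf] grants for the members of [p] alone. *)
rewrite (_ : (fun w => _) = (fun w => \sum_(c <- p)
   (if c \in p then c.1 * (W c.2.2 w - W c.2.1 w) else 0))); last first.
  by apply/funext => w; apply: eq_big_seq => c ->.
apply: measurable_sum => -[c [u v]]; case: (boolP (_ \in p)) => // /wf/= /andP[u0 uv].
apply: measurable_funM => //; apply: measurable_funB; apply: mW => //.
exact: le_trans uv.
Qed.

Definition common_pts (ps : seq (seq (R * (R * R)))) : seq R :=
  sort <=%R (undup (flatten [seq step_ends p | p <- ps])).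

Lemma common_pts_sorted ps : sorted <%R (common_pts ps).
Proof. by rewrite lt_sorted_uniq_le sort_uniq undup_uniq sort_le_sorted. Qed.

Lemma common_pts_sub ps p : p \in ps -> {subset step_ends p <= common_pts ps}.
Proof.
move=> pin x xp; rewrite /common_pts mem_sort mem_undup; apply/flattenP.
by exists (step_ends p) => //; apply/mapP; exists p.
Qed.

Lemma step_ends_ge0 p x : step_wf p -> x \in step_ends p -> 0 <= x.
Proof.
move=> wf; rewrite mem_cat => /orP[] /mapP[c /wf /andP[c0 c1] ->] //.
exact: le_trans c1.
Qed.

Lemma common_pts_ge0 ps x : (forall p, p \in ps -> step_wf p) ->
  x \in common_pts ps -> 0 <= x.
Proof.
move=> wf; rewrite /common_pts mem_sort mem_undup => /flattenP[_ /mapP[p pin ->]].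
exact/step_ends_ge0/wf.
Qed.

Lemma common_pts_gaussian ps : (forall p, p \in ps -> step_wf p) ->
  gaussian_seq P (size (common_pts ps)).-1
    (fun k w => W (gridpt (common_pts ps) k.+1) w - W (gridpt (common_pts ps) k) w)
    (fun k => gridpt (common_pts ps) k.+1 - gridpt (common_pts ps) k).
Proof.
move=> wf; apply: (@brownian_gaussian_seq (gridpt (common_pts ps))) => [|k kM].
  case E : (common_pts ps) => [|x s]; first by rewrite /gridpt.
  by apply: (common_pts_ge0 wf); rewrite E /gridpt/= mem_head.
by apply: gridpt_lt => //; exact: common_pts_sorted.
Qed.

(** On a common grid, each increment is shifted by the value of [q] on its cell times the length of
    the cell. This moves the integral of [ps k] by [step_ip (ps k) q], that is by 0, so the argument
    of [G] is unchanged; the density of the shift is the exponential of the integral of [q] minus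
    half of [step_ip q q]. *)
Lemma step_integral_orth_exp (m : nat) (ps : nat -> seq (R * (R * R))) q
    (G : m.-tuple R -> \bar R) :
  (forall k, (k < m)%N -> step_wf (ps k)) -> step_wf q ->
  (forall k, (k < m)%N -> step_ip (ps k) q = 0) ->
  measurable_fun [set: m.-tuple R] G -> (forall z, (0 <= G z)%E) ->
  (\int[P]_w ((expR (step_integral W q w))%:E *
              G (tup m (fun k => step_integral W (ps k)) w)) =
   (expR (step_ip q q / 2))%:E *
   \int[P]_w G (tup m (fun k => step_integral W (ps k)) w))%E.
Proof.
move=> wps wq orth mG G0.
pose L := q :: [seq ps k | k <- iota 0 m].
have wL p : p \in L -> step_wf p.
  rewrite inE => /predU1P[->//|/mapP[k]]; rewrite mem_iota add0n => km ->; exact: wps.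
set pts := common_pts L; set M := (size pts).-1.
have srt : sorted <%R pts by exact: common_pts_sorted.
have subq : {subset step_ends q <= pts} by apply: common_pts_sub; rewrite mem_head.
have subp k : (k < m)%N -> {subset step_ends (ps k) <= pts}.
  move=> km; apply: common_pts_sub; rewrite inE; apply/orP; right.
  by apply/mapP; exists k; rewrite ?mem_iota.
have gD := common_pts_gaussian wL; rewrite -/pts -/M in gD.
set D := (X in gaussian_seq _ _ X _) in gD.
set dl := (X in gaussian_seq _ _ _ X) in gD.
have [mD d0 _ _] := gD.
pose cq (l : nat) := step_fun q (gridpt pts l.+1).
pose cp (k l : nat) := step_fun (ps k) (gridpt pts l.+1).
have pE k w : (k < m)%N -> step_integral W (ps k) w = \sum_(l < M) cp k l * D l w.
  by move=> km; rewrite -(step_path_grid (fun t => W t w) srt (subp _ km))//; exact: wps.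
have qE w : step_integral W q w = \sum_(l < M) cq l * D l w.
  by rewrite -(step_path_grid (fun t => W t w) srt subq).
have ipq : step_ip q q = \sum_(l < M) cq l * cq l * dl l by rewrite (step_ip_grid srt subq subq).
have ipp k : (k < m)%N -> 0 = \sum_(l < M) cp k l * cq l * dl l.
  move=> km; rewrite -[LHS](orth _ km) [LHS](step_ip_grid srt (subp _ km) subq)//.
  exact: wps.
pose Z := tup m (fun k => step_integral W (ps k)).
pose lin (z : M.-tuple R) : m.-tuple R := [tuple \sum_(l < M) cp k l * tnth z l | k < m].
have mlin : measurable_fun [set: M.-tuple R] lin.
  apply/measurable_fun_tnthP => k.
  rewrite (_ : _ \o _ = fun z => \sum_(l < M) cp k l * tnth z l); last first.
    by apply/funext => z /=; rewrite tnth_mktuple.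
  by apply: measurable_sum => l; apply: measurable_funM => //; exact: measurable_tnth.
have := @integral_gaussian_affine _ _ _ P M D (fun l => cq l * dl l) (fun=> 1) dl
  (G \o lin) gD (fun _ _ => ltr01) (measurableT_comp mG mlin) (fun=> G0 _).
have -> : (fun w => (G \o lin) (tup M (fun k w0 => cq k * dl k + 1 * D k w0) w)) =
    (fun w => G (Z w)).
  apply/funext => w /=; congr G; apply: eq_from_tnth => k.
  rewrite tnth_mktuple tnth_tup pE//.
  under eq_bigr do rewrite tnth_tup mul1r mulrDr mulrA.
  by rewrite big_split/= -ipp// add0r.
move=> H; rewrite -/Z H -ge0_integralZl//.
- apply: eq_integral => w _; rewrite muleA -EFinM; congr (_%:E * G _)%E; last first.
    by apply: eq_from_tnth => k; rewrite tnth_tup tnth_mktuple pE//; apply: eq_bigr => l _; rewrite tnth_tup.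
  have -> : \prod_(l < M) gauss_ratio (cq l * dl l) 1 (dl l) (D l w) =
      expR (\sum_(l < M) (cq l * D l w - cq l * cq l * dl l / 2)).
    rewrite expR_sum; apply: eq_bigr => l _.
    rewrite /gauss_ratio invr1 mul1r; congr expR.
    by field; rewrite gt_eqF// d0.
  rewrite qE ipq mulr_suml -expRD -big_split/=; congr expR.
  by apply: eq_bigr => l _; rewrite addrC subrK.
- apply: emeasurable_funM; last first.
    apply: (measurableT_comp mG); apply: (measurableT_comp mlin).
    exact: measurable_tup.
  apply/measurable_EFinP; apply: measurable_prod => k _.
  by apply: measurableT_comp; [exact: measurable_gauss_ratio|exact: mD].
- move=> w _; apply: mule_ge0; last exact: G0.
  rewrite lee_fin.
  by apply: prodr_ge0 => k _; exact: gauss_ratio_ge0.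
Qed.

End BrownianSteps.

(** * Real-valued integrable functions *)

Section RealIntegrable.
Context (R : realType) (d : measure_display) (T : measurableType d).
Variable mu : {measure set T -> \bar R}.
Implicit Types f g : T -> R.

Definition itg f := mu.-integrable setT (EFin \o f).

Lemma itg_measurable f : itg f -> measurable_fun [set: T] f.
Proof. by move=> /measurable_int /measurable_EFinP. Qed.

Lemma itgD f g : itg f -> itg g -> itg (fun x => f x + g x).
Proof. by move=> fi gi; have := integrableD measurableT fi gi. Qed.

Lemma itgZ c f : itg f -> itg (fun x => c * f x).
Proof. by move=> fi; have := integrableZl measurableT c fi. Qed.

Lemma itgN f : itg f -> itg (fun x => - f x).
Proof. by move=> /(itgZ (-1)); under eq_fun do rewrite mulN1r. Qed.

Lemma itgB f g : itg f -> itg g -> itg (fun x => f x - g x).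
Proof. by move=> fi /itgN; exact: itgD. Qed.

Lemma itg_le g f : measurable_fun [set: T] f -> (forall x, `|f x| <= g x) ->
  itg g -> itg f.
Proof.
move=> mf fg; apply: le_integrable => //; first exact/measurable_EFinP.
by move=> x _ /=; rewrite lee_fin (le_trans (fg x))// ler_norm.
Qed.

Lemma itg_norm f : itg f -> itg (fun x => `|f x|).
Proof. by move=> fi; have := integrable_abse fi. Qed.

Lemma itg_sum (I : Type) (s : seq I) (P : pred I) (F : I -> T -> R) :
  (forall i, P i -> itg (F i)) -> itg (fun x => \sum_(i <- s | P i) F i x).
Proof.
move=> Fi; elim: s => [|i s IH].
  under eq_fun do rewrite big_nil; rewrite /itg.
  by rewrite (_ : _ \o _ = cst 0%E)//; exact: integrable0.
case Pi : (P i); under eq_fun do rewrite big_cons Pi.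
  by apply: itgD => //; exact: Fi.
exact: IH.
Qed.

Lemma ge0_itgP f : measurable_fun [set: T] f -> (forall x, 0 <= f x) ->
  (\int[mu]_x (f x)%:E < +oo)%E -> itg f.
Proof.
move=> mf f0 foo; apply/integrableP; split; first exact/measurable_EFinP.
rewrite (eq_integral (EFin \o f))// => x _.
by rewrite /= ger0_norm.
Qed.

Lemma itg_ge0_fin f : itg f -> (forall x, 0 <= f x) ->
  (\int[mu]_x (f x)%:E < +oo)%E.
Proof.
move=> /integrableP[_ foo] f0; rewrite (eq_integral (fun x => `|(EFin \o f) x|%E))//.
by move=> x _; rewrite /= ger0_norm.
Qed.

Lemma EFin_Rintegral f : itg f -> (\int[mu]_x f x)%:E = (\int[mu]_x (f x)%:E)%E.
Proof. by move=> fi; rewrite /Rintegral fineK//; exact: integrable_fin_num. Qed.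

Lemma Rintegral_sum (I : Type) (s : seq I) (P : pred I) (F : I -> T -> R) :
  (forall i, P i -> itg (F i)) ->
  \int[mu]_x (\sum_(i <- s | P i) F i x) = \sum_(i <- s | P i) \int[mu]_x F i x.
Proof.
move=> Fi; elim: s => [|i s IH].
  under eq_Rintegral do rewrite big_nil.
  by rewrite big_nil /Rintegral integral0.
rewrite big_cons; case Pi : (P i); under eq_Rintegral do rewrite big_cons Pi.
  by rewrite RintegralD// ?IH//; [exact: Fi|exact: itg_sum].
exact: IH.
Qed.

End RealIntegrable.

(** * Taylor bounds for the exponential *)

Section ExpInequalities.
Context (R : realType).
Implicit Types (x : R) (f df : R -> R).

Lemma derive_ge0_ge f df : (forall x, is_derive x 1 f (df x)) ->
  (forall x, 0 <= x -> 0 <= df x) -> forall x, 0 <= x -> f 0 <= f x.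
Proof.
move=> fd df0 x; rewrite le_eqVlt => /predU1P[<-//|x0].
have [|c + E] := @MVT R f df 0 x x0 (fun y _ => fd y).
  apply: continuous_subspaceT => y.
  exact/differentiable_continuous/derivable1_diffP/ex_derive.
rewrite in_itv/= => /andP[c0 _].
by rewrite -subr_ge0 E mulr_ge0 ?df0 ?subr0// ltW.
Qed.

(** The Taylor polynomial p of odd degree three lies below exp on both sides of 0: along x >= 0, the
    derivative of - p(e x) exp (- e x) is x^3 / 6 exp (- e x) for either sign e, since e^4 = 1. *)
Lemma expR_ge_cubic x : 1 + x + x ^+ 2 / 2 + x ^+ 3 / 6 <= expR x.
Proof.
suff pos : forall e : R, e = 1 \/ e = -1 -> forall x, 0 <= x ->
    (1 + e * x + (e * x) ^+ 2 / 2 + (e * x) ^+ 3 / 6) * expR (- (e * x)) <= 1.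
  have H (e : R) : e = 1 \/ e = -1 -> 0 <= e * x ->
      1 + x + x ^+ 2 / 2 + x ^+ 3 / 6 <= expR x.
    move=> e1 ex; have := pos _ e1 _ ex.
    have -> : e * (e * x) = x by case: e1 => ->; ring.
    by rewrite expRN ler_pdivrMr ?expR_gt0// mul1r.
  have [x0|x0] := leP 0 x; first by apply: (H 1); [left|rewrite mul1r].
  by apply: (H (-1)); [right|rewrite mulN1r oppr_ge0 ltW].
move=> e e1 {}x x0.
pose f x := - ((1 + e * x + (e * x) ^+ 2 / 2 + (e * x) ^+ 3 / 6) * expR (- (e * x))).
have : f 0 <= f x.
  apply: (@derive_ge0_ge f (fun x => x ^+ 3 / 6 * expR (- (e * x)))) => // y.
    rewrite /f; apply: is_derive_eq.
    by case: e1 => ->; rewrite /GRing.scale/=; field.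
  by move=> y0; rewrite mulr_ge0 ?expR_ge0// divr_ge0// exprn_ge0.
by rewrite /f mulr0 oppr0 expR0 expr0n/= expr0n/= !mul0r !addr0 mul1r lerN2.
Qed.

Lemma expR_le_quadratic x : expR x <= 1 + x + x ^+ 2 / 2 * expR `|x|.
Proof.
have [x0|x0] := leP 0 x.
  rewrite ger0_norm//.
  pose f x := x ^+ 2 / 2 + (1 + x) * expR (- x).
  have : f 0 <= f x.
    apply: (@derive_ge0_ge f (fun x => x - x * expR (- x))) => // y.
      by rewrite /f; apply: is_derive_eq; rewrite /GRing.scale/=; field.
    move=> y0; rewrite -{1}[y]mulr1 -mulrBr mulr_ge0// subr_ge0.
    by rewrite -expR0 ler_expR oppr_le0.
  rewrite /f expr0n/= mul0r add0r addr0 oppr0 expR0 mulr1 => H1.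
  have := ler_wpM2r (expR_ge0 x) H1.
  by rewrite mulrDl -(mulrA (1 + x)) -expRD addNr expR0 mulr1 mul1r addrC.
have xn : 0 <= - x by rewrite oppr_ge0 ltW.
pose f x := x ^+ 2 / 2 + 1 - x - expR (- x).
have : f 0 <= f (- x).
  apply: (@derive_ge0_ge f (fun x => x - 1 + expR (- x))) => // y.
    by rewrite /f; apply: is_derive_eq; rewrite /GRing.scale/=; field.
  by move=> y0; have := expR_ge1Dx (- y); lra.
rewrite /f expr0n/= mul0r add0r subr0 oppr0 expR0 subrr opprK sqrrN => H1.
apply: (@le_trans _ _ (1 + x + x ^+ 2 / 2)); first lra.
rewrite lerD2l ler_peMr ?divr_ge0 ?sqr_ge0//.
by rewrite -expR0 ler_expR.
Qed.

Lemma exprn_le_expR n x : `|x| ^+ n <= n`!%:R * expR `|x|.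
Proof.
case: n => [|n]; first by rewrite expr0 fact0 mul1r -expR0 ler_expR.
have := expR_ge1Dxn n (normr_ge0 x); set y := `|x| ^+ n.+1 => H.
have f0 : (0 : R) < (n.+1)`!%:R by rewrite ltr0n fact_gt0.
rewrite -ler_pdivrMl// mulrC; apply: le_trans H; lra.
Qed.

Lemma expR_norm_le x : expR `|x| <= expR x + expR (- x).
Proof.
have [x0|x0] := leP 0 x; first by rewrite ger0_norm// lerDl expR_ge0.
by rewrite ltr0_norm// lerDr expR_ge0.
Qed.

Lemma le0_of_le_small (x K : R) : (forall l, 0 < l <= 1 -> x <= K * l) -> x <= 0.
Proof.
move=> H; rewrite leNgt; apply/negP => x0.
pose K' := `|K| + 1; have K0 : 0 < K' by rewrite ltr_wpDl.
pose l := Num.min 1 (x / (2 * K')).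
have l0 : 0 < l by rewrite lt_min ltr01 divr_gt0// mulr_gt0.
have := H l; rewrite l0 ge_min lexx => /(_ isT) xl.
have : x <= K' * l.
  by rewrite (le_trans xl)// ler_pM2r// /K' (le_trans (ler_norm K))// lerDl.
have : K' * l <= K' * (x / (2 * K')) by rewrite ler_pM2l// ge_min lexx orbT.
have -> : K' * (x / (2 * K')) = x / 2 by field; rewrite gt_eqF.
lra.
Qed.

(** Dividing by powers of [l] and letting it tend to 0, the odd coefficients are bounded from both
    sides by taking [l] and [- l], while the even one is bounded only from above. The cubic
    coefficient is reached once the quadratic one is known to vanish. *)
Lemma cubic_coeff_le (a b e C : R) :
  (forall l, `|l| <= 1 -> l * a + l ^+ 2 * b + l ^+ 3 * e <= C * l ^+ 4) ->
  [/\ a = 0, b <= 0 & b = 0 -> e = 0].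
Proof.
move=> H.
have Hp l : 0 < l <= 1 -> a + l * b + l ^+ 2 * e <= C * l ^+ 3.
  move=> /andP[l0 l1]; have := H l; rewrite (ger0_norm (ltW l0)) => /(_ l1) Hl.
  rewrite -(ler_pM2l l0).
  have -> : l * (a + l * b + l ^+ 2 * e) = l * a + l ^+ 2 * b + l ^+ 3 * e by ring.
  by have -> : l * (C * l ^+ 3) = C * l ^+ 4 by ring.
have Hm l : 0 < l <= 1 -> - a + l * b - l ^+ 2 * e <= C * l ^+ 3.
  move=> /andP[l0 l1]; have := H (- l); rewrite normrN (ger0_norm (ltW l0)) => /(_ l1) Hl.
  rewrite -(ler_pM2l l0).
  have -> : l * (- a + l * b - l ^+ 2 * e) =
      - l * a + (- l) ^+ 2 * b + (- l) ^+ 3 * e by ring.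
  by have -> : l * (C * l ^+ 3) = C * (- l) ^+ 4 by ring.
have bd (t u l : R) : 0 <= u -> u <= l -> - (`|t| * l) <= u * t /\ u * t <= `|t| * l.
  move=> u0 ul; have ut : `|u * t| <= `|t| * l.
    by rewrite normrM (ger0_norm u0) mulrC ler_wpM2l.
  split; last exact: le_trans (ler_norm _) ut.
  by rewrite lerNl (le_trans _ ut)// -normrN ler_norm.
have pw (l : R) n : 0 < l <= 1 -> 0 <= l ^+ n.+1 /\ l ^+ n.+1 <= l.
  move=> /andP[l0 l1]; split; first by rewrite exprn_ge0// ltW.
  by rewrite -{2}[l]expr1 ler_wiXn2l// ltW.
have a0 : a = 0.
  apply/eqP; rewrite eq_le; apply/andP; split.
    apply: (@le0_of_le_small _ (`|b| + `|e| + `|C|)) => l l01.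
    have Hl := Hp l l01; have [p1 q1] := pw l 0%N l01.
    have [p2 q2] := pw l 1%N l01; have [p3 q3] := pw l 2%N l01.
    have [B1 B2] := bd b _ _ p1 q1; have [E1 E2] := bd e _ _ p2 q2.
    have [C1 C2] := bd C _ _ p3 q3; rewrite expr1 in B1 B2.
    by rewrite !mulrDl; rewrite [C * _]mulrC in Hl; lra.
  rewrite -oppr_le0.
  apply: (@le0_of_le_small _ (`|b| + `|e| + `|C|)) => l l01.
  have Hl := Hm l l01; have [p1 q1] := pw l 0%N l01.
  have [p2 q2] := pw l 1%N l01; have [p3 q3] := pw l 2%N l01.
  have [B1 B2] := bd b _ _ p1 q1; have [E1 E2] := bd e _ _ p2 q2.
  have [C1 C2] := bd C _ _ p3 q3; rewrite expr1 in B1 B2.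
  by rewrite !mulrDl; rewrite [C * _]mulrC in Hl; lra.
subst a; split => //.
  apply: (@le0_of_le_small _ `|C|) => l l01.
  have := Hp l l01; have := Hm l l01 => H1 H2.
  have : l * b <= C * l ^+ 3 by lra.
  have [p2 q2] := pw l 1%N l01; have [C1 C2] := bd C _ _ p2 q2.
  have /andP[l0 l1] := l01; rewrite exprS mulrCA ler_pM2l// => Hb.
  by apply: (le_trans Hb); rewrite mulrC.
move=> b0; subst b; apply/eqP; rewrite eq_le; apply/andP; split.
  apply: (@le0_of_le_small _ C) => l l01; have Hl := Hp l l01.
  have /andP[l0 _] := l01; rewrite -(ler_pM2l (exprn_gt0 2 l0)).
  have -> : l ^+ 2 * (C * l) = C * l ^+ 3 by ring.
  by lra.
rewrite -oppr_le0.
apply: (@le0_of_le_small _ C) => l l01; have Hl := Hm l l01.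
have /andP[l0 _] := l01; rewrite -(ler_pM2l (exprn_gt0 2 l0)).
have -> : l ^+ 2 * (C * l) = C * l ^+ 3 by ring.
  by lra.
Qed.

End ExpInequalities.

(** * Moments from a one-sided Gaussian bound on the Laplace transform *)

Section MgfMoments.
Context (R : realType) (d : measure_display) (T : measurableType d).
Variable mu : {measure set T -> \bar R}.
Variables (g I : T -> R) (V : R).
Hypotheses (gi : itg mu g) (mI : measurable_fun [set: T] I).
Hypothesis g0 : forall x, 0 <= g x.
Hypothesis mgf : forall l,
  (\int[mu]_x (g x * expR (l * I x))%:E <=
   (expR (l ^+ 2 * V / 2))%:E * \int[mu]_x (g x)%:E)%E.

Let mg : measurable_fun [set: T] g. Proof. exact: itg_measurable gi. Qed.

Lemma mgf_itg_expR l : itg mu (fun x => g x * expR (l * I x)).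
Proof.
apply: ge0_itgP.
- apply: measurable_funM => //; apply: measurableT_comp => //.
  exact: measurable_funM.
- by move=> x; rewrite mulr_ge0// expR_ge0.
- by apply: (le_lt_trans (mgf l)); rewrite -EFin_Rintegral// -EFinM ltry.
Qed.

Lemma mgf_itg_expR_norm l : itg mu (fun x => g x * expR `|l * I x|).
Proof.
have /(itgD (mgf_itg_expR l)) := mgf_itg_expR (- l); apply: itg_le.
  apply: measurable_funM => //; apply: measurableT_comp => //.
  by apply: measurableT_comp => //; exact: measurable_funM.
move=> x; rewrite ger0_norm ?mulr_ge0 ?expR_ge0// mulNr -mulrDr ler_wpM2l//.
exact: expR_norm_le.
Qed.

Lemma mgf_itg_pow n : itg mu (fun x => g x * I x ^+ n).
Proof.
have := itgZ (n`!%:R) (mgf_itg_expR_norm 1); apply: itg_le.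
  by apply: measurable_funM => //; exact: measurable_funX.
move=> x; rewrite normrM (ger0_norm (g0 x)) normrX mulrCA ler_wpM2l// mul1r.
exact: exprn_le_expR.
Qed.

(** The Laplace transform is minorised by its cubic Taylor polynomial and majorised through the
    hypothesis. The difference is O(l^4) for both signs of [l], and [cubic_coeff_le] reads off the
    moments of [I] under the measure of density [g]. *)
Lemma mgf_moments :
  [/\ \int[mu]_x (g x * I x) = 0,
      \int[mu]_x (g x * I x ^+ 2) <= V * \int[mu]_x g x &
      \int[mu]_x (g x * I x ^+ 2) = V * \int[mu]_x g x ->
      \int[mu]_x (g x * I x ^+ 3) = 0].
Proof.
set m0 := \int[mu]_x g x.
set m1 := \int[mu]_x (g x * I x).
set m2 := \int[mu]_x (g x * I x ^+ 2).
set m3 := \int[mu]_x (g x * I x ^+ 3).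
have i1 : itg mu (fun x => g x * I x) by have := mgf_itg_pow 1; under eq_fun do rewrite expr1.
have i2 := mgf_itg_pow 2; have i3 := mgf_itg_pow 3.
have m00 : 0 <= m0 by apply: Rintegral_ge0.
(* With e = l^2 V / 2, the quadratic bound on exp e leaves the remainder e^2 / 2 exp |e|, at most
   l^4 V^2 / 8 exp |V| when |l| <= 1. *)
have H l : `|l| <= 1 -> l * m1 + l ^+ 2 * ((m2 - V * m0) / 2) + l ^+ 3 * (m3 / 6) <=
    m0 * (V ^+ 2 / 8 * expR `|V|) * l ^+ 4.
  move=> l1.
  have s1 : m0 + l * m1 + l ^+ 2 / 2 * m2 + l ^+ 3 / 6 * m3 <=
      \int[mu]_x (g x * expR (l * I x)).
    have k1 := itgZ l i1; have k2 := itgZ (l ^+ 2 / 2) i2.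
    have k3 := itgZ (l ^+ 3 / 6) i3.
    have j1 := itgD gi k1; have j2 := itgD j1 k2; have j3 := itgD j2 k3.
    rewrite /m0 /m1 /m2 /m3 -!RintegralZl// -!RintegralD//.
    apply: le_Rintegral => //; first exact: mgf_itg_expR.
    move=> x _.
    have -> : g x + l * (g x * I x) + l ^+ 2 / 2 * (g x * I x ^+ 2) +
        l ^+ 3 / 6 * (g x * I x ^+ 3) =
        g x * (1 + l * I x + (l * I x) ^+ 2 / 2 + (l * I x) ^+ 3 / 6) by field.
    by rewrite ler_wpM2l// expR_ge_cubic.
  have s2 : \int[mu]_x (g x * expR (l * I x)) <= expR (l ^+ 2 * V / 2) * m0.
    rewrite -lee_fin EFinM !EFin_Rintegral//; last exact: mgf_itg_expR.
  have s3 := expR_le_quadratic (l ^+ 2 * V / 2).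
  have s4 : expR `|l ^+ 2 * V / 2| <= expR `|V|.
    have l2 : l ^+ 2 <= 1 by rewrite -real_normK ?num_real// exprn_ile1.
    rewrite ler_expR normrM (normrM (l ^+ 2)) (ger0_norm (sqr_ge0 l)).
    rewrite (@ger0_norm _ 2^-1)//.
    have := normr_ge0 V; have := sqr_ge0 l; nra.
  have s5 : expR (l ^+ 2 * V / 2) * m0 <=
      (1 + l ^+ 2 * V / 2 + (l ^+ 2 * V / 2) ^+ 2 / 2 * expR `|V|) * m0.
    rewrite ler_wpM2r// (le_trans s3)// lerD2l ler_wpM2l// divr_ge0//.
    exact: sqr_ge0.
  have s6 := le_trans s1 (le_trans s2 s5).
  have -> : m0 * (V ^+ 2 / 8 * expR `|V|) * l ^+ 4 =
     (1 + l ^+ 2 * V / 2 + (l ^+ 2 * V / 2) ^+ 2 / 2 * expR `|V|) * m0 -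
     m0 - l ^+ 2 * V / 2 * m0 by field.
  have -> : l * m1 + l ^+ 2 * ((m2 - V * m0) / 2) + l ^+ 3 * (m3 / 6) =
     m0 + l * m1 + l ^+ 2 / 2 * m2 + l ^+ 3 / 6 * m3 - m0 -
     l ^+ 2 * V / 2 * m0 by field.
  by rewrite !lerD2r.
have [-> m2V m30] := cubic_coeff_le H; split => //.
  by move: m2V; rewrite pmulr_lle0// subr_le0.
move=> E; have : m3 / 6 = 0 by apply: m30; rewrite E subrr mul0r.
by move/eqP; rewrite mulf_eq0 invr_eq0 pnatr_eq0 orbF => /eqP.
Qed.

End MgfMoments.

(** * Square-integrable functions *)

Section SquareIntegrable.
Context (R : realType) (d : measure_display) (T : measurableType d).
Variable mu : {measure set T -> \bar R}.
Implicit Types f g u z : T -> R.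

Definition L2 f := measurable_fun [set: T] f /\ itg mu (fun x => f x ^+ 2).

Lemma L2_mul f g : L2 f -> L2 g -> itg mu (fun x => f x * g x).
Proof.
move=> [mf fi] [mg gi]; have := itgD fi gi; apply: itg_le; first exact: measurable_funM.
move=> x; have := sqr_ge0 (f x - g x); have := sqr_ge0 (f x + g x).
rewrite ler_norml; nra.
Qed.

Lemma L2D f g : L2 f -> L2 g -> L2 (fun x => f x + g x).
Proof.
move=> f2 g2; have [mf fi] := f2; have [mg gi] := g2; split; first exact: measurable_funD.
have := itgD fi (itgD (itgZ 2 (L2_mul f2 g2)) gi); congr itg.
by apply/funext => x; ring.
Qed.

Lemma L2Z c f : L2 f -> L2 (fun x => c * f x).
Proof.
move=> [mf fi]; split; first exact: measurable_funM.
by have := itgZ (c ^+ 2) fi; congr itg; apply/funext => x; ring.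
Qed.

Lemma L2B f g : L2 f -> L2 g -> L2 (fun x => f x - g x).
Proof.
move=> f2 /(L2Z (-1)) g2; have := L2D f2 g2; congr L2.
by apply/funext => x; rewrite mulN1r.
Qed.

Lemma L2_sum (I : Type) (s : seq I) (F : I -> T -> R) : (forall i, L2 (F i)) ->
  L2 (fun x => \sum_(i <- s) F i x).
Proof.
move=> F2; elim: s => [|i s IH].
  under eq_fun do rewrite big_nil; split => //.
  rewrite (_ : itg _ _ = itg mu (fun=> 0)); last by congr itg; apply/funext => x; rewrite expr0n.
  by rewrite /itg (_ : _ \o _ = cst 0%E)//; exact: integrable0.
by under eq_fun do rewrite big_cons; exact: L2D.
Qed.

Definition L2dist2 f g := \int[mu]_x ((f x - g x) ^+ 2).

(* Young: x^2 <= (1 + e) y^2 + (1 + 1/e) (y - x)^2. *)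
Lemma L2_norm_le e f g : 0 < e -> L2 f -> L2 g ->
  \int[mu]_x (f x ^+ 2) <=
  (1 + e) * \int[mu]_x (g x ^+ 2) + (1 + e^-1) * L2dist2 g f.
Proof.
move=> e0 f2 g2; have [_ gf] := L2B g2 f2; have [_ fi] := f2; have [_ gi] := g2.
have k1 := itgZ (1 + e) gi; have k2 := itgZ (1 + e^-1) gf; have k := itgD k1 k2.
rewrite /L2dist2 -!RintegralZl// -RintegralD//; apply: le_Rintegral => //.
move=> x _; have ei : 0 < e^-1 by rewrite invr_gt0.
have ee : e * e^-1 = 1 by rewrite divff// gt_eqF.
have := sqr_ge0 (e * g x + (g x - f x)).
set a := g x; set b := f x => H.
have : 0 <= e^-1 * (e * a + (a - b)) ^+ 2 by rewrite mulr_ge0// ltW.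
have -> : e^-1 * (e * a + (a - b)) ^+ 2 =
  (e * e^-1) * e * a ^+ 2 + 2 * (e * e^-1) * a * (a - b) + e^-1 * (a - b) ^+ 2 by ring.
rewrite ee; lra.
Qed.

(** Pythagoras: [c] is the coefficient of the orthogonal projection of [u] on [z], described by an
    equation instead of a quotient. *)
Lemma L2dist2_proj u z c : L2 u -> L2 z ->
  c * \int[mu]_x (z x ^+ 2) = \int[mu]_x (u x * z x) ->
  \int[mu]_x ((u x - c * z x) ^+ 2) <= \int[mu]_x (u x ^+ 2).
Proof.
move=> u2 z2 cE; have [_ ui] := u2; have [_ zi] := z2; have uz := L2_mul u2 z2.
rewrite (_ : \int[mu]_x ((u x - c * z x) ^+ 2) = \int[mu]_x (u x ^+ 2) +
  (- (2 * c) * \int[mu]_x (u x * z x) + c ^+ 2 * \int[mu]_x (z x ^+ 2))).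
  rewrite gerDl -cE; have : 0 <= \int[mu]_x (z x ^+ 2).
    by apply: Rintegral_ge0 => x _; exact: sqr_ge0.
  have := sqr_ge0 c; nra.
have k1 := itgZ (- (2 * c)) uz; have k2 := itgZ (c ^+ 2) zi; have k := itgD k1 k2.
rewrite -!RintegralZl// -!RintegralD//.
by apply: eq_Rintegral => x _; ring.
Qed.

End SquareIntegrable.

(** * Laplace transform and isometry for step integrals *)

Section StepIsometry.
Context (R : realType) (d : measure_display) (Omega : measurableType d).
Variables (P : probability Omega R) (W : R -> Omega -> R).
Hypothesis hW : brownian_motion P W.
Local Notation mu := (@lebesgue_measure R).
Implicit Types (p q r : seq (R * (R * R))).

Definition step_scale (c : R) p : seq (R * (R * R)) :=
  [seq (c * a.1, a.2) | a <- p].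

Lemma step_wf_cat p q : step_wf p -> step_wf q -> step_wf (p ++ q).
Proof. by move=> wp wq c; rewrite mem_cat => /orP[/wp|/wq]. Qed.

Lemma step_wf_scale c p : step_wf p -> step_wf (step_scale c p).
Proof. by move=> wp _ /mapP[a /wp ? ->]. Qed.

Lemma step_fun_cat p q x : step_fun (p ++ q) x = step_fun p x + step_fun q x.
Proof. by rewrite /step_fun big_cat. Qed.

Lemma step_fun_scale c p x : step_fun (step_scale c p) x = c * step_fun p x.
Proof.
rewrite /step_fun big_map mulr_sumr; apply: eq_bigr => a _.
by rewrite /= mulrA.
Qed.

Lemma step_integral_cat p q w :
  step_integral W (p ++ q) w = step_integral W p w + step_integral W q w.
Proof. by rewrite /step_integral big_cat. Qed.

Lemma step_integral_scale c p w :
  step_integral W (step_scale c p) w = c * step_integral W p w.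
Proof.
rewrite /step_integral big_map mulr_sumr; apply: eq_bigr => a _.
by rewrite /= mulrA.
Qed.

Lemma step_fun_L2 p : L2 mu (step_fun p).
Proof.
apply: L2_sum => -[c [u v]]; apply: L2Z; split; first exact: measurable_indic.
have := integrable_itv_indic u v 1; congr (integrable _ _ _).
apply/funext => x /=; rewrite mul1r indicE; congr (_%:E).
by case: (x \in _); rewrite ?expr1n ?expr0n.
Qed.

Lemma step_ip_catl p q r : step_ip (p ++ q) r = step_ip p r + step_ip q r.
Proof.
rewrite /step_ip -RintegralD//; try exact: L2_mul (step_fun_L2 _) (step_fun_L2 _).
by apply: eq_Rintegral => x _; rewrite step_fun_cat mulrDl.
Qed.

Lemma step_ip_scalel c p r : step_ip (step_scale c p) r = c * step_ip p r.
Proof.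
rewrite /step_ip -RintegralZl//; last exact: L2_mul (step_fun_L2 _) (step_fun_L2 _).
by apply: eq_Rintegral => x _; rewrite step_fun_scale mulrA.
Qed.

Lemma step_ipC p q : step_ip p q = step_ip q p.
Proof. by apply: eq_Rintegral => x _; rewrite mulrC. Qed.

Lemma step_ip_catr p q r : step_ip r (p ++ q) = step_ip r p + step_ip r q.
Proof. by rewrite step_ipC step_ip_catl !(step_ipC _ r). Qed.

Lemma step_ip_scaler c p r : step_ip r (step_scale c p) = c * step_ip r p.
Proof. by rewrite step_ipC step_ip_scalel step_ipC. Qed.

(** The case of [step_integral_orth_exp] in which the family of orthogonal steps is empty and [G] is
    1. *)
Lemma step_integral_mgf p l : step_wf p ->
  (\int[P]_w (expR (l * step_integral W p w))%:E =
   (expR (l ^+ 2 * step_ip p p / 2))%:E)%E.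
Proof.
move=> wp; have := @step_integral_orth_exp _ _ _ _ _ hW 0%N (fun=> [::])
  (step_scale l p) (fun=> 1%E).
move=> H; have {H} := H (fun k k0 => False_ind _ (notF k0)) (step_wf_scale wp)
  (fun k k0 => False_ind _ (notF k0)) (measurable_cst _) (fun=> lee01).
rewrite integral_cst//= probability_setT !mule1 step_ip_scalel step_ip_scaler mulrA -expr2 => <-.
by apply: eq_integral => w _; rewrite mule1 step_integral_scale.
Qed.

Lemma itg_cst1 (c : R) : itg P (fun=> c).
Proof. exact: finite_measure_integrable_cst. Qed.

Lemma Rintegral_P_cst (c : R) : \int[P]_w c = c.
Proof. by rewrite Rintegral_cst//= probability_setT mulr1. Qed.

Section OneStep.
Variable p : seq (R * (R * R)).
Hypothesis wp : step_wf p.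
Local Notation L := (step_integral W p).
Local Notation V := (step_ip p p).

Let mL : measurable_fun [set: Omega] L.
Proof. exact: (measurable_step_integral hW). Qed.

Let mgf l : (\int[P]_x (1 * expR (l * L x))%:E <=
   (expR (l ^+ 2 * V / 2))%:E * \int[P]_x 1%:E)%E.
Proof.
rewrite integral_cst//= probability_setT !mule1.
under eq_integral do rewrite mul1r.
by rewrite step_integral_mgf//.
Qed.

Lemma step_integral_itg_expR (l : R) : itg P (fun w => expR `|l * L w|).
Proof.
have := @mgf_itg_expR_norm _ _ _ P (fun=> 1) L V (itg_cst1 1) mL (fun=> ler01) mgf l.
by under eq_fun do rewrite mul1r.
Qed.

Lemma step_integral_itg_pow k : itg P (fun w => L w ^+ k).
Proof.
have := @mgf_itg_pow _ _ _ P (fun=> 1) L V (itg_cst1 1) mL (fun=> ler01) mgf k.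
by under eq_fun do rewrite mul1r.
Qed.

Lemma step_integral_L2 : L2 P L.
Proof. by split => //; exact: step_integral_itg_pow. Qed.

(** [mgf_moments] gives the zero mean and one inequality. For the other, exp (l^2 V / 2) >= 1 + l^2
    V / 2 is compared with an upper expansion of E exp (l L) to order two, whose error is l^3 / 2
    times the expectation of |L|^3 exp |L|; then [l] tends to 0. *)
Lemma step_integral_norm2 : \int[P]_w (L w ^+ 2) = V.
Proof.
have [E1 E2 _] := @mgf_moments _ _ _ P (fun=> 1) L V (itg_cst1 1) mL (fun=> ler01) mgf.
move: E1 E2; rewrite Rintegral_P_cst mulr1.
under eq_Rintegral do rewrite mul1r; under [in X in _ -> X]eq_Rintegral do rewrite mul1r.
move=> E1 E2; apply/eqP; rewrite eq_le E2/= -subr_le0.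
have i1 : itg P L by have := step_integral_itg_pow 1; under eq_fun do rewrite expr1.
have i2 := step_integral_itg_pow 2.
have i3 : itg P (fun w => `|L w| ^+ 3 * expR `|L w|).
  have := itgZ (3`!%:R) (step_integral_itg_expR 2); apply: itg_le.
    apply: measurable_funM; last by apply: measurableT_comp => //; exact: measurableT_comp.
    by apply: measurable_funX; exact: measurableT_comp.
  move=> w; rewrite ger0_norm ?mulr_ge0 ?exprn_ge0 ?expR_ge0//.
  have -> : `|2 * L w| = `|L w| + `|L w| by rewrite normrM (@ger0_norm _ 2)//; ring.
  rewrite expRD mulrA ler_wpM2r ?expR_ge0//.
  exact: exprn_le_expR.
apply: (@le0_of_le_small _ _ (\int[P]_w (`|L w| ^+ 3 * expR `|L w|))) => l /andP[l0 l1].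
have s1 : 1 + l ^+ 2 * V / 2 <= \int[P]_w expR (l * L w).
  rewrite /Rintegral step_integral_mgf//=; exact: expR_ge1Dx.
have s2 : \int[P]_w expR (l * L w) <=
  1 + l * \int[P]_w L w + l ^+ 2 / 2 * (\int[P]_w (L w ^+ 2) +
    l * \int[P]_w (`|L w| ^+ 3 * expR `|L w|)).
  have c1 := itg_cst1 1; have k1 := itgZ l i1; have j1 := itgD c1 k1.
  have k3 := itgZ l i3; have j2 := itgD i2 k3; have k2 := itgZ (l ^+ 2 / 2) j2.
  have j3 := itgD j1 k2.
  rewrite -{1}[1]Rintegral_P_cst -!RintegralZl// -!RintegralD// -!RintegralZl// -!RintegralD//.
  apply: le_Rintegral => //.
    have := step_integral_itg_expR l; apply: itg_le.
      by apply: measurableT_comp => //; exact: measurable_funM.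
    by move=> w; rewrite ger0_norm ?expR_ge0// ler_expR ler_norm.
  move=> w _; apply: (le_trans (expR_le_quadratic _)).
  rewrite lerD2l exprMn [X in X * _](_ : _ = l ^+ 2 / 2 * L w ^+ 2); last by ring.
  rewrite -(mulrA (l ^+ 2 / 2)); apply: ler_wpM2l; first by rewrite divr_ge0 ?sqr_ge0.
  have /(ler_wpM2l (sqr_ge0 (L w))) : expR `|l * L w| <= 1 + `|l * L w| * expR `|l * L w|.
    have := expR_ge1Dx (- `|l * L w|); rewrite expRN => H.
    have := ler_wpM2r (expR_ge0 `|l * L w|) H.
    by rewrite mulVf ?gt_eqF ?expR_gt0// mulrDl mul1r mulNr; lra.
  move=> /le_trans; apply.
  rewrite mulrDr mulr1 lerD2l normrM (gtr0_norm l0).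
  rewrite -[L w ^+ 2]real_normK ?num_real//.
  have -> : `|L w| ^+ 2 * (l * `|L w| * expR (l * `|L w|)) =
     l * (`|L w| ^+ 3 * expR (l * `|L w|)) by ring.
  rewrite ler_wpM2l ?(ltW l0)// ler_wpM2l ?exprn_ge0// ler_expR.
  by rewrite ler_piMl.
have := le_trans s1 s2; rewrite E1 mulr0 addr0.
set A := \int[P]_w (L w ^+ 2); set B := \int[P]_w (_ * _) => H.
have : l ^+ 2 / 2 * (V - A - l * B) <= 0 by lra.
by rewrite pmulr_rle0 ?divr_gt0 ?exprn_gt0//; lra.
Qed.

End OneStep.

Lemma step_isometry p q : step_wf p -> step_wf q ->
  \int[P]_w (step_integral W p w * step_integral W q w) = step_ip p q.
Proof.
move=> wp wq.
have := step_integral_norm2 (step_wf_cat wp wq).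
rewrite !step_ip_catl !step_ip_catr (step_ipC q p).
have Lp := step_integral_L2 wp; have Lq := step_integral_L2 wq.
have i1 := L2_mul Lp Lq; have [_ i2] := Lp; have [_ i3] := Lq.
under eq_Rintegral do rewrite step_integral_cat sqrrD -mulr_natl.
have k1 := itgZ 2 i1; have j1 := itgD i2 k1.
rewrite RintegralD// RintegralD// RintegralZl// !step_integral_norm2//; lra.
Qed.

End StepIsometry.

(** * Passing to the limit in truncations *)

Section Truncation.
Context (R : realType) (d : measure_display) (T : measurableType d).
Variable mu : {measure set T -> \bar R}.

(** Monotone convergence for truncations: at each point the sequence is eventually equal to its
    limit. *)
Lemma ge0_integral_le_approx (F : nat -> T -> R) (f : T -> R) (B : \bar R) :
  (forall n, measurable_fun [set: T] (F n)) -> (forall n x, 0 <= F n x) ->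
  (forall x m n, (m <= n)%N -> F m x <= F n x) ->
  (forall x, exists N, forall n, (N <= n)%N -> F n x = f x) ->
  (forall n, (\int[mu]_x (F n x)%:E <= B)%E) ->
  (\int[mu]_x (f x)%:E <= B)%E.
Proof.
move=> mF F0 ndF Ff FB.
have mF' n : measurable_fun [set: T] (fun x => (F n x)%:E) by exact/measurable_EFinP.
have F0' n x : [set: T] x -> (0 <= (F n x)%:E)%E by rewrite lee_fin.
have ndF' x : [set: T] x -> {homo (fun n => (F n x)%:E) : n m / (n <= m)%N >-> (n <= m)%E}.
  by move=> _ n m nm; rewrite lee_fin ndF.
have := @cvg_monotone_convergence _ _ _ mu _ measurableT _ mF' F0' ndF'.
have -> : (fun x0 : T => limn ((fun n x => (F n x)%:E)^~ x0)) = (fun x => (f x)%:E).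
  apply/funext => x; apply: lim_near_cst; first exact: ereal_hausdorff.
  have [N NF] := Ff x; exists N => // n /= Nn; by rewrite NF.
move=> /cvge_to_le; apply; by near=> n.
Unshelve. all: by end_near. Qed.

End Truncation.

(** * Wiener integrals as L2 limits, and their isometry *)

Section WienerClass.
Context (R : realType) (d : measure_display) (Omega : measurableType d).
Variables (P : probability Omega R) (W : R -> Omega -> R).
Hypothesis hW : brownian_motion P W.
Local Notation mu := (@lebesgue_measure R).
Implicit Types (f g : R -> R) (I J : Omega -> R) (p q : seq (R * (R * R))).

(* [f] is extended by zero outside the interval of integration. *)
Definition wiener f I : Prop :=
  [/\ L2 mu f, L2 P I & forall e, 0 < e -> exists q,
     [/\ step_wf q, L2dist2 mu (step_fun q) f <= e &
         L2dist2 P (step_integral W q) I <= e]].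

Lemma wiener_step q : step_wf q -> wiener (step_fun q) (step_integral W q).
Proof.
move=> wq; split; [exact: step_fun_L2|exact: step_integral_L2|] => e e0.
exists q; split => //; rewrite /L2dist2; under eq_Rintegral do rewrite subrr expr0n.
  by rewrite /Rintegral integral0/= ltW.
by rewrite /Rintegral integral0/= ltW.
Qed.

Lemma wienerZ c f I : wiener f I -> wiener (fun x => c * f x) (fun w => c * I w).
Proof.
move=> [f2 I2 H]; split; [exact: L2Z|exact: L2Z|] => e e0.
have c1 : 0 < c ^+ 2 + 1 by rewrite ltr_wpDl// sqr_ge0.
have [q [wq qf qI]] := H (e / (c ^+ 2 + 1)) (divr_gt0 e0 c1).
have ce : c ^+ 2 * (e / (c ^+ 2 + 1)) <= e.
  by rewrite mulrA ler_pdivrMr// mulrC ler_pM2l// lerDl.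
exists (step_scale c q); split; first exact: step_wf_scale.
  have [_ i] := L2B (step_fun_L2 q) f2.
  rewrite /L2dist2 (_ : \int[mu]_x _ = c ^+ 2 * L2dist2 mu (step_fun q) f).
    by apply: le_trans ce; rewrite ler_wpM2l// sqr_ge0.
  rewrite /L2dist2 -RintegralZl//; apply: eq_Rintegral => x _.
  by rewrite step_fun_scale; ring.
have [_ i] := L2B (step_integral_L2 hW wq) I2.
rewrite /L2dist2 (_ : \int[P]_x _ = c ^+ 2 * L2dist2 P (step_integral W q) I).
  by apply: le_trans ce; rewrite ler_wpM2l// sqr_ge0.
rewrite /L2dist2 -RintegralZl//; apply: eq_Rintegral => x _.
by rewrite step_integral_scale; ring.
Qed.

Lemma L2dist2D (d' : measure_display) (T : measurableType d')
    (nu : {measure set T -> \bar R}) (f1 f2 g1 g2 : T -> R) :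
  L2 nu f1 -> L2 nu f2 -> L2 nu g1 -> L2 nu g2 ->
  L2dist2 nu (fun x => f1 x + f2 x) (fun x => g1 x + g2 x) <=
  2 * L2dist2 nu f1 g1 + 2 * L2dist2 nu f2 g2.
Proof.
move=> f12 f22 g12 g22; have [_ i1] := L2B f12 g12; have [_ i2] := L2B f22 g22.
have [_ i3] := L2B (L2D f12 f22) (L2D g12 g22).
have k1 := itgZ 2 i1; have k2 := itgZ 2 i2; have j := itgD k1 k2.
rewrite /L2dist2 -!RintegralZl// -RintegralD//; apply: le_Rintegral => // x _.
have := sqr_ge0 (f1 x - g1 x - (f2 x - g2 x)); lra.
Qed.

Lemma wienerD f g I J : wiener f I -> wiener g J ->
  wiener (fun x => f x + g x) (fun w => I w + J w).
Proof.
move=> [f2 I2 Hf] [g2 J2 Hg]; split; [exact: L2D|exact: L2D|] => e e0.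
have e4 : 0 < e / 4 by rewrite divr_gt0.
have [q1 [wq1 qf1 qI1]] := Hf _ e4; have [q2 [wq2 qf2 qI2]] := Hg _ e4.
exists (q1 ++ q2); split; first exact: step_wf_cat.
  rewrite /L2dist2; under eq_Rintegral do rewrite step_fun_cat.
  have := L2dist2D (step_fun_L2 q1) (step_fun_L2 q2) f2 g2; rewrite {1}/L2dist2.
  move=> /le_trans; apply; lra.
rewrite /L2dist2; under eq_Rintegral do rewrite step_integral_cat.
have := L2dist2D (step_integral_L2 hW wq1) (step_integral_L2 hW wq2) I2 J2.
rewrite {1}/L2dist2 => /le_trans; apply; lra.
Qed.

Lemma wienerB f g I J : wiener f I -> wiener g J ->
  wiener (fun x => f x - g x) (fun w => I w - J w).
Proof.
move=> fI /(wienerZ (-1)) /(wienerD fI); congr wiener; apply/funext => x;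
by rewrite mulN1r.
Qed.

(** Comparison of two norms through an intermediate one, at the price of two Young inequalities.
    Taking e = s^2 / 2 makes the error (1 + 1/s) e equal to (s^2 + s) / 2, which vanishes with
    [s]. *)
Lemma le_of_young (A B : R) : 0 <= B ->
  (forall s e, 0 < s -> 0 < e -> exists v, A <= (1 + s) * v + (1 + s^-1) * e /\
     v <= (1 + s) * B + (1 + s^-1) * e) -> A <= B.
Proof.
move=> B0 H; rewrite -subr_le0.
apply: (@le0_of_le_small _ _ (3 * B + 3)) => s /andP[s0 s1].
have [|v [Av vB]] := H s (s ^+ 2 / 2) s0; first by rewrite divr_gt0// exprn_gt0.
have se : (1 + s^-1) * (s ^+ 2 / 2) = (s ^+ 2 + s) / 2.
  by field; rewrite gt_eqF.
rewrite se in Av vB.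
have : (1 + s) * v <= (1 + s) * ((1 + s) * B + (s ^+ 2 + s) / 2).
  by rewrite ler_pM2l// ltr_wpDr// ltW.
have s2 : s ^+ 2 <= s by rewrite expr2 ler_piMr// ltW.
have : s ^+ 2 * B <= s * B by rewrite ler_wpM2r.
have sB : s * B <= s * B by [].
have s3 : s ^+ 3 <= s ^+ 2 by rewrite -[leRHS]mulr1 exprSr ler_wpM2l// sqr_ge0.
have -> : (1 + s) * ((1 + s) * B + (s ^+ 2 + s) / 2) =
  B + 2 * (s * B) + s ^+ 2 * B + (s ^+ 3 + 2 * s ^+ 2 + s) / 2 by field.
lra.
Qed.

(** Each inequality goes through [step_ip q q], where [q] approximates [f] and its step integral
    approximates [I]; on steps the two norms agree. *)
Lemma wiener_norm2 f I : wiener f I -> \int[P]_w (I w ^+ 2) = \int[mu]_x (f x ^+ 2).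
Proof.
move=> [f2 I2 H]; apply/eqP; rewrite eq_le; apply/andP; split.
  apply: le_of_young => [|s e s0 e0]; first by apply: Rintegral_ge0 => x _; exact: sqr_ge0.
  have [q [wq qf qI]] := H _ e0; exists (step_ip q q); split.
    rewrite -(step_integral_norm2 hW wq).
    apply: (le_trans (L2_norm_le s0 I2 (step_integral_L2 hW wq))).
    by rewrite lerD2l ler_wpM2l// addr_ge0// invr_ge0 ltW.
  have := L2_norm_le s0 (step_fun_L2 q) f2; rewrite /step_ip.
  under eq_Rintegral do rewrite expr2.
  move=> /le_trans; apply.
  rewrite lerD2l ler_wpM2l ?addr_ge0 ?invr_ge0 ?(ltW s0)//.
  apply: le_trans qf; rewrite /L2dist2 le_eqVlt; apply/orP; left; apply/eqP.
  by apply: eq_Rintegral => x _; ring.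
apply: le_of_young => [|s e s0 e0]; first by apply: Rintegral_ge0 => x _; exact: sqr_ge0.
have [q [wq qf qI]] := H _ e0; exists (step_ip q q); split.
  rewrite /step_ip; under [X in _ <= _ * X + _]eq_Rintegral do rewrite -expr2.
  apply: (le_trans (L2_norm_le s0 f2 (step_fun_L2 q))).
  by rewrite lerD2l ler_wpM2l// addr_ge0// invr_ge0 ltW.
rewrite -(step_integral_norm2 hW wq).
apply: (le_trans (L2_norm_le s0 (step_integral_L2 hW wq) I2)).
rewrite lerD2l ler_wpM2l ?addr_ge0 ?invr_ge0 ?(ltW s0)//.
apply: le_trans qI; rewrite /L2dist2 le_eqVlt; apply/orP; left; apply/eqP.
by apply: eq_Rintegral => x _; ring.
Qed.

Lemma wiener_isometry f g I J : wiener f I -> wiener g J ->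
  \int[P]_w (I w * J w) = \int[mu]_x (f x * g x).
Proof.
move=> fI gJ; have := wiener_norm2 (wienerD fI gJ).
have [f2 I2 _] := fI; have [g2 J2 _] := gJ.
have [_ i1] := f2; have [_ i2] := g2; have i3 := L2_mul f2 g2.
have [_ j1] := I2; have [_ j2] := J2; have j3 := L2_mul I2 J2.
under eq_Rintegral do rewrite sqrrD -mulr_natl.
under [X in _ = X -> _]eq_Rintegral do rewrite sqrrD -mulr_natl.
have k1 := itgZ 2 i3; have k2 := itgZ 2 j3; have l1 := itgD i1 k1; have l2 := itgD j1 k2.
rewrite !RintegralD// !RintegralZl// (wiener_norm2 fI) (wiener_norm2 gJ); lra.
Qed.

Section Orthogonal.
Variables (m : nat) (zs : nat -> seq (R * (R * R))).
Hypothesis wz : forall k, (k < m)%N -> step_wf (zs k).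
Hypothesis zz : forall k l, (k < m)%N -> (l < m)%N -> k != l -> step_ip (zs k) (zs l) = 0.
Hypothesis z0 : forall k, (k < m)%N -> step_ip (zs k) (zs k) != 0.

(* Orthogonalising an approximation one cell at a time does not increase the
   distance to [f] because [f] is orthogonal to the cells. *)
Lemma wiener_orth_approx f I : wiener f I ->
  (forall k, (k < m)%N -> \int[mu]_x (f x * step_fun (zs k) x) = 0) ->
  forall e, 0 < e -> exists q,
    [/\ step_wf q, L2dist2 mu (step_fun q) f <= e,
        L2dist2 P (step_integral W q) I <= e &
        forall k, (k < m)%N -> step_ip (zs k) q = 0].
Proof.
move=> fI orth e e0; have [f2 I2 H] := fI.
suff : forall j, (j <= m)%N -> exists q,
    [/\ step_wf q, L2dist2 mu (step_fun q) f <= e,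
        L2dist2 P (step_integral W q) I <= e &
        forall k, (k < j)%N -> step_ip (zs k) q = 0] by apply.
elim=> [_|j IH jm].
  by have [q [wq qf qI]] := H _ e0; exists q; split.
have [q [wq qf qI qo]] := IH (ltnW jm).
(* Coefficient of the projection of [q] on the cell treated at this stage. The orthogonality to
   earlier cells survives because the cells are orthogonal to one another. *)
pose c := step_ip q (zs j) / step_ip (zs j) (zs j).
have wzj := wz jm.
have cz : c * step_ip (zs j) (zs j) = step_ip q (zs j) by rewrite divfK// z0.
exists (q ++ step_scale (- c) (zs j)); split.
- by apply: step_wf_cat => //; exact: step_wf_scale.
- apply: le_trans qf; rewrite /L2dist2.
  have u2 := L2B (step_fun_L2 q) f2; have z2 := step_fun_L2 (zs j).
  have i1 := L2_mul (step_fun_L2 q) z2; have i2 := L2_mul f2 z2.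
  rewrite (_ : \int[mu]_x _ =
    \int[mu]_x ((step_fun q x - f x - c * step_fun (zs j) x) ^+ 2)); last first.
    by apply: eq_Rintegral => x _; rewrite step_fun_cat step_fun_scale; ring.
  apply: L2dist2_proj => //.
  under [RHS]eq_Rintegral do rewrite mulrBl.
  rewrite RintegralB//.
  rewrite orth// subr0 -[RHS]cz /step_ip.
  by under eq_Rintegral do rewrite expr2.
(* By the isometry, the same [c] is the projection coefficient in L2(P), and [I] is orthogonal to
   the increment over the cell; hence the distance to [I] does not grow either. *)
- apply: le_trans qI; rewrite /L2dist2.
  have q2 := step_integral_L2 hW wq; have z2 := step_integral_L2 hW wzj.
  have u2 := L2B q2 I2; have i1 := L2_mul q2 z2; have i2 := L2_mul I2 z2.
  rewrite (_ : \int[P]_w _ =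
    \int[P]_w ((step_integral W q w - I w - c * step_integral W (zs j) w) ^+ 2)); last first.
    by apply: eq_Rintegral => w _; rewrite step_integral_cat step_integral_scale; ring.
  apply: L2dist2_proj => //.
  under [RHS]eq_Rintegral do rewrite mulrBl.
  rewrite RintegralB//.
  rewrite (wiener_isometry fI (wiener_step wzj)) orth// subr0 [RHS](step_isometry hW)//.
  by rewrite -[RHS]cz (step_integral_norm2 hW).
move=> k; rewrite ltnS step_ip_catr step_ip_scaler leq_eqVlt => /predU1P[->|kj].
  by rewrite step_ipC mulNr cz subrr.
by rewrite qo// zz ?mulr0 ?addr0 ?(ltn_trans kj jm)//; rewrite ltn_eqF.
Qed.

End Orthogonal.

End WienerClass.

(** * Moments of an orthogonal Wiener integral against functions of Z *)

Section ConditionalMoments.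
Context (R : realType) (d : measure_display) (Omega : measurableType d).
Variables (P : probability Omega R) (W : R -> Omega -> R).
Hypothesis hW : brownian_motion P W.
Local Notation mu := (@lebesgue_measure R).
Variables (m : nat) (zs : nat -> seq (R * (R * R))).
Hypothesis wz : forall k, (k < m)%N -> step_wf (zs k).
Hypothesis zz : forall k l, (k < m)%N -> (l < m)%N -> k != l -> step_ip (zs k) (zs l) = 0.
Hypothesis z0 : forall k, (k < m)%N -> step_ip (zs k) (zs k) != 0.

Local Notation Z := (tup m (fun k => step_integral W (zs k))).

Let mZ : measurable_fun [set: Omega] Z.
Proof. by apply: measurable_tup => k km; apply: (measurable_step_integral hW); exact: wz. Qed.

Lemma step_orth_mgf (G : m.-tuple R -> R) q l : measurable_fun [set: m.-tuple R] G ->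
  (forall z, 0 <= G z) -> step_wf q -> (forall k, (k < m)%N -> step_ip (zs k) q = 0) ->
  (\int[P]_w (G (Z w) * expR (l * step_integral W q w))%:E =
   (expR (l ^+ 2 * step_ip q q / 2))%:E * \int[P]_w (G (Z w))%:E)%E.
Proof.
move=> mG G0 wq orth.
have ol k : (k < m)%N -> step_ip (zs k) (step_scale l q) = 0.
  by move=> km; rewrite step_ip_scaler orth// mulr0.
have G0' z : (0 <= (EFin \o G) z)%E by rewrite lee_fin.
have mG' : measurable_fun [set: m.-tuple R] (EFin \o G) by exact/measurable_EFinP.
have := step_integral_orth_exp hW wz (step_wf_scale wq) ol mG' G0'.
rewrite step_ip_scalel step_ip_scaler mulrA -expr2 => <-.
by apply: eq_integral => w _; rewrite step_integral_scale mulrC EFinM.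
Qed.

Lemma expR_le_exp1 (x : R) : 0 <= x -> expR x <= 1 + x * expR x.
Proof.
move=> x0; have := ler_wpM2r (expR_ge0 x) (expR_ge1Dx (- x)).
rewrite expRN mulVf ?gt_eqF ?expR_gt0//; lra.
Qed.

Variables (f : R -> R) (I : Omega -> R).
Hypothesis fI : wiener P W f I.
Hypothesis orth : forall k, (k < m)%N -> \int[mu]_x (f x * step_fun (zs k) x) = 0.
Local Notation V := (\int[mu]_x (f x ^+ 2)).

Let V0 : 0 <= V. Proof. by apply: Rintegral_ge0 => x _; exact: sqr_ge0. Qed.
Let mI : measurable_fun [set: Omega] I. Proof. by have [_ [] ] := fI. Qed.

Section Nonnegative.
Variable G : m.-tuple R -> R.
Hypotheses (mG : measurable_fun [set: m.-tuple R] G) (G0 : forall z, 0 <= G z).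
Local Notation g := (fun w => G (Z w)).
Hypothesis gi : itg P g.

Let mg : measurable_fun [set: Omega] g. Proof. exact: measurableT_comp. Qed.

(** L2 convergence of step integrals does not control their exponentials. Where both |I| and [g] are
    at most [K] the limiting integrand is bounded, and the comparison with the approximations
    becomes linear in their distance to [I]. *)
Let trunc l (K : nat) (w : Omega) : R :=
  if (`|I w| <= K%:R) && (g w <= K%:R) then g w * expR (l * I w) else 0.

Let mtrunc l K : measurable_fun [set: Omega] (trunc l K).
Proof.
rewrite /trunc; apply: measurable_fun_ifT => //.
  apply: measurable_and; apply: measurable_fun_ler => //.
  exact: measurableT_comp.
by apply: measurable_funM => //; apply: measurableT_comp => //; exact: measurable_funM.
Qed.

Let trunc_ge0 l K w : 0 <= trunc l K w.
Proof. by rewrite /trunc; case: ifP => // _; rewrite mulr_ge0 ?expR_ge0. Qed.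

Let bnd (l : R) (K : nat) : R := K%:R * expR (`|l| * K%:R).

Let trunc_le l K w : trunc l K w <= bnd l K.
Proof.
rewrite /trunc /bnd; case: ifP => [/andP[IK gK]|_]; last by rewrite mulr_ge0 ?expR_ge0.
apply: ler_pM => //; rewrite ?expR_ge0// ler_expR (le_trans (ler_norm _))//.
by rewrite normrM ler_wpM2l.
Qed.

Let itrunc l K : itg P (trunc l K).
Proof.
have := itg_cst1 P (bnd l K); apply: itg_le => // w.
by rewrite ger0_norm.
Qed.

(** The tangent inequality exp (l L) >= exp (l I) (1 + l (L - I)) bounds the truncated integrand by
    g exp (l L) plus a constant times |L - I|, and |L - I| <= s + (L - I)^2 / s brings in the L2
    distance. *)
Let trunc_step l K q : step_wf q -> (forall k, (k < m)%N -> step_ip (zs k) q = 0) ->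
  forall s e, 0 < s -> L2dist2 P (step_integral W q) I <= e ->
  \int[P]_w trunc l K w <= expR (l ^+ 2 * step_ip q q / 2) * \int[P]_w g w +
    bnd l K * `|l| * (s + s^-1 * e).
Proof.
move=> wq qo s e s0 qI; set L := step_integral W q.
have L2L := step_integral_L2 hW wq; have [_ L2I _] := fI.
have [mL _] := L2L; have [_ iLI] := L2B L2L L2I.
have iE : itg P (fun w => g w * expR (l * L w)).
  apply: ge0_itgP.
  - by apply: measurable_funM => //; apply: measurableT_comp => //; exact: measurable_funM.
  - by move=> w; rewrite mulr_ge0 ?expR_ge0.
  - by rewrite step_orth_mgf// -EFin_Rintegral// -EFinM ltry.
have -> : expR (l ^+ 2 * step_ip q q / 2) * \int[P]_w g w = \int[P]_w (g w * expR (l * L w)).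
  by apply: EFin_inj; rewrite EFinM EFin_Rintegral// [RHS]EFin_Rintegral// step_orth_mgf.
have c0 : 0 <= bnd l K * `|l| by rewrite !mulr_ge0 ?expR_ge0.
have i1 := itg_cst1 P s; have k1 := itgZ s^-1 iLI; have j1 := itgD i1 k1.
have k2 := itgZ (bnd l K * `|l|) j1; have j2 := itgD iE k2.
apply: (@le_trans _ _ (\int[P]_w (g w * expR (l * L w) +
    bnd l K * `|l| * (s + s^-1 * (L w - I w) ^+ 2)))); last first.
  rewrite RintegralD// RintegralZl// RintegralD// RintegralZl// Rintegral_P_cst.
  by rewrite lerD2l ler_wpM2l// lerD2l ler_wpM2l// invr_ge0 ltW.
apply: le_Rintegral => //; first exact: itrunc.
move=> w _.
have young : `|L w - I w| <= s + s^-1 * (L w - I w) ^+ 2.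
  have ss : s * s^-1 = 1 by rewrite divff// gt_eqF.
  have si : 0 < s^-1 by rewrite invr_gt0.
  have := mulr_ge0 (ltW si) (sqr_ge0 (s - `|L w - I w|)).
  rewrite -[(L w - I w) ^+ 2]real_normK ?num_real//; set x := `|L w - I w|.
  have -> : s^-1 * (s - x) ^+ 2 = s * (s * s^-1) - 2 * (s * s^-1) * x + s^-1 * x ^+ 2 by ring.
  have x0 : 0 <= x by exact: normr_ge0.
  by rewrite ss; lra.
have young0 := le_trans (normr_ge0 _) young.
rewrite /trunc; case: ifPn => [/andP[IK gK]|_]; last first.
  by rewrite addr_ge0// mulr_ge0// expR_ge0.
have tb : g w * expR (l * I w) <= bnd l K.
  by have := trunc_le l K w; rewrite /trunc IK gK.
have e1 : expR (l * I w) * (1 + l * (L w - I w)) <= expR (l * L w).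
  have := ler_wpM2l (expR_ge0 (l * I w)) (expR_ge1Dx (l * (L w - I w))).
  by rewrite -expRD; have -> : l * I w + l * (L w - I w) = l * L w by ring.
have e2 := ler_wpM2l (G0 (Z w)) e1.
have e3 : g w * expR (l * I w) * (- (l * (L w - I w))) <=
    bnd l K * (`|l| * (s + s^-1 * (L w - I w) ^+ 2)).
  apply: (@le_trans _ _ (g w * expR (l * I w) * (`|l| * `|L w - I w|))).
    rewrite ler_wpM2l ?mulr_ge0 ?expR_ge0// -normrM -normrN; exact: ler_norm.
  apply: ler_pM => //; rewrite ?mulr_ge0 ?expR_ge0//.
  exact: ler_wpM2l.
lra.
Qed.

(** A step function orthogonal to the cells is taken at squared distance s^2 / 2, so that the errors
    of [trunc_step] and the excess of [step_ip q q] over [V] are of order [s]; then [s] tends to 0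
    with [K] fixed. *)
Let trunc_bound l K : \int[P]_w trunc l K w <= expR (l ^+ 2 * V / 2) * \int[P]_w g w.
Proof.
rewrite -subr_le0; set m0 := \int[P]_w g w.
have m00 : 0 <= m0 by apply: Rintegral_ge0.
pose k := l ^+ 2 * (V + 1) / 2.
have k0 : 0 <= k by rewrite divr_ge0// mulr_ge0 ?sqr_ge0// addr_ge0.
have b0 : 0 <= bnd l K * `|l| by rewrite !mulr_ge0 ?expR_ge0.
apply: (@le0_of_le_small _ _ (expR (l ^+ 2 * V / 2) * m0 * (k * expR k) +
   2 * (bnd l K * `|l|))) => s /andP[s0 s1].
pose e := s ^+ 2 / 2; have e0 : 0 < e by rewrite divr_gt0// exprn_gt0.
have [q [wq qf qI qo]] := wiener_orth_approx hW wz zz z0 fI orth e0.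
have H := trunc_step l K wq qo s0 qI.
have [f2 _ _] := fI.
have ipq : step_ip q q <= V + s * (V + 1).
  have := L2_norm_le s0 (step_fun_L2 q) f2.
  rewrite /step_ip; under eq_Rintegral do rewrite expr2.
  move=> /le_trans; apply.
  have : (1 + s^-1) * L2dist2 mu f (step_fun q) <= (1 + s^-1) * e.
    rewrite ler_wpM2l ?addr_ge0 ?invr_ge0 ?(ltW s0)//; apply: le_trans qf.
    rewrite /L2dist2 le_eqVlt; apply/orP; left; apply/eqP.
    by apply: eq_Rintegral => x _; ring.
  have -> : (1 + s^-1) * e = (s ^+ 2 + s) / 2 by rewrite /e; field; rewrite gt_eqF.
  have : s ^+ 2 <= s by rewrite expr2 ler_piMr// ltW.
  lra.
have eip : expR (l ^+ 2 * step_ip q q / 2) <= expR (l ^+ 2 * V / 2) * (1 + s * (k * expR k)).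
  apply: (@le_trans _ _ (expR (l ^+ 2 * V / 2) * expR (s * k))).
    rewrite -expRD ler_expR.
    have -> : l ^+ 2 * V / 2 + s * k = l ^+ 2 * (V + s * (V + 1)) / 2 by rewrite /k; field.
    by rewrite ler_pM2r// ler_wpM2l// sqr_ge0.
  apply: ler_wpM2l; first exact: expR_ge0.
  apply: (le_trans (expR_le_exp1 _)); first by rewrite mulr_ge0// ltW.
  rewrite lerD2l -mulrA ler_wpM2l ?(ltW s0)// ler_wpM2l// ler_expR.
  by rewrite ler_piMl.
have se : s + s^-1 * e <= 2 * s.
  have -> : s^-1 * e = s / 2 by rewrite /e; field; rewrite gt_eqF.
  lra.
have h1 := ler_wpM2r m00 eip; have h2 := ler_wpM2l b0 se.
rewrite -/m0 in H; lra.
Qed.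

(** Removing the truncation by monotone convergence retains an upper bound, which is the hypothesis
    of [mgf_moments]. *)
Lemma wiener_mgf_le l : (\int[P]_w (g w * expR (l * I w))%:E <=
  (expR (l ^+ 2 * V / 2))%:E * \int[P]_w (g w)%:E)%E.
Proof.
apply: (@ge0_integral_le_approx _ _ _ P (trunc l)) => //.
- move=> w K K' KK'; rewrite {1}/trunc; case: ifPn => // /andP[IK gK].
  have KR : (K%:R : R) <= K'%:R by rewrite ler_nat.
  by rewrite /trunc (le_trans IK KR) (le_trans gK KR).
- move=> w; have I1 := archi_boundP (normr_ge0 (I w)).
  have g1 := archi_boundP (G0 (Z w)).
  exists (maxn (Num.bound `|I w|) (Num.bound (g w))) => K; rewrite geq_max => /andP[K1 K2].
  rewrite /trunc (le_trans (ltW I1)) ?ler_nat//.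
  by rewrite (le_trans (ltW g1)) ?ler_nat.
- move=> K; rewrite -!EFin_Rintegral// -EFinM lee_fin; exact: trunc_bound.
Qed.

End Nonnegative.

Lemma wiener_moments_le (G : m.-tuple R -> R) : measurable_fun [set: m.-tuple R] G ->
  (forall z, 0 <= G z) -> itg P (fun w => G (Z w)) ->
  [/\ \int[P]_w (G (Z w) * I w) = 0,
      \int[P]_w (G (Z w) * I w ^+ 2) <= V * \int[P]_w G (Z w) &
      \int[P]_w (G (Z w) * I w ^+ 2) = V * \int[P]_w G (Z w) ->
      \int[P]_w (G (Z w) * I w ^+ 3) = 0].
Proof.
move=> mG G0 gi; apply: mgf_moments => // l; exact: wiener_mgf_le.
Qed.

Lemma wiener_itg_pow (G : m.-tuple R -> R) n : measurable_fun [set: m.-tuple R] G ->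
  (forall z, 0 <= G z) -> itg P (fun w => G (Z w)) ->
  itg P (fun w => G (Z w) * I w ^+ n).
Proof.
by move=> mG G0 gi; apply: (@mgf_itg_pow _ _ _ P _ I V) => // l; exact: wiener_mgf_le.
Qed.

(* The second-moment inequality for [K - min(G, K)] turns the one for
   [min(G, K)] into an equality, because [I] has second moment [V]. *)
Lemma wiener_moment2_ge0 (G : m.-tuple R -> R) : measurable_fun [set: m.-tuple R] G ->
  (forall z, 0 <= G z) -> itg P (fun w => G (Z w)) ->
  \int[P]_w (G (Z w) * I w ^+ 2) = V * \int[P]_w G (Z w).
Proof.
move=> mG G0 gi; have [_ le2 _] := wiener_moments_le mG G0 gi.
apply/eqP; rewrite eq_le le2/=.
have i2 := wiener_itg_pow 2 mG G0 gi.
have mg : measurable_fun [set: Omega] (fun w => G (Z w)) by exact: itg_measurable gi.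
have [_ [_ iI2] _] := fI.
pose GK (K : nat) z := Num.min (G z) K%:R.
have GK0 K z : 0 <= GK K z by rewrite le_min G0/=.
have mGK K : measurable_fun [set: m.-tuple R] (GK K) by exact: measurable_minr.
have iGK K : itg P (fun w => GK K (Z w)).
  have := gi; apply: itg_le; first exact: measurableT_comp.
  by move=> w; rewrite ger0_norm// ge_min lexx.
rewrite -lee_fin -RintegralZl// EFin_Rintegral; last exact: itgZ.
apply: (@ge0_integral_le_approx _ _ _ P (fun K w => V * GK K (Z w))).
- by move=> K; apply: measurable_funM => //; exact: measurableT_comp.
- by move=> K w; rewrite mulr_ge0.
- by move=> w K K' KK'; rewrite ler_wpM2l// le_min ge_min lexx/= ge_min ler_nat KK' orbT.
- move=> w; exists (Num.bound (G (Z w))) => K bK; congr (_ * _); apply/min_idPl.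
  by rewrite (le_trans (ltW (archi_boundP (G0 _))))// ler_nat.
move=> K; rewrite -EFin_Rintegral; last exact: itgZ.
rewrite lee_fin RintegralZl//; last exact: iGK.
pose hK z := K%:R - GK K z.
have hK0 z : 0 <= hK z by rewrite subr_ge0 ge_min lexx orbT.
have mhK : measurable_fun [set: m.-tuple R] hK by exact: measurable_funB.
have ihK : itg P (fun w => hK (Z w)) by exact: (itgB (itg_cst1 P K%:R) (iGK K)).
have [_ + _] := wiener_moments_le mhK hK0 ihK.
have iK2 := wiener_itg_pow 2 (mGK K) (GK0 K) (iGK K).
have kI := itgZ K%:R iI2.
under eq_Rintegral do rewrite mulrBl.
rewrite RintegralB// RintegralZl// (wiener_norm2 hW fI).
have cK := itg_cst1 P (K%:R : R).
rewrite RintegralB//; last exact: iGK.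
rewrite Rintegral_P_cst mulrBr (mulrC V) lerD2l lerN2 => /le_trans; apply.
apply: le_Rintegral => // w _; rewrite ler_wpM2r ?sqr_ge0//.
by rewrite ge_min lexx.
Qed.

(** Extension to signed test functions, by positive and negative parts. *)
Lemma wiener_cond_moments (G : m.-tuple R -> R) : measurable_fun [set: m.-tuple R] G ->
  itg P (fun w => G (Z w)) ->
  [/\ forall n, itg P (fun w => G (Z w) * I w ^+ n),
      \int[P]_w (G (Z w) * I w) = 0,
      \int[P]_w (G (Z w) * I w ^+ 2) = V * \int[P]_w G (Z w) &
      \int[P]_w (G (Z w) * I w ^+ 3) = 0].
Proof.
move=> mG gi.
pose Gp z := Num.max (G z) 0; pose Gn z := Num.max (- G z) 0.
have Gpn z : G z = Gp z - Gn z.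
  rewrite /Gp /Gn; case: (leP (G z) 0) => [Gz|Gz].
    by rewrite max_l ?oppr_ge0// sub0r opprK.
  by rewrite max_r ?subr0// oppr_le0 ltW.
have Gp0 z : 0 <= Gp z by rewrite le_max lexx orbT.
have Gn0 z : 0 <= Gn z by rewrite le_max lexx orbT.
have mGp : measurable_fun [set: m.-tuple R] Gp by exact: measurable_maxr.
have mGn : measurable_fun [set: m.-tuple R] Gn.
  by apply: measurable_maxr => //; exact: measurableT_comp.
have ip : itg P (fun w => Gp (Z w)).
  have := itg_norm gi; apply: itg_le; first exact: measurableT_comp.
  by move=> w; rewrite ger0_norm// ge_max ler_norm/=.
have iN : itg P (fun w => Gn (Z w)).
  have := itg_norm gi; apply: itg_le; first exact: measurableT_comp.
  by move=> w; rewrite ger0_norm// ge_max -normrN ler_norm/=.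
have [p1 _ p3] := wiener_moments_le mGp Gp0 ip.
have [n1 _ n3] := wiener_moments_le mGn Gn0 iN.
have p2 := wiener_moment2_ge0 mGp Gp0 ip; have n2 := wiener_moment2_ge0 mGn Gn0 iN.
have ipk k := wiener_itg_pow k mGp Gp0 ip.
have ink k := wiener_itg_pow k mGn Gn0 iN.
have E k : (fun w => G (Z w) * I w ^+ k) =
    (fun w => Gp (Z w) * I w ^+ k - Gn (Z w) * I w ^+ k).
  by apply/funext => w; rewrite Gpn mulrBl.
split.
- by move=> k; rewrite E; exact: itgB.
- have := E 1; under eq_fun do rewrite expr1; move=> ->.
  have := ipk 1; have := ink 1; under eq_fun do rewrite expr1.
  move=> i1; under eq_fun do rewrite expr1; move=> i2.
  under eq_Rintegral do rewrite !expr1.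
  by rewrite RintegralB// p1 n1 subr0.
- have i1 := ipk 2; have i2 := ink 2; rewrite E RintegralB// p2 n2 -mulrBr -RintegralB//; congr (_ * _).
  by apply: eq_Rintegral => w _; rewrite Gpn.
- have i1 := ipk 3; have i2 := ink 3.
  by rewrite E RintegralB// p3// n3// subr0.
Qed.

End ConditionalMoments.

(** * Products of two and three orthogonal Wiener integrals *)

Section ConditionalProducts.
Context (R : realType) (d : measure_display) (Omega : measurableType d).
Variables (P : probability Omega R) (W : R -> Omega -> R).
Hypothesis hW : brownian_motion P W.
Local Notation mu := (@lebesgue_measure R).
Variables (m : nat) (zs : nat -> seq (R * (R * R))).
Hypothesis wz : forall k, (k < m)%N -> step_wf (zs k).
Hypothesis zz : forall k l, (k < m)%N -> (l < m)%N -> k != l -> step_ip (zs k) (zs l) = 0.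
Hypothesis z0 : forall k, (k < m)%N -> step_ip (zs k) (zs k) != 0.

Local Notation Z := (tup m (fun k => step_integral W (zs k))).

Definition wiener_orth (f : R -> R) (I : Omega -> R) : Prop :=
  wiener P W f I /\
  forall k, (k < m)%N -> \int[mu]_x (f x * step_fun (zs k) x) = 0.

Lemma wiener_orthZ c f I : wiener_orth f I ->
  wiener_orth (fun x => c * f x) (fun w => c * I w).
Proof.
move=> [fI o]; split=> [|k km]; first exact: wienerZ.
have [f2 _ _] := fI; have i := L2_mul f2 (step_fun_L2 (zs k)).
by under eq_Rintegral do rewrite -mulrA; rewrite RintegralZl// o// mulr0.
Qed.

Lemma wiener_orthD f g I J : wiener_orth f I -> wiener_orth g J ->
  wiener_orth (fun x => f x + g x) (fun w => I w + J w).
Proof.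
move=> [fI o] [gJ o']; split=> [|k km]; first exact: wienerD.
have [f2 _ _] := fI; have i := L2_mul f2 (step_fun_L2 (zs k)).
have [g2 _ _] := gJ; have j := L2_mul g2 (step_fun_L2 (zs k)).
by under eq_Rintegral do rewrite mulrDl; rewrite RintegralD// o// o'// addr0.
Qed.

Lemma wiener_orthB f g I J : wiener_orth f I -> wiener_orth g J ->
  wiener_orth (fun x => f x - g x) (fun w => I w - J w).
Proof.
move=> fI /(wiener_orthZ (-1)) /(wiener_orthD fI); congr wiener_orth; apply/funext => x;
by rewrite mulN1r.
Qed.

Variable G : m.-tuple R -> R.
Hypotheses (mG : measurable_fun [set: m.-tuple R] G) (gi : itg P (fun w => G (Z w))).
Local Notation g := (fun w => G (Z w)).

Lemma wiener_cond1 f I : wiener_orth f I ->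
  itg P (fun w => g w * I w) /\ \int[P]_w (g w * I w) = 0.
Proof.
move=> [fI o]; have [i E _ _] := wiener_cond_moments hW wz zz z0 fI o mG gi.
by split => //; have := i 1; under eq_fun do rewrite expr1.
Qed.

Lemma wiener_cond2 f1 I1 f2 I2 : wiener_orth f1 I1 -> wiener_orth f2 I2 ->
  itg P (fun w => g w * (I1 w * I2 w)) /\
  \int[P]_w (g w * (I1 w * I2 w)) = \int[P]_w (I1 w * I2 w) * \int[P]_w g w.
Proof.
move=> w1 w2; have [wp op] := wiener_orthD w1 w2; have [wm om] := wiener_orthB w1 w2.
have [ip _ Ep _] := wiener_cond_moments hW wz zz z0 wp op mG gi.
have [im _ Em _] := wiener_cond_moments hW wz zz z0 wm om mG gi.
have E : (fun w => g w * (I1 w * I2 w)) = (fun w =>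
   4^-1 * (g w * (I1 w + I2 w) ^+ 2) - 4^-1 * (g w * (I1 w - I2 w) ^+ 2)).
  by apply/funext => w; field.
have p2 := ip 2; have m2 := im 2.
have k1 := itgZ 4^-1 p2; have k2 := itgZ 4^-1 m2.
rewrite E; split; first exact: itgB.
rewrite RintegralB// !RintegralZl// Ep Em.
rewrite -(wiener_norm2 hW wp) -(wiener_norm2 hW wm).
have [[_ L1 _] _] := w1; have [[_ L2' _] _] := w2.
have i12 := L2_mul L1 L2'.
have [_ j1] := L2D L1 L2'; have [_ j2] := L2B L1 L2'.
have E2 : \int[P]_w (I1 w * I2 w) =
   4^-1 * \int[P]_w ((I1 w + I2 w) ^+ 2) - 4^-1 * \int[P]_w ((I1 w - I2 w) ^+ 2).
  have l1 := itgZ 4^-1 j1; have l2 := itgZ 4^-1 j2.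
  by rewrite -!RintegralZl// -RintegralB//; apply: eq_Rintegral => w _; field.
rewrite E2; ring.
Qed.

(** Polarisation of the cube: 24 x y z = (x + y + z)^3 - (x + y - z)^3 - (x - y + z)^3 - (y - x +
    z)^3, and every combination is again orthogonal to the cells. *)
Lemma wiener_cond3 f1 I1 f2 I2 f3 I3 :
  wiener_orth f1 I1 -> wiener_orth f2 I2 -> wiener_orth f3 I3 ->
  itg P (fun w => g w * (I1 w * I2 w * I3 w)) /\
  \int[P]_w (g w * (I1 w * I2 w * I3 w)) = 0.
Proof.
move=> w1 w2 w3.
have C f I : wiener_orth f I ->
    itg P (fun w => g w * I w ^+ 3) /\ \int[P]_w (g w * I w ^+ 3) = 0.
  by move=> [fI o]; have [i _ _ E] := wiener_cond_moments hW wz zz z0 fI o mG gi.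
have [i1 E1] := C _ _ (wiener_orthD (wiener_orthD w1 w2) w3).
have [i2 E2] := C _ _ (wiener_orthB (wiener_orthD w1 w2) w3).
have [i3 E3] := C _ _ (wiener_orthD (wiener_orthB w1 w2) w3).
have [i4 E4] := C _ _ (wiener_orthD (wiener_orthB w2 w1) w3).
have E : (fun w => g w * (I1 w * I2 w * I3 w)) = (fun w =>
   24^-1 * (g w * (I1 w + I2 w + I3 w) ^+ 3) - 24^-1 * (g w * (I1 w + I2 w - I3 w) ^+ 3)
   - 24^-1 * (g w * (I1 w - I2 w + I3 w) ^+ 3) - 24^-1 * (g w * (I2 w - I1 w + I3 w) ^+ 3)).
  by apply/funext => w; field.
have k1 := itgZ 24^-1 i1; have k2 := itgZ 24^-1 i2.
have k3 := itgZ 24^-1 i3; have k4 := itgZ 24^-1 i4.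
have j1 := itgB k1 k2; have j2 := itgB j1 k3.
rewrite E; split; first exact: itgB.
by rewrite !RintegralB// !RintegralZl// E1 E2 E3 E4 mulr0 !subr0.
Qed.

End ConditionalProducts.

(** * Functions growing more slowly than every Gaussian exponential *)

Section Tame.
Context (R : realType) (M : nat).
Implicit Types (p q : M.-tuple R -> R) (z : M.-tuple R).

Definition sqnorm z : R := \sum_(k < M) tnth z k ^+ 2.

Lemma sqnorm_ge0 z : 0 <= sqnorm z.
Proof. by apply: sumr_ge0 => k _; exact: sqr_ge0. Qed.

Lemma measurable_sqnorm : measurable_fun [set: M.-tuple R] sqnorm.
Proof.
apply: measurable_sum => k; apply: measurable_funX; exact: measurable_tnth.
Qed.

Lemma coord_le_sqnorm z k : tnth z k ^+ 2 <= sqnorm z.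
Proof.
rewrite /sqnorm (bigD1 k)//= lerDl; apply: sumr_ge0 => l _; exact: sqr_ge0.
Qed.

(** The bound is required for every rate [e], so that the class is closed under products (each
    factor takes half of the rate) and contains the polynomials, while integrability of the payoff
    against one exponential, of whatever positive rate, suffices to integrate its product with any
    member. *)
Definition tame p := measurable_fun [set: M.-tuple R] p /\
  forall e, 0 < e -> exists2 C, 0 <= C & forall z, `|p z| <= C * expR (e * sqnorm z).

Lemma tame_cst (c : R) : tame (fun=> c).
Proof.
split => // e e0; exists `|c| => // z; rewrite ler_peMr// -expR0 ler_expR.
by rewrite mulr_ge0 ?sqnorm_ge0// ltW.
Qed.

Lemma tame_coord k : tame (fun z => tnth z k).
Proof.
split; first exact: measurable_tnth.
move=> e e0; exists (1 + e^-1) => [|z]; first by rewrite addr_ge0// invr_ge0 ltW.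
set x := tnth z k.
have x2 : x ^+ 2 <= sqnorm z by exact: coord_le_sqnorm.
have h1 : 1 + e * x ^+ 2 <= expR (e * sqnorm z).
  by rewrite (le_trans (expR_ge1Dx _))// ler_expR ler_wpM2l// ltW.
have ei : 0 < e^-1 by rewrite invr_gt0.
have ee : e^-1 * e = 1 by rewrite mulVf// gt_eqF.
have h2 : (1 + e^-1) * (1 + e * x ^+ 2) <= (1 + e^-1) * expR (e * sqnorm z).
  by rewrite ler_wpM2l// addr_ge0// ltW.
apply: le_trans h2.
have -> : (1 + e^-1) * (1 + e * x ^+ 2) = 1 + e * x ^+ 2 + e^-1 + (e^-1 * e) * x ^+ 2 by ring.
rewrite ee mul1r; have := mulr_ge0 (ltW e0) (sqr_ge0 x).
have := sqr_ge0 (`|x| - 1); rewrite sqrrB real_normK ?num_real// mulr1 expr1n.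
have := normr_ge0 x; lra.
Qed.

Lemma tameD p q : tame p -> tame q -> tame (fun z => p z + q z).
Proof.
move=> [mp hp] [mq hq]; split; first exact: measurable_funD.
move=> e e0; have [C C0 hC] := hp e e0; have [D D0 hD] := hq e e0.
exists (C + D); first exact: addr_ge0.
by move=> z; rewrite mulrDl (le_trans (ler_normD _ _))// lerD.
Qed.

Lemma tameM p q : tame p -> tame q -> tame (fun z => p z * q z).
Proof.
move=> [mp hp] [mq hq]; split; first exact: measurable_funM.
move=> e e0; have e2 : 0 < e / 2 by rewrite divr_gt0.
have [C C0 hC] := hp _ e2; have [D D0 hD] := hq _ e2.
exists (C * D); first exact: mulr_ge0.
move=> z; rewrite normrM (le_trans (ler_pM _ _ (hC z) (hD z)))//.
rewrite mulrACA -expRD -mulrDl; have -> : e / 2 + e / 2 = e by field.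
by [].
Qed.

Lemma tameZ c p : tame p -> tame (fun z => c * p z).
Proof. by move=> hp; exact: tameM (tame_cst c) hp. Qed.

Lemma tameB p q : tame p -> tame q -> tame (fun z => p z - q z).
Proof.
move=> hp /(tameZ (-1)) hq; have := tameD hp hq; congr tame; apply/funext => z.
by rewrite mulN1r.
Qed.

Lemma tame_sum (I : Type) (s : seq I) (Q : pred I) (F : I -> M.-tuple R -> R) :
  (forall i, Q i -> tame (F i)) -> tame (fun z => \sum_(i <- s | Q i) F i z).
Proof.
move=> hF; elim: s => [|i s IH].
  by under eq_fun do rewrite big_nil; exact: tame_cst.
case Qi : (Q i); under eq_fun do rewrite big_cons Qi; last exact: IH.
by apply: tameD => //; exact: hF.
Qed.

Lemma tameX p n : tame p -> tame (fun z => p z ^+ n).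
Proof.
move=> hp; elim: n => [|n IH]; first by under eq_fun do rewrite expr0; exact: tame_cst.
by under eq_fun do rewrite exprS; exact: tameM.
Qed.

End Tame.

(** * Brownian increments on a grid and the third-order Wick formula *)

Section Grid.
Context (R : realType) (d : measure_display) (Omega : measurableType d).
Variables (P : probability Omega R) (W : R -> Omega -> R).
Hypothesis hW : brownian_motion P W.
Local Notation mu := (@lebesgue_measure R).
Variables (M : nat) (u : nat -> R).
Hypotheses (u0 : 0 <= u 0%N) (uS : forall k, (k < M)%N -> u k < u k.+1).

Definition incr (k : nat) (w : Omega) : R := W (u k.+1) w - W (u k) w.
Definition cell (k : nat) : R -> R := \1_`]u k, u k.+1].
Definition dt (k : nat) : R := u k.+1 - u k.
Definition cell_list (k : nat) : seq (R * (R * R)) := [:: (1, (u k, u k.+1))].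

Lemma u_mono k l : (k <= l <= M)%N -> u k <= u l.
Proof.
move=> /andP[]; elim: l => [|l IH]; first by rewrite leqn0 => /eqP ->.
rewrite leq_eqVlt => /predU1P[->//|kl] lM; apply: (le_trans (IH _ (ltnW lM))) => //.
exact/ltW/uS.
Qed.

Lemma u_ge0 k : (k <= M)%N -> 0 <= u k.
Proof. by move=> kM; rewrite (le_trans u0)// u_mono. Qed.

Lemma dt_gt0 k : (k < M)%N -> 0 < dt k. Proof. by move=> kM; rewrite subr_gt0 uS. Qed.

Lemma cell_list_wf k : (k < M)%N -> step_wf (cell_list k).
Proof.
by move=> kM c; rewrite inE => /eqP ->/=; rewrite u_ge0 ?(ltnW kM)//= ltW// uS.
Qed.

Lemma step_fun_cell_list k : step_fun (cell_list k) = cell k.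
Proof. by apply/funext => x; rewrite /step_fun big_seq1 /= mul1r. Qed.

Lemma step_integral_cell_list k : step_integral W (cell_list k) = incr k.
Proof. by apply/funext => w; rewrite /step_integral big_seq1 /= mul1r. Qed.

Lemma Rintegral_itv_indic (a b : R) : a <= b -> \int[mu]_x (\1_`]a, b] x) = b - a.
Proof.
move=> ab; rewrite /Rintegral integral_indic//= setIT lebesgue_measure_itv/= lte_fin.
by case: ltP => // ba; apply/esym/eqP; rewrite subr_eq0 eq_le ba ab.
Qed.

Lemma wiener_interval a b : 0 <= a -> a <= b ->
  wiener P W (\1_`]a, b]) (fun w => W b w - W a w).
Proof.
move=> a0 ab; have wf : step_wf [:: (1, (a, b))].
  by move=> c; rewrite inE => /eqP -> /=; rewrite a0.
have := wiener_step hW wf; congr wiener.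
  by apply/funext => x; rewrite /step_fun big_seq1 /= mul1r.
by apply/funext => w; rewrite /step_integral big_seq1 /= mul1r.
Qed.

Lemma wiener_cell k : (k < M)%N -> wiener P W (cell k) (incr k).
Proof. by move=> kM; apply: wiener_interval; [rewrite u_ge0// ltnW|exact/ltW/uS]. Qed.

Lemma cell_mul k l x : (k < M)%N -> (l < M)%N ->
  cell k x * cell l x = (k == l)%:R * cell k x.
Proof.
wlog kl : k l / (k <= l)%N => [H kM lM|kM lM].
  have [kl|/ltnW lk] := leqP k l; first exact: H.
  rewrite mulrC (H l k)// eq_sym; case: eqP => [->//|_]; by rewrite !mul0r.
move: kl; rewrite leq_eqVlt => /predU1P[<-|kl].
  rewrite eqxx mul1r /cell indicE; case: (x \in _); by rewrite ?mulr1 ?mulr0.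
rewrite (ltn_eqF kl) mul0r /cell !indicE.
have [xk|] := boolP (x \in _); last by rewrite mul0r.
rewrite [x \in `]u l, _] %classic]memNset ?mulr0//=.
move: xk; rewrite inE /= !in_itv/= => /andP[_ xk] /andP[lx _].
have := lt_le_trans lx xk; rewrite ltNge => /negP; apply; apply: u_mono.
by rewrite kl ltnW.
Qed.

Lemma cell_ip k l : (k < M)%N -> (l < M)%N ->
  \int[mu]_x (cell k x * cell l x) = (k == l)%:R * dt k.
Proof.
move=> kM lM; under eq_Rintegral do rewrite cell_mul//.
rewrite RintegralZl//.
  by rewrite /cell Rintegral_itv_indic// ltW// uS.
by have := integrable_itv_indic (u k) (u k.+1) 1; under eq_fun do rewrite mul1r.
Qed.

Lemma cell_list_ip k l : (k < M)%N -> (l < M)%N ->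
  step_ip (cell_list k) (cell_list l) = (k == l)%:R * dt k.
Proof. by move=> kM lM; rewrite /step_ip !step_fun_cell_list cell_ip. Qed.

Local Notation Z := (tup M incr).

Lemma tup_cell_list : tup M (fun k => step_integral W (cell_list k)) = Z.
Proof.
by apply/funext => w; apply: eq_from_tnth => k; rewrite !tnth_tup step_integral_cell_list.
Qed.

Lemma measurable_grid : measurable_fun [set: Omega] Z.
Proof.
apply: measurable_tup => k kM; rewrite -step_integral_cell_list.
exact: (measurable_step_integral hW (cell_list_wf kM)).
Qed.

Definition orth_cells f I := wiener P W f I /\
  forall k, (k < M)%N -> \int[mu]_x (f x * cell k x) = 0.

Lemma orth_cellsE f I : orth_cells f I -> wiener_orth P W M cell_list f I.
Proof.
by move=> [fI o]; split => // k kM; rewrite step_fun_cell_list o.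
Qed.

Lemma orth_cells0 : orth_cells (fun=> 0) (fun=> 0).
Proof.
split=> [|k kM]; last first.
  by under eq_Rintegral do rewrite mul0r; rewrite /Rintegral integral0.
have wf : step_wf ([::] : seq (R * (R * R))) by [].
have := wiener_step hW wf; congr wiener.
  by apply/funext => x; rewrite /step_fun big_nil.
by apply/funext => w; rewrite /step_integral big_nil.
Qed.

Section Conditional.
Variable G : M.-tuple R -> R.
Hypothesis mG : measurable_fun [set: M.-tuple R] G.
Hypothesis Gexp : exists2 e, 0 < e & itg P (fun w => `|G (Z w)| * expR (e * sqnorm (Z w))).

Lemma tame_itg p : tame p -> itg P (fun w => G (Z w) * p (Z w)).
Proof.
move=> [mp hp]; have [e e0 ie] := Gexp; have [C C0 hC] := hp e e0.
have mZ := measurable_grid.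
have := itgZ C ie; apply: itg_le.
  by apply: measurable_funM; exact: measurableT_comp.
by move=> w; rewrite normrM mulrCA ler_wpM2l.
Qed.

(* [q] is the conditional expectation of [X] given the increments, tested
   against [G] only. *)
Definition cexp X q := [/\ tame q, itg P (fun w => G (Z w) * X w) &
  \int[P]_w (G (Z w) * X w) = \int[P]_w (G (Z w) * q (Z w))].

Lemma cexp_tame p : tame p -> cexp (fun w => p (Z w)) p.
Proof. by move=> hp; split => //; exact: tame_itg. Qed.

Lemma cexpD X Y p q : cexp X p -> cexp Y q ->
  cexp (fun w => X w + Y w) (fun z => p z + q z).
Proof.
move=> [tp iX EX] [tq iY EY]; have ip := tame_itg tp; have iq := tame_itg tq.
split; first exact: tameD.
  by under eq_fun do rewrite mulrDr; exact: itgD.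
under eq_Rintegral do rewrite mulrDr; under [RHS]eq_Rintegral do rewrite mulrDr.
by rewrite !RintegralD// EX EY.
Qed.

Lemma cexpZ c X p : cexp X p -> cexp (fun w => c * X w) (fun z => c * p z).
Proof.
move=> [tp iX EX]; have ip := tame_itg tp.
split; first exact: tameZ.
  by under eq_fun do rewrite mulrCA; exact: itgZ.
under eq_Rintegral do rewrite mulrCA; under [RHS]eq_Rintegral do rewrite mulrCA.
by rewrite !RintegralZl// EX.
Qed.

Lemma cexp_sum (I : Type) (s : seq I) (Q : pred I) X p :
  (forall i, Q i -> cexp (X i) (p i)) ->
  cexp (fun w => \sum_(i <- s | Q i) X i w) (fun z => \sum_(i <- s | Q i) p i z).
Proof.
move=> H; elim: s => [|i s IH].
  under eq_fun do rewrite big_nil; rewrite [X in cexp _ X](_ : _ = fun=> 0).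
    exact: (cexp_tame (tame_cst _ 0)).
  by apply/funext => z; rewrite big_nil.
case Qi : (Q i); under eq_fun do rewrite big_cons Qi.
  rewrite [X in cexp _ X](_ : _ = fun z => p i z + \sum_(j <- s | Q j) p j z).
    by apply: cexpD => //; exact: H.
  by apply/funext => z; rewrite big_cons Qi.
rewrite [X in cexp _ X](_ : _ = fun z => \sum_(j <- s | Q j) p j z)//.
by apply/funext => z; rewrite big_cons Qi.
Qed.

Lemma cexp_eq X p X' p' : X' = X -> p' = p -> cexp X p -> cexp X' p'.
Proof. by move=> -> ->. Qed.

(** In the expanded product the terms with one or three remainders vanish, and a pair of remainders
    contributes the inner product of its integrands. The factors that depend on Z are absorbed into
    the test function, the result being applied to [G] times a tame function. *)
Lemma cexp_wick p1 p2 p3 f1 f2 f3 A1 A2 A3 :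
  tame p1 -> tame p2 -> tame p3 ->
  orth_cells f1 A1 -> orth_cells f2 A2 -> orth_cells f3 A3 ->
  cexp (fun w => (p1 (Z w) + A1 w) * (p2 (Z w) + A2 w) * (p3 (Z w) + A3 w))
       (fun z => p1 z * p2 z * p3 z + p1 z * \int[mu]_x (f2 x * f3 x)
          + p2 z * \int[mu]_x (f1 x * f3 x) + p3 z * \int[mu]_x (f1 x * f2 x)).
Proof.
move=> t1 t2 t3 /orth_cellsE o1 /orth_cellsE o2 /orth_cellsE o3.
have z0 k : (k < M)%N -> step_ip (cell_list k) (cell_list k) != 0.
  by move=> kM; rewrite cell_list_ip// eqxx mul1r gt_eqF// dt_gt0.
have zz k l : (k < M)%N -> (l < M)%N -> k != l -> step_ip (cell_list k) (cell_list l) = 0.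
  by move=> kM lM kl; rewrite cell_list_ip// (negbTE kl) mul0r.
have mGp p : tame p -> measurable_fun [set: M.-tuple R] (fun z => G z * p z).
  by move=> [mp _]; exact: measurable_funM.
have iGp p : tame p -> itg P (fun w => G (tup M (fun k => step_integral W (cell_list k)) w) *
    p (tup M (fun k => step_integral W (cell_list k)) w)).
  by move=> tp; rewrite tup_cell_list; exact: tame_itg.
have C1 p f A : tame p -> wiener_orth P W M cell_list f A ->
    cexp (fun w => p (Z w) * A w) (fun=> 0).
  move=> tp o; have := wiener_cond1 hW cell_list_wf zz z0 (mGp p tp) (iGp p tp) o.
  rewrite tup_cell_list => -[i E]; split; first exact: tame_cst.
    by under eq_fun do rewrite mulrA.
  under eq_Rintegral do rewrite mulrA; rewrite E.
  by under eq_Rintegral do rewrite mulr0; rewrite Rintegral_P_cst.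
have C2 p f A f' A' : tame p -> wiener_orth P W M cell_list f A ->
    wiener_orth P W M cell_list f' A' ->
    cexp (fun w => p (Z w) * (A w * A' w)) (fun z => p z * \int[mu]_x (f x * f' x)).
  move=> tp o o'; have := wiener_cond2 hW cell_list_wf zz z0 (mGp p tp) (iGp p tp) o o'.
  rewrite tup_cell_list => -[i E]; split; first by apply: tameM => //; exact: tame_cst.
    by under eq_fun do rewrite mulrA.
  under eq_Rintegral do rewrite mulrA; rewrite E.
  have [fA _] := o; have [fA' _] := o'.
  rewrite (wiener_isometry hW fA fA').
  under [RHS]eq_Rintegral do rewrite mulrA.
  by rewrite RintegralZr 1?mulrC//; exact: tame_itg.
have C3 : cexp (fun w => 1 * (A1 w * A2 w * A3 w)) (fun=> 0).
  have t := tame_cst M (1 : R).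
  have := wiener_cond3 hW cell_list_wf zz z0 (mGp _ t) (iGp _ t) o1 o2 o3.
  rewrite tup_cell_list => -[i E]; split; first exact: tame_cst.
    by under eq_fun do rewrite mulrA.
  under eq_Rintegral do rewrite mulrA; rewrite E.
  by under eq_Rintegral do rewrite mulr0; rewrite Rintegral_P_cst.
have t12 := tameM t1 t2; have t13 := tameM t1 t3; have t23 := tameM t2 t3.
have t123 := tameM t12 t3.
have S := cexpD (cexpD (cexpD (cexpD (cexpD (cexpD (cexpD (cexp_tame t123)
  (C2 _ _ _ _ _ t1 o2 o3)) (C2 _ _ _ _ _ t2 o1 o3)) (C2 _ _ _ _ _ t3 o1 o2))
  (C1 _ _ _ t12 o3)) (C1 _ _ _ t13 o2)) (C1 _ _ _ t23 o1)) C3.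
apply: cexp_eq S; first by apply/funext => w; ring.
by apply/funext => z; rewrite !addr0.
Qed.

End Conditional.

End Grid.

(** * Inner products of projection remainders *)

Section InnerProduct.
Context (R : realType) (d : measure_display) (T : measurableType d).
Variable mu : {measure set T -> \bar R}.
Implicit Types f g h : T -> R.

Lemma ip_subZl c f g h : L2 mu f -> L2 mu g -> L2 mu h ->
  \int[mu]_x ((f x - c * g x) * h x) =
  \int[mu]_x (f x * h x) - c * \int[mu]_x (g x * h x).
Proof.
move=> f2 g2 h2; have i1 := L2_mul f2 h2; have i2 := L2_mul g2 h2.
have k2 := itgZ c i2; rewrite -RintegralZl// -RintegralB//.
by apply: eq_Rintegral => x _; ring.
Qed.

Lemma ip_subZ c c' f g f' g' : L2 mu f -> L2 mu g -> L2 mu f' -> L2 mu g' ->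
  \int[mu]_x ((f x - c * g x) * (f' x - c' * g' x)) =
  \int[mu]_x (f x * f' x) - c' * \int[mu]_x (f x * g' x)
  - c * \int[mu]_x (g x * f' x) + c * c' * \int[mu]_x (g x * g' x).
Proof.
move=> f2 g2 f2' g2'; rewrite ip_subZl//; last by apply: L2B => //; exact: L2Z.
have E e : L2 mu e -> \int[mu]_x (e x * (f' x - c' * g' x)) =
    \int[mu]_x (e x * f' x) - c' * \int[mu]_x (e x * g' x).
  move=> e2; transitivity (\int[mu]_x ((f' x - c' * g' x) * e x)).
    by apply: eq_Rintegral => x _; rewrite mulrC.
  by rewrite ip_subZl//; congr (_ - _ * _); apply: eq_Rintegral => x _; rewrite mulrC.
by rewrite !E//; ring.
Qed.

End InnerProduct.

(** * Conditional expectation of the weight at a fixed time *)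

Section WeightConditional.
Context (R : realType) (d : measure_display) (Omega : measurableType d).
Variables (P : probability Omega R) (W : R -> Omega -> R).
Hypothesis hW : brownian_motion P W.
Local Notation mu := (@lebesgue_measure R).
Variables (M : nat) (u : nat -> R).
Hypotheses (u0 : 0 <= u 0%N) (uS : forall k, (k < M)%N -> u k < u k.+1).
Local Notation Z := (tup M (incr W u)).
Variable G : M.-tuple R -> R.
Hypothesis mG : measurable_fun [set: M.-tuple R] G.
Hypothesis Gexp : exists2 e, 0 < e & itg P (fun w => `|G (Z w)| * expR (e * sqnorm (Z w))).

Lemma cexp_wick2 p1 p2 f1 f2 A1 A2 : tame p1 -> tame p2 ->
  orth_cells P W M u f1 A1 -> orth_cells P W M u f2 A2 ->
  cexp P W u G (fun w => (p1 (Z w) + A1 w) * (p2 (Z w) + A2 w))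
    (fun z => p1 z * p2 z + \int[mu]_x (f1 x * f2 x)).
Proof.
move=> t1 t2 o1 o2.
have t3 := tame_cst M (1 : R).
have := cexp_wick hW u0 uS mG Gexp t1 t2 t3 o1 o2 (orth_cells0 hW M u).
apply: cexp_eq; first by apply/funext => w; rewrite addr0 mulr1.
apply/funext => z; rewrite mulr1 mul1r.
have z0 (f : R -> R) : \int[mu]_x (f x * 0) = 0.
  by under eq_Rintegral do rewrite mulr0; rewrite /Rintegral integral0.
by rewrite !z0 !mulr0 !addr0.
Qed.

Lemma cexp_wick1 p1 f1 A1 : tame p1 -> orth_cells P W M u f1 A1 ->
  cexp P W u G (fun w => p1 (Z w) + A1 w) p1.
Proof.
move=> t1 o1; have t2 := tame_cst M (1 : R).
have := cexp_wick2 t1 t2 o1 (orth_cells0 hW M u).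
apply: cexp_eq; first by apply/funext => w; rewrite addr0 mulr1.
apply/funext => z; rewrite mulr1.
under eq_Rintegral do rewrite mulr0.
by rewrite /Rintegral integral0 addr0.
Qed.

Variables (j : nat) (s sigma : R).
Hypotheses (jM : (j < M)%N) (s0 : 0 <= s) (us : u j <= s < u j.+1) (sg : sigma != 0).
Variables (V0 V1 V3 N : R).

Local Notation dl := (u j.+1 - s).

(** A function with integral 1 over cell [k] projects on that cell to the constant 1 / [dt u k], so
    this is the contribution of cell [k] to the component of its Wiener integral along Z. *)
Definition zeta (k : nat) (z : M.-tuple R) : R := nth 0 z k / dt u k.

(** Component of [Fw k] along Z, with [del] the time from [s] to the end of its cell. In the cell of
    [s], the part after [s] carries on average the fraction del / [dt u j] of the whole
    increment. *)
Definition drift (del : R) (k : nat) (z : M.-tuple R) : R :=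
  if k == j then del * (zeta j z - sigma) else - sigma * dt u k + nth 0 z k.

(** The weight with each Wiener integral replaced by its component along Z, corrected by the
    covariances of the remainders. The terms 1 - del / [dt u j] are the covariances of the Brownian
    increment after [s] with the integrals of [a] and [b j]; neither function occurs otherwise. *)
Definition weight_poly (del : R) (z : M.-tuple R) : R :=
  2 * V0 * (sigma^-1 * (- N + (\sum_(j <= k < M) drift del k z * zeta k z) +
                        (1 - del / dt u j))) +
  2 * V1 * (sigma ^- 2 * (- N * zeta j z +
      (\sum_(j <= k < M) drift del k z * zeta k z) * zeta j z
      - drift del j z / dt u j + 2 * zeta j z * (1 - del / dt u j) - zeta j z)) +
  V3 * (sigma ^- 3 * (zeta j z ^+ 3 - 3 * zeta j z / dt u j) -
        sigma ^- 2 * (zeta j z ^+ 2 - (dt u j)^-1)).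

(** [del] enters through the drift of cell [j] and through 1 - del / [dt u j], each affine and never
    multiplied by one another. *)
Lemma weight_poly_affine del z :
  weight_poly del z = weight_poly 0 z + del * (weight_poly 1 z - weight_poly 0 z).
Proof.
rewrite /weight_poly !(big_ltn jM) /=.
have E e : \sum_(j.+1 <= k < M) drift e k z * zeta k z =
    \sum_(j.+1 <= k < M) (- sigma * dt u k + nth 0 z k) * zeta k z.
  rewrite big_nat [RHS]big_nat; apply: eq_bigr => k /andP[jk _].
  by rewrite /drift gtn_eqF.
rewrite !E /drift eqxx; set S := \sum_(_ <= _ < _) _; ring.
Qed.

Lemma tame_nth k : (k < M)%N -> tame (fun z : M.-tuple R => nth 0 z k).
Proof.
move=> kM; have := tame_coord R (Ordinal kM); congr tame.
by apply/funext => z; rewrite (tnth_nth 0).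
Qed.

Lemma tame_zeta k : (k < M)%N -> tame (zeta k).
Proof.
move=> kM; have := tameM (tame_nth kM) (tame_cst M (dt u k)^-1); congr tame.
Qed.

Lemma tame_drift del k : (k < M)%N -> tame (drift del k).
Proof.
move=> kM; rewrite /drift; case: eqP => _.
  apply: tameZ; apply: tameB; [exact: tame_zeta|exact: tame_cst].
by apply: tameD; [exact: tame_cst|exact: tame_nth].
Qed.

Lemma nth_incr k w : (k < M)%N -> nth 0 (Z w) k = incr W u k w.
Proof. by move=> kM; have := tnth_tup (incr W u) w (Ordinal kM); rewrite (tnth_nth 0). Qed.

Variables (a : R -> R) (IA : Omega -> R) (b : nat -> R -> R) (IB : nat -> Omega -> R).
Local Notation jk k := ((j <= k)%N && (k < M)%N).
(** [ha1] holds the successive differences of the constraints on a(s, .): mass 1 in the cell of [s]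
    and mass 0 in every other cell. The family [b] has one member per cell, so each is normalised on
    its own support. *)
Hypotheses (ha : wiener P W a IA)
  (ha1 : forall k, (k < M)%N -> \int[mu]_x (a x * cell u k x) = (k == j)%:R)
  (hb : forall k, jk k -> wiener P W (b k) (IB k))
  (hb1 : forall k l, jk k -> (l < M)%N -> \int[mu]_x (b k x * cell u l x) = (k == l)%:R).
Local Notation es := (\1_`]s, u j.+1] : R -> R).
Hypotheses (hea : \int[mu]_x (es x * a x) = 1)
  (heb : \int[mu]_x (es x * b j x) = 1).

Local Notation va := (\int[mu]_x (a x * a x)).
Local Notation cab k := (\int[mu]_x (a x * b k x)).

(** From here to [wH], the weights are restated at a frozen time, with their deterministic integrals
    as parameters. The same computation thus applies to the given [a] and [b] and to the functions
    constant on cells that produce the Greeks. *)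
Definition start (k : nat) : R := if k == j then s else u k.
Definition Fw (k : nat) (w : Omega) : R :=
  - sigma * (u k.+1 - start k) + W (u k.+1) w - W (start k) w.
Definition wD (w : Omega) : R := sigma^-1 * IA w.
Definition w3 (vA : R) (w : Omega) : R :=
  wD w ^+ 3 - wD w ^+ 2 - sigma ^- 2 * (3 * wD w - 1) * vA.
Definition wS (w : Omega) : R :=
  sigma^-1 * (- N + \sum_(j <= k < M) Fw k w * IB k w).
Definition wDS (cAB : nat -> R) (w : Omega) : R :=
  wS w * wD w - sigma ^- 2 * (IB j w + \sum_(j <= k < M) Fw k w * cAB k).
Definition wH (vA : R) (cAB : nat -> R) (w : Omega) : R :=
  2 * V0 * wS w + 2 * V1 * wDS cAB w + V3 * w3 vA w.

(** Each integrand is stripped of its projection on the cells, and its integral of the corresponding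
    multiple of the increment. In particular [E] is the Brownian bridge fluctuation of the increment
    after [s] inside its cell. *)
Let c := (dt u j)^-1.
Let fA x := a x - c * cell u j x.
Let A w := IA w - c * incr W u j w.
Let fB k x := b k x - (dt u k)^-1 * cell u k x.
Let B k w := IB k w - (dt u k)^-1 * incr W u k w.
Let fE x := es x - (dl / dt u j) * cell u j x.
Let E w := W (u j.+1) w - W s w - (dl / dt u j) * incr W u j w.
(** For a cell after that of [s], [Fw k] is already a function of the increments, so its remainder
    is zero. *)
Let fEk k : R -> R := if k == j then fE else fun=> 0.
Let Ek k : Omega -> R := if k == j then E else fun=> 0.

Let dj0 : dt u j != 0. Proof. by rewrite gt_eqF// (dt_gt0 uS). Qed.

Let es_cell k : (k < M)%N -> \int[mu]_x (es x * cell u k x) = (k == j)%:R * dl.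
Proof.
move=> kM; have /andP[ujs sj] := us.
have E1 x : es x * cell u k x = (k == j)%:R * es x.
  have ec : es x = es x * cell u j x.
    rewrite /cell !indicE; have [xs|] := boolP (x \in `]s, _]%classic); last by rewrite mul0r.
    rewrite mem_set ?mulr1//=; move: xs; rewrite inE /= !in_itv/= => /andP[sx ->].
    by rewrite (le_lt_trans ujs sx).
  rewrite ec -mulrA (cell_mul uS)// eq_sym; case: eqP => _; last by rewrite !mul0r mulr0.
  by rewrite !mul1r -ec.
under eq_Rintegral do rewrite E1; rewrite RintegralZl//.
  by rewrite Rintegral_itv_indic// ltW.
by have := integrable_itv_indic s (u j.+1) 1; under eq_fun do rewrite mul1r.
Qed.

Let a2 : L2 mu a. Proof. by have [] := ha. Qed.
Let b2 k : jk k -> L2 mu (b k). Proof. by move=> /hb[]. Qed.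
Let cell2 k : (k < M)%N -> L2 mu (cell u k).
Proof. by move=> kM; have [] := wiener_cell hW u0 uS kM. Qed.
Let he : wiener P W es (fun w => W (u j.+1) w - W s w).
Proof. by have /andP[_ sj] := us; apply: (wiener_interval hW) => //; exact: ltW. Qed.
Let e2 : L2 mu es. Proof. by have [] := he. Qed.

Let oA : orth_cells P W M u fA A.
Proof.
split; first by apply: (wienerB hW) => //; apply: (wienerZ hW); exact: (wiener_cell hW u0 uS).
move=> k kM; rewrite ip_subZl//; [|exact: cell2|exact: cell2].
rewrite ha1// (cell_ip uS)// eq_sym; case: eqP => _; last by rewrite mul0r mulr0 subr0.
by rewrite mul1r /c mulVf// subrr.
Qed.

Let oB k : jk k -> orth_cells P W M u (fB k) (B k).
Proof.
move=> jkk; have /andP[_ kM] := jkk.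
split; first by apply: (wienerB hW) => //; [exact: hb|apply: (wienerZ hW); exact: (wiener_cell hW u0 uS)].
move=> l lM; rewrite ip_subZl//; [|exact: b2|exact: cell2|exact: cell2].
rewrite hb1// (cell_ip uS)//; case: eqP => [kl|_]; last by rewrite mul0r mulr0 subr0.
by rewrite mul1r mulVf ?subrr// gt_eqF// (dt_gt0 uS).
Qed.

Let oE : orth_cells P W M u fE E.
Proof.
split; first by apply: (wienerB hW) => //; apply: (wienerZ hW); exact: (wiener_cell hW u0 uS).
move=> k kM; rewrite ip_subZl//; [|exact: cell2|exact: cell2].
rewrite es_cell// (cell_ip uS)// (eq_sym j); case: eqP => [_|_]; last by rewrite !mul0r mulr0 subr0.
by rewrite !mul1r divfK// subrr.
Qed.

Let oEk k : orth_cells P W M u (fEk k) (Ek k).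
Proof. by rewrite /fEk /Ek; case: eqP => _; [exact: oE|exact: orth_cells0]. Qed.

Let cell_mulr k (f : R -> R) : \int[mu]_x (cell u k x * f x) = \int[mu]_x (f x * cell u k x).
Proof. by apply: eq_Rintegral => x _; rewrite mulrC. Qed.

Let covAA : \int[mu]_x (fA x * fA x) = va - c.
Proof.
rewrite ip_subZ//; [|exact: cell2|exact: cell2].
by rewrite cell_mulr ha1// eqxx (cell_ip uS)// eqxx /= /c; field.
Qed.

Let covAB k : jk k -> \int[mu]_x (fA x * fB k x) = cab k - (k == j)%:R * c.
Proof.
move=> jkk; have /andP[_ kM] := jkk; have bk := b2 jkk.
rewrite ip_subZ//; [|exact: cell2|exact: cell2].
rewrite cell_mulr ha1// hb1// (cell_ip uS)// (eq_sym j).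
case: (eqVneq k j) => [->|_]; rewrite /= /c; last by ring.
by field.
Qed.

Let covEA : \int[mu]_x (fE x * fA x) = 1 - dl / dt u j.
Proof.
rewrite ip_subZ//; [|exact: cell2|exact: cell2].
by rewrite hea cell_mulr ha1// es_cell// (cell_ip uS)// eqxx /= /c; field.
Qed.

Let covEB : \int[mu]_x (fE x * fB j x) = 1 - dl / dt u j.
Proof.
have jj : jk j by rewrite leqnn.
have bj := b2 jj; rewrite ip_subZ//; [|exact: cell2|exact: cell2].
by rewrite heb cell_mulr hb1// es_cell// (cell_ip uS)// eqxx /=; field.
Qed.

Let ind k := (if k == j then 1 - dl / dt u j else 0).

Let covEkA k : \int[mu]_x (fEk k x * fA x) = ind k.
Proof.
rewrite /fEk /ind; case: eqP => _ //.
by under eq_Rintegral do rewrite mul0r; rewrite /Rintegral integral0.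
Qed.

Let covEkB k : \int[mu]_x (fEk k x * fB k x) = ind k.
Proof.
rewrite /fEk /ind; case: eqP => [->|_] //.
by under eq_Rintegral do rewrite mul0r; rewrite /Rintegral integral0.
Qed.

Let IAE w : IA w = zeta j (Z w) + A w.
Proof. by rewrite /zeta nth_incr// /A /c; ring. Qed.

Let IBE k w : (k < M)%N -> IB k w = zeta k (Z w) + B k w.
Proof. by move=> kM; rewrite /zeta nth_incr// /B; ring. Qed.

Let FwE k w : (k < M)%N -> Fw k w = drift dl k (Z w) + Ek k w.
Proof.
move=> kM; rewrite /Fw /drift /Ek /start; case: eqP => [->|_].
  by rewrite /zeta nth_incr// /E; ring.
by rewrite nth_incr// /incr /dt; ring.
Qed.

Let tz := tame_zeta jM.

Let c_A : cexp P W u G IA (zeta j).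
Proof.
have := cexp_wick1 tz oA; apply: cexp_eq => //.
by apply/funext => w; rewrite IAE.
Qed.

Let c_AA : cexp P W u G (fun w => IA w * IA w) (fun z => zeta j z * zeta j z + (va - c)).
Proof.
have := cexp_wick2 tz tz oA oA; apply: cexp_eq; last by rewrite covAA.
by apply/funext => w; rewrite IAE.
Qed.

Let c_AAA : cexp P W u G (fun w => IA w * IA w * IA w)
  (fun z => zeta j z * zeta j z * zeta j z + 3 * zeta j z * (va - c)).
Proof.
have := cexp_wick hW u0 uS mG Gexp tz tz tz oA oA oA; apply: cexp_eq.
  by apply/funext => w; rewrite IAE.
by rewrite covAA; apply/funext => z; ring.
Qed.

Let c_B : cexp P W u G (IB j) (zeta j).
Proof.
have jj : jk j by rewrite leqnn.
have := cexp_wick1 tz (oB jj); apply: cexp_eq => //.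
by apply/funext => w; rewrite IBE.
Qed.

Let c_F k : jk k -> cexp P W u G (Fw k) (drift dl k).
Proof.
move=> /andP[_ kM]; have := cexp_wick1 (tame_drift dl kM) (oEk k); apply: cexp_eq => //.
by apply/funext => w; rewrite FwE.
Qed.

Let c_FB k : jk k -> cexp P W u G (fun w => Fw k w * IB k w)
  (fun z => drift dl k z * zeta k z + ind k).
Proof.
move=> jkk; have /andP[_ kM] := jkk.
have := cexp_wick2 (tame_drift dl kM) (tame_zeta kM) (oEk k) (oB jkk).
apply: cexp_eq; last by rewrite covEkB.
by apply/funext => w; rewrite FwE// IBE.
Qed.

Let c_FBA k : jk k -> cexp P W u G (fun w => Fw k w * IB k w * IA w)
  (fun z => drift dl k z * zeta k z * zeta j z +
    drift dl k z * (cab k - (k == j)%:R * c) + zeta k z * ind k + zeta j z * ind k).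
Proof.
move=> jkk; have /andP[_ kM] := jkk.
have := cexp_wick hW u0 uS mG Gexp (tame_drift dl kM) (tame_zeta kM) tz (oEk k) (oB jkk) oA.
apply: cexp_eq; first by apply/funext => w; rewrite FwE// IBE// IAE.
rewrite covEkA covEkB -(covAB jkk); apply/funext => z; do 3 congr (_ + _).
by congr (_ * _); apply: eq_Rintegral => x _; rewrite mulrC.
Qed.

(** The dependence on [a] and [b] cancels term by term. Up to powers of sigma, the cube yields 3
    zeta va and the square - va, against - (3 zeta - 1) va in [w3]; the product [Fw k] times [IB k]
    times [IA] yields drift times the inner product of [a] and [b k], against the correcting sum in
    [wDS]. What survives is 1 / [dt u j] and 1 - dl / [dt u j]. *)
Lemma weight_cexp :
  cexp P W u G (wH va (fun k => cab k)) (weight_poly dl).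
Proof.
have jj : jk j by rewrite leqnn.
have sumE (F : nat -> R) : \sum_(j <= k < M) F k = \sum_(j <= k < M | jk k) F k.
  exact: big_nat.
have cst1 v : cexp P W u G (fun=> v) (fun=> v) := cexp_tame hW u0 uS mG Gexp (tame_cst M v).
have Zc := cexpZ hW u0 uS mG Gexp; have Dc := cexpD hW u0 uS mG Gexp.
have Sc := cexp_sum hW u0 uS mG Gexp (index_iota j M).
have sFB := Sc _ _ _ c_FB.
have sFBA := Sc _ _ _ c_FBA.
have sF := Sc (fun k => jk k) _ _ (fun k jkk => Zc (cab k) _ _ (c_F jkk)).
have cS := Zc sigma^-1 _ _ (Dc _ _ _ _ (cst1 (- N)) sFB).
have cDS := Zc (sigma ^- 2) _ _ (Dc _ _ _ _ (Dc _ _ _ _ (Dc _ _ _ _ (Zc (- N) _ _ c_A) sFBA)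
   (Zc (-1) _ _ c_B)) (Zc (-1) _ _ sF)).
have c3 := Dc _ _ _ _ (Dc _ _ _ _ (Dc _ _ _ _ (Zc (sigma ^- 3) _ _ c_AAA)
  (Zc (- sigma ^- 2) _ _ c_AA)) (Zc (- (3 * sigma ^- 3 * va)) _ _ c_A)) (cst1 (sigma ^- 2 * va)).
have := Dc _ _ _ _ (Dc _ _ _ _ (Zc (2 * V0) _ _ cS) (Zc (2 * V1) _ _ cDS)) (Zc V3 _ _ c3).
apply: cexp_eq.
  apply/funext => w; rewrite /wH /wDS /w3 /wS /wD !sumE; congr (_ + _ + _).
    congr (_ * _).
    have -> : \sum_(j <= k < M | jk k) Fw k w * IB k w * IA w =
        (\sum_(j <= k < M | jk k) Fw k w * IB k w) * IA w by rewrite mulr_suml.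
    have -> : \sum_(j <= k < M | jk k) cab k * Fw k w =
        \sum_(j <= k < M | jk k) Fw k w * cab k by apply: eq_bigr => k _; rewrite mulrC.
    by set S1 := \sum_(_ <= _ < _ | _) _; set S2 := \sum_(_ <= _ < _ | _) _; field.
  by congr (_ * _); field.
(* Only cell [j] interacts with [s] and with the projection of [a]. The cells after it are gathered
   in [T1], which occurs on both sides, and [T2], which cancels. *)
apply/funext => z; rewrite /weight_poly -!sumE !(big_ltn jM).
pose T1 := \sum_(j.+1 <= k < M) drift dl k z * zeta k z.
pose T2 := \sum_(j.+1 <= k < M) drift dl k z * cab k.
have ne k : (j.+1 <= k < M)%N -> (k == j) = false by move=> /andP[jk _]; rewrite gtn_eqF.
have -> : \sum_(j.+1 <= k < M) (drift dl k z * zeta k z + ind k) = T1.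
  rewrite big_nat /T1 [RHS]big_nat; apply: eq_bigr => k kj.
  by rewrite /ind ne// addr0.
have -> : \sum_(j.+1 <= k < M) (drift dl k z * zeta k z * zeta j z +
    drift dl k z * (cab k - (k == j)%:R * c) + zeta k z * ind k + zeta j z * ind k) =
    T1 * zeta j z + T2.
  rewrite big_nat /T1 /T2 mulr_suml -big_split/= [RHS]big_nat; apply: eq_bigr => k kj.
  by rewrite /ind ne//=; ring.
have -> : \sum_(j.+1 <= k < M) cab k * drift dl k z = T2.
  by apply: eq_bigr => k _; rewrite mulrC.
rewrite -/T1 /ind !eqxx /= /c. field.
by rewrite sg dj0.
Qed.

End WeightConditional.

(** * Derivative from a quadratic remainder *)

Section QuadraticDerivative.
Context (R : realType).

Lemma is_derive_quadratic (f : R -> R) (x l C c : R) : 0 < c ->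
  (forall h, `|h| <= c -> `|f (x + h) - f x - h * l| <= C * h ^+ 2) ->
  is_derive x 1 f l.
Proof.
move=> c0 H.
have L : h^-1 *: (f (h *: 1 + x) - f x) @[h --> 0^'] --> l.
  apply/cvgrPdist_le => e e0; near=> h.
  have h0 : h != 0 by near: h; exact: nbhs_dnbhs_neq.
  have hc : `|h| <= c.
    near: h; apply: dnbhs0_le => //.
  have he : `|h| <= e / (`|C| + 1).
    near: h; apply: dnbhs0_le; rewrite divr_gt0// ltr_wpDl//.
  have -> : l - h^-1 *: (f (h *: 1 + x) - f x) =
      - (h^-1 * (f (x + h) - f x - h * l)).
    by rewrite /GRing.scale/= mulr1 (addrC h); field.
  rewrite normrN normrM normrV ?unitfE//.
  have h1 : 0 < `|h| by rewrite normr_gt0.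
  rewrite ler_pdivrMl// (le_trans (H _ hc))//.
  rewrite -[h ^+ 2]real_normK ?num_real// expr2 mulrCA ler_wpM2l//.
  apply: (@le_trans _ _ ((`|C| + 1) * `|h|)).
    by rewrite ler_wpM2r// (le_trans (ler_norm C))// lerDl.
  by rewrite mulrC -ler_pdivlMr// ltr_wpDl.
apply: DeriveDef; first by apply/cvg_ex; exists l.
by apply: cvg_lim.
Unshelve. all: by end_near. Qed.

End QuadraticDerivative.

(** * Differentiation of an exponential tilt *)

Section ExponentialTilt.
Context (R : realType) (d : measure_display) (T : measurableType d).
Variables (mu : {measure set T -> \bar R}) (G Y : T -> R) (c : R).
Hypotheses (c0 : 0 < c) (mG : measurable_fun [set: T] G) (mY : measurable_fun [set: T] Y).
Hypothesis Gc : itg mu (fun x => `|G x| * expR (c * `|Y x|)).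

Lemma tilt_itg l : `|l| <= c -> itg mu (fun x => G x * expR (l * Y x)).
Proof.
move=> lc; move: Gc; apply: itg_le.
  by apply: measurable_funM => //; apply: measurableT_comp => //; exact: measurable_funM.
move=> x; rewrite normrM ler_wpM2l// ger0_norm ?expR_ge0// ler_expR.
by rewrite (le_trans (ler_norm _))// normrM ler_wpM2r.
Qed.

Lemma tilt_itg_mul : itg mu (fun x => G x * Y x).
Proof.
have := itgZ c^-1 Gc; apply: itg_le; first exact: measurable_funM.
move=> x; rewrite normrM mulrCA ler_wpM2l//.
rewrite mulrC ler_pdivlMr// mulrC; have := expR_ge1Dx (c * `|Y x|); lra.
Qed.

(** With y = h Y and |h| <= c / 2, |exp y - 1 - y| <= y^2 / 2 exp |y|. Half of the exponent c |Y|
    absorbs y^2, through t^2 <= 2 exp |t| at t = c Y / 2, and the other half absorbs exp |y|; this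
    gives the constant 4 / c^2. *)
Lemma tilt_derive :
  is_derive (0 : R) (1 : R) (fun l : R => \int[mu]_x (G x * expR (l * Y x))) (\int[mu]_x (G x * Y x)).
Proof.
pose K := \int[mu]_x (`|G x| * expR (c * `|Y x|)).
apply: (@is_derive_quadratic _ _ _ _ (4 / c ^+ 2 * K) (c / 2)) => [|h hc].
  by rewrite divr_gt0.
have hc' : `|h| <= c by rewrite (le_trans hc)// ler_pdivrMr// ler_peMr ?(ltW c0)// ler1n.
have ih := tilt_itg hc'; have iY := itgZ h tilt_itg_mul.
have iG : itg mu G.
  have : `|0 : R| <= c by rewrite normr0 ltW.
  by move=> /tilt_itg; under eq_fun do rewrite mul0r expR0 mulr1.
rewrite add0r; under [X in _ - X - _]eq_Rintegral do rewrite mul0r expR0 mulr1.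
have i1 := itgB ih iG; have i2 := itgB i1 iY.
rewrite -RintegralZl; [|by []|exact: tilt_itg_mul].
rewrite -RintegralB// -RintegralB//.
apply: (le_trans (le_normr_Rintegral _ i2)) => //.
have -> : 4 / c ^+ 2 * K * h ^+ 2 = \int[mu]_x (h ^+ 2 * (4 / c ^+ 2) * (`|G x| * expR (c * `|Y x|))).
  by rewrite RintegralZl// /K; ring.
apply: le_Rintegral => //; [exact: itg_norm|exact: itgZ|] => x _.
have -> : G x * expR (h * Y x) - G x - h * (G x * Y x) =
    G x * (expR (h * Y x) - 1 - h * Y x) by ring.
rewrite normrM mulrCA ler_wpM2l//.
set y := h * Y x.
have y1 : `|expR y - 1 - y| <= y ^+ 2 / 2 * expR `|y|.
  rewrite ger0_norm; first by have := expR_le_quadratic y; lra.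
  by have := expR_ge1Dx y; lra.
apply: (le_trans y1).
have y2 : `|y| <= c / 2 * `|Y x| by rewrite normrM ler_wpM2r.
have -> : y ^+ 2 / 2 = h ^+ 2 * (2 / c ^+ 2) * `|c / 2 * Y x| ^+ 2.
  rewrite real_normK ?num_real// /y; field; by rewrite gt_eqF.
have q := @exprn_le_expR R 2 (c / 2 * Y x).
have -> : expR (c * `|Y x|) = expR (`|c / 2 * Y x|) * expR (c / 2 * `|Y x|).
  have c20 : 0 <= c / 2 by rewrite divr_ge0// ltW.
  by rewrite -expRD normrM (ger0_norm c20); congr expR; field.
have -> : h ^+ 2 * (4 / c ^+ 2) * (expR `|c / 2 * Y x| * expR (c / 2 * `|Y x|)) =
   (h ^+ 2 * (2 / c ^+ 2) * (2`!%:R * expR `|c / 2 * Y x|)) * expR (c / 2 * `|Y x|).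
  by rewrite (_ : 2`!%:R = 2%:R :> R)//; ring.
apply: ler_pM; rewrite ?expR_ge0 ?ler_expR//.
  by rewrite mulr_ge0// ?exprn_ge0// mulr_ge0 ?sqr_ge0// divr_ge0// sqr_ge0.
by rewrite ler_wpM2l// mulr_ge0 ?sqr_ge0// divr_ge0// sqr_ge0.
Qed.

End ExponentialTilt.

(** * The affine change of variable for signed integrands *)

Section RealAffineChange.
Context (R : realType) (d : measure_display) (Omega : measurableType d).
Variable P : probability Omega R.

Lemma itg_gaussian_affine M (X : nat -> Omega -> R) al be dl (G : M.-tuple R -> R) :
  gaussian_seq P M X dl -> (forall k, (k < M)%N -> 0 < be k) ->
  measurable_fun [set: M.-tuple R] G ->
  itg P (fun w => G (tup M (fun k w => al k + be k * X k w) w)) ->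
  itg P (fun w => (\prod_(k < M) gauss_ratio (al k) (be k) (dl k) (X k w)) *
                  G (tup M X w)) /\
  \int[P]_w G (tup M (fun k w => al k + be k * X k w) w) =
  \int[P]_w ((\prod_(k < M) gauss_ratio (al k) (be k) (dl k) (X k w)) * G (tup M X w)).
Proof.
move=> gX b0 mG iG; have [mX _ _ _] := gX.
pose rho w := \prod_(k < M) gauss_ratio (al k) (be k) (dl k) (X k w).
have rho0 w : 0 <= rho w by apply: prodr_ge0 => k _; apply: gauss_ratio_ge0; exact: b0.
have mrho : measurable_fun [set: Omega] rho.
  apply: measurable_prod => k _.
  by apply: measurableT_comp; [exact: measurable_gauss_ratio|exact: mX].
have mX' : measurable_fun [set: Omega] (tup M X) by exact: measurable_tup.
have pos (F : M.-tuple R -> R) : measurable_fun [set: M.-tuple R] F ->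
    (forall z, 0 <= F z) -> (\int[P]_w (F (tup M (fun k w => al k + be k * X k w) w))%:E =
    \int[P]_w (rho w * F (tup M X w))%:E)%E.
  move=> mF F0; have mF' : measurable_fun [set: M.-tuple R] (EFin \o F) by exact/measurable_EFinP.
  exact: (integral_gaussian_affine al gX b0 mF' (fun z => F0 z)).
pose Gp z := Num.max (G z) 0; pose Gn z := Num.max (- G z) 0.
have Gpn z : G z = Gp z - Gn z.
  rewrite /Gp /Gn; case: (leP (G z) 0) => [Gz|Gz].
    by rewrite max_l ?oppr_ge0// sub0r opprK.
  by rewrite max_r ?subr0// oppr_le0 ltW.
have Gp0 z : 0 <= Gp z by rewrite le_max lexx orbT.
have Gn0 z : 0 <= Gn z by rewrite le_max lexx orbT.
have mGp : measurable_fun [set: M.-tuple R] Gp by exact: measurable_maxr.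
have mGn : measurable_fun [set: M.-tuple R] Gn.
  by apply: measurable_maxr => //; exact: measurableT_comp.
have maff : measurable_fun [set: Omega] (tup M (fun k w => al k + be k * X k w)).
  apply: measurable_tup => k kM; apply: measurable_funD => //.
  by apply: measurable_funM => //; exact: mX.
have ip : itg P (fun w => Gp (tup M (fun k w => al k + be k * X k w) w)).
  have := itg_norm iG; apply: itg_le; first exact: measurableT_comp.
  by move=> w; rewrite ger0_norm// ge_max ler_norm/=.
have iN : itg P (fun w => Gn (tup M (fun k w => al k + be k * X k w) w)).
  have := itg_norm iG; apply: itg_le; first exact: measurableT_comp.
  by move=> w; rewrite ger0_norm// ge_max -normrN ler_norm/=.
have tr (F : M.-tuple R -> R) : measurable_fun [set: M.-tuple R] F ->
    (forall z, 0 <= F z) -> itg P (fun w => F (tup M (fun k w => al k + be k * X k w) w)) ->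
    itg P (fun w => rho w * F (tup M X w)) /\
    \int[P]_w F (tup M (fun k w => al k + be k * X k w) w) =
    \int[P]_w (rho w * F (tup M X w)).
  move=> mF F0 iF; split; last by rewrite /Rintegral pos.
  apply: ge0_itgP.
  - by apply: measurable_funM => //; exact: measurableT_comp.
  - by move=> w; rewrite mulr_ge0.
  - by rewrite -pos//; exact: itg_ge0_fin.
have [jp Ep] := tr _ mGp Gp0 ip; have [jn En] := tr _ mGn Gn0 iN.
rewrite -/rho; split.
  have := itgB jp jn; congr itg; apply/funext => w.
  by rewrite -mulrBr -Gpn.
under eq_Rintegral do rewrite Gpn; rewrite RintegralB// Ep En -RintegralB//.
by apply: eq_Rintegral => w _; rewrite -mulrBr -Gpn.
Qed.

End RealAffineChange.

(** * Derivatives of the price in the volatility and in the spot *)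

Section PriceFunctional.
Context (R : realType) (d : measure_display) (Omega : measurableType d).
Variables (P : probability Omega R) (W : R -> Omega -> R).
Hypothesis hW : brownian_motion P W.
Variables (M : nat) (u : nat -> R).
Hypotheses (u0 : 0 <= u 0%N) (uS : forall k, (k < M)%N -> u k < u k.+1).
Hypothesis M0 : (0 < M)%N.
Local Notation Z := (tup M (incr W u)).
Variable sigma : R.
Hypothesis s0 : 0 < sigma.

(** Multiplying the initial price by exp t adds t to every later log-price, hence t / sigma to the
    first increment alone; [Hshift] states this for the payoff. *)
Definition shift0 (a : R) (z : M.-tuple R) : M.-tuple R :=
  [tuple (if k == 0 :> nat then a else 0) + tnth z k | k < M].

(** The increments that, read in the model of volatility [sigma], reproduce the log-returns of
    volatility [v]: (r - sigma^2 / 2) dt + sigma times this equals (r - v^2 / 2) dt + v times the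
    Brownian increment. The functional [H] thus stays fixed as [v] varies. *)
Definition vol_incr (v : R) (k : nat) (w : Omega) : R :=
  (sigma ^+ 2 - v ^+ 2) / (2 * sigma) * dt u k + v / sigma * incr W u k w.

Variable H : R -> M.-tuple R -> R.
Hypothesis mH : forall x, measurable_fun [set: M.-tuple R] (H x).
Hypothesis Hshift : forall x t z, H (x * expR t) z = H x (shift0 (t / sigma) z).
Hypothesis Hint : forall v x, 0 < v -> 0 < x -> itg P (fun w => H x (tup M (vol_incr v) w)).

Let gD : gaussian_seq P M (incr W u) (dt u).
Proof. exact: brownian_gaussian_seq. Qed.

Let dtp k : (k < M)%N -> 0 < dt u k. Proof. exact: dt_gt0. Qed.

Let mZ : measurable_fun [set: Omega] Z. Proof. exact: (measurable_grid hW u0 uS). Qed.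

Let sqE w : sqnorm (Z w) = \sum_(k < M) incr W u k w ^+ 2.
Proof. by apply: eq_bigr => k _; rewrite tnth_tup. Qed.

(* At volatility [2 sigma] the density of the increments with respect to those
   at volatility [sigma] grows like a Gaussian exponential. *)
Lemma price_gauss_itg x : 0 < x ->
  exists2 e, 0 < e & itg P (fun w => `|H x (Z w)| * expR (e * sqnorm (Z w))).
Proof.
move=> x0; have v0 : 0 < 2 * sigma by rewrite mulr_gt0.
pose al k := (sigma ^+ 2 - (2 * sigma) ^+ 2) / (2 * sigma) * dt u k.
pose be (k : nat) := 2 * sigma / sigma.
have be2 k : be k = 2 by rewrite /be mulfK// gt_eqF.
have b0 k : (k < M)%N -> 0 < be k by rewrite be2.
have [/itg_norm iH _] := itg_gaussian_affine (al := al) gD b0 (mH x) (Hint v0 x0).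
pose D := \sum_(k < M) dt u k.
have D0 : 0 < D.
  rewrite /D (bigD1 (Ordinal M0))//= ltr_wpDr ?dtp//.
  by apply: sumr_ge0 => k _; rewrite ltW// dtp.
have dD (k : 'I_M) : dt u k <= D.
  rewrite /D (bigD1 k)//= lerDl; apply: sumr_ge0 => l _; by rewrite ltW// dtp.
(* For an increment z over a cell of length dk the exponent of the density is at least z^2 / (2 dk)
   - z^2 / (4 dk) - 9/16 sigma^2 dk. Bounding dk by [D] in the quadratic part gives this rate, and
   [c] below covers the constant part, together with the factor 1/2 from the scaling. *)
exists (4 * D)^-1; first by rewrite invr_gt0 mulr_gt0.
pose c (k : nat) := 2^-1 * expR (- (sigma ^+ 2 * dt u k)).
have cp k : 0 < c k by rewrite mulr_gt0// expR_gt0.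
pose C := \prod_(k < M) c k.
have C0 : 0 < C by rewrite prodr_gt0.
have := itgZ C^-1 iH; apply: itg_le.
  apply: measurable_funM; first by apply: measurableT_comp => //; exact: measurableT_comp.
  apply: measurableT_comp => //; apply: measurable_funM => //.
  by apply: measurableT_comp => //; exact: measurable_sqnorm.
move=> w; rewrite ger0_norm ?mulr_ge0 ?expR_ge0// normrM.
rewrite (@ger0_norm _ (\prod_(_ < _) _)); last first.
  by apply: prodr_ge0 => k _; apply: gauss_ratio_ge0; exact: b0.
rewrite mulrA [leRHS]mulrC ler_wpM2l// ler_pdivlMl//.
have -> : C * expR ((4 * D)^-1 * sqnorm (Z w)) =
    \prod_(k < M) (c k * expR ((4 * D)^-1 * incr W u k w ^+ 2)).
  by rewrite big_split/= -expR_sum -mulr_sumr sqE.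
apply: ler_prod => k _; rewrite mulr_ge0 ?expR_ge0 ?(ltW (cp _))//=.
rewrite /c /gauss_ratio be2 -mulrA ler_wpM2l// -expRD ler_expR.
set z := incr W u k w; set dk := dt u k.
have dk0 : 0 < dk by exact: dtp.
have -> : al k = - (3 / 2 * sigma * dk) by rewrite /al -/dk; field; rewrite gt_eqF.
have h1 : (4 * D)^-1 * z ^+ 2 <= (4 * dk)^-1 * z ^+ 2.
  rewrite ler_wpM2r ?sqr_ge0// lef_pV2 ?posrE ?mulr_gt0// ler_pM2l//.
  exact: dD.
have h2 : (z - - (3 / 2 * sigma * dk)) ^+ 2 <= 2 * z ^+ 2 + 2 * (3 / 2 * sigma * dk) ^+ 2.
  have := sqr_ge0 (z - 3 / 2 * sigma * dk); lra.
have h3 : (z - - (3 / 2 * sigma * dk)) ^+ 2 / (2 * dk * 2 ^+ 2) <=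
   (2 * z ^+ 2 + 2 * (3 / 2 * sigma * dk) ^+ 2) / (2 * dk * 2 ^+ 2).
  by rewrite ler_wpM2r// invr_ge0 mulr_ge0// mulr_ge0// ltW.
have e1 : (2 * z ^+ 2 + 2 * (3 / 2 * sigma * dk) ^+ 2) / (2 * dk * 2 ^+ 2) =
   (4 * dk)^-1 * z ^+ 2 + 9 / 16 * (sigma ^+ 2 * dk) by field; rewrite gt_eqF.
have e2 : z ^+ 2 / (2 * dk) = 2 * ((4 * dk)^-1 * z ^+ 2) by field; rewrite gt_eqF.
have : 0 <= sigma ^+ 2 * dk by rewrite mulr_ge0 ?sqr_ge0// ltW.
rewrite e2; lra.
Qed.

(** Logarithmic derivative in [v], at [sigma], of the density of [vol_incr v] with respect to the
    original increments. *)
Definition vega_poly (z : M.-tuple R) : R :=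
  sigma^-1 * \sum_(k < M) (-1 + (tnth z k - sigma * dt u k) * tnth z k / dt u k).

Lemma tame_vega_poly : tame vega_poly.
Proof.
apply: tameZ; apply: tame_sum => k _; apply: tameD; first exact: tame_cst.
apply: tameM; last exact: tame_cst.
by apply: tameM (tame_coord _ _); apply: tameB (tame_coord _ _) (tame_cst _ _).
Qed.

Let Yq (z : M.-tuple R) : R :=
  \sum_(k < M) (tnth z k ^+ 2 / (2 * dt u k) - sigma / 2 * tnth z k).

Let TT := \sum_(k < M) dt u k.

Let mYq : measurable_fun [set: M.-tuple R] Yq.
Proof.
apply: measurable_sum => k; apply: measurable_funB; apply: measurable_funM => //.
  by apply: measurable_funX; exact: measurable_tnth.
exact: measurable_tnth.
Qed.

Let pref (v : R) := (sigma / v) ^+ M * expR (- (TT * (v ^+ 2 - sigma ^+ 2) ^+ 2 / (8 * v ^+ 2))).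
Let kap (v : R) := 1 - sigma ^+ 2 / v ^+ 2.

(** In the density of [vol_incr v] the increments appear only through exp (kap v * Yq), so that
    differentiating in [v] reduces to differentiating an exponential tilt at kap sigma = 0. *)
Let vol_change x v : 0 < x -> 0 < v ->
  \int[P]_w H x (tup M (vol_incr v) w) =
  pref v * \int[P]_w (H x (Z w) * expR (kap v * Yq (Z w))).
Proof.
move=> x0 v0.
pose al k := (sigma ^+ 2 - v ^+ 2) / (2 * sigma) * dt u k.
pose be (k : nat) := v / sigma.
have b0 k : (k < M)%N -> 0 < be k by rewrite divr_gt0.
have [iH ->] := itg_gaussian_affine (al := al) gD b0 (mH x) (Hint v0 x0).
have E w : \prod_(k < M) gauss_ratio (al k) (be k) (dt u k) (incr W u k w) =
    pref v * expR (kap v * Yq (Z w)).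
  rewrite /pref -mulrA -expRD /Yq.
  have -> : (sigma / v) ^+ M = \prod_(k < M) (be k)^-1.
    by rewrite /be prodr_const card_ord invf_div.
  rewrite /TT mulr_sumr 2!mulr_suml -sumrN -big_split/= expR_sum -big_split/=.
  apply: eq_bigr => k _; rewrite /gauss_ratio; congr (_ * expR _); rewrite tnth_tup.
  rewrite /al /be /kap; field.
  by rewrite !gt_eqF// dtp.
have p0 : pref v != 0.
  by rewrite mulf_neq0 ?gt_eqF ?expR_gt0// exprn_gt0// divr_gt0.
rewrite -RintegralZl//.
  by apply: eq_Rintegral => w _; rewrite E; ring.
have := itgZ (pref v)^-1 iH; congr itg; apply/funext => w; rewrite E.
by field.
Qed.

Let Ytilt x : 0 < x -> exists2 c, 0 < c &
  itg P (fun w => `|H x (Z w)| * expR (c * `|Yq (Z w)|)).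
Proof.
move=> x0; have [e e0 ie] := price_gauss_itg x0.
pose K := \sum_(k < M) ((2 * dt u k)^-1 + sigma / 2).
have Kp (k : 'I_M) : 0 < (2 * dt u k)^-1 + sigma / 2.
  by rewrite addr_gt0// ?divr_gt0// invr_gt0 mulr_gt0// dtp.
have K0 : 0 < K.
  rewrite /K (bigD1 (Ordinal M0))//= ltr_wpDr//; last exact: Kp (Ordinal M0).
  by apply: sumr_ge0 => k _; exact/ltW/Kp.
have Kk (k : 'I_M) : (2 * dt u k)^-1 + sigma / 2 <= K.
  by rewrite /K [leRHS](bigD1 k)//= lerDl; apply: sumr_ge0 => l _; exact/ltW/Kp.
have Yle z : `|Yq z| <= K * sqnorm z + M%:R * (sigma / 2).
  rewrite /Yq /sqnorm mulr_sumr.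
  apply: (le_trans (ler_norm_sum _ _ _)).
  have -> : M%:R * (sigma / 2) = \sum_(k < M) (sigma / 2).
    by rewrite sumr_const card_ord mulr_natl.
  rewrite -big_split/=; apply: ler_sum => k _.
  have dk := dtp (ltn_ord k).
  have z1 : `|tnth z k| <= 1 + tnth z k ^+ 2.
    have := sqr_ge0 (`|tnth z k| - 1); rewrite sqrrB real_normK ?num_real// mulr1 expr1n.
    have := normr_ge0 (tnth z k); lra.
  have z2 : `|sigma / 2 * tnth z k| <= sigma / 2 * (1 + tnth z k ^+ 2).
    have sg2 : 0 <= sigma / 2 by rewrite divr_ge0// ltW.
    by rewrite normrM (ger0_norm sg2) ler_wpM2l.
  have z3 : `|tnth z k ^+ 2 / (2 * dt u k)| = (2 * dt u k)^-1 * tnth z k ^+ 2.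
    have p2 : 0 <= (2 * dt u k)^-1 by rewrite invr_ge0 mulr_ge0// ltW.
    by rewrite normrM (ger0_norm (sqr_ge0 _)) (ger0_norm p2) mulrC.
  have := ler_wpM2r (sqr_ge0 (tnth z k)) (Kk k).
  have := ler_normB (tnth z k ^+ 2 / (2 * dt u k)) (sigma / 2 * tnth z k).
  rewrite z3; lra.
exists (e / K); first exact: divr_gt0.
have := itgZ (expR (e / K * (M%:R * (sigma / 2)))) ie; apply: itg_le.
  apply: measurable_funM; first by apply: measurableT_comp => //; exact: measurableT_comp.
  apply: measurableT_comp => //; apply: measurable_funM => //.
  by apply: measurableT_comp => //; exact: measurableT_comp.
move=> w; rewrite ger0_norm ?mulr_ge0 ?expR_ge0// mulrCA ler_wpM2l// -expRD ler_expR.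
have eK : 0 <= e / K by rewrite divr_ge0// ltW.
apply: (le_trans (ler_wpM2l eK (Yle _))).
by rewrite mulrDr [X in X <= _]addrC lerD2l mulrA divfK// gt_eqF.
Qed.

Lemma price_vega x : 0 < x ->
  is_derive sigma 1 (fun v => \int[P]_w H x (tup M (vol_incr v) w))
    (\int[P]_w (H x (Z w) * vega_poly (Z w))).
Proof.
move=> x0; have [c c0 ic] := Ytilt x0.
pose F l := \int[P]_w (H x (Z w) * expR (l * Yq (Z w))).
have mHx : measurable_fun [set: Omega] (fun w => H x (Z w)) by exact: measurableT_comp.
have mYx : measurable_fun [set: Omega] (fun w => Yq (Z w)) by exact: measurableT_comp.
have dF : is_derive (0 : R) 1 F (\int[P]_w (H x (Z w) * Yq (Z w))).
  exact: tilt_derive c0 mHx mYx ic.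
have sn : sigma != 0 by rewrite gt_eqF.
have dsq : is_derive sigma 1 (fun v : R => v ^+ 2) (2 * sigma).
  by apply: is_derive_eq; rewrite /GRing.scale/=; ring.
have sq0 : sigma ^+ 2 != 0 by rewrite expf_neq0.
have dsqV := @is_deriveV _ (fun v : R => v ^+ 2) sigma _ 1 sq0 dsq.
have dk : is_derive sigma 1 kap (2 / sigma).
  by rewrite /kap; apply: is_derive_eq; rewrite /GRing.scale/=; field.
have kap0 : kap sigma = 0 by rewrite /kap divff ?subrr// expf_neq0.
have pref1 : pref sigma = 1.
  by rewrite /pref divff// expr1n subrr expr0n/= mulr0 mul0r oppr0 expR0 mulr1.
have dF' : is_derive (kap sigma) 1 F (\int[P]_w (H x (Z w) * Yq (Z w))) by rewrite kap0.
have dFk := is_derive1_comp dF' dk.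
(* The exponential factor of [pref] does not contribute, since (v^2 - sigma^2)^2 vanishes to second
   order at [sigma]; only the power of sigma / v does. *)
have dp : is_derive sigma 1 pref (- M%:R / sigma).
  have dV : is_derive sigma 1 (fun v : R => v^-1) (- sigma ^- 2).
    have := @is_deriveV _ (fun v : R => v) sigma _ 1 sn (is_derive_id _ _).
    by move=> dV; apply: (is_derive_eq dV); rewrite /GRing.scale/= mulr1.
  have d1 : is_derive sigma 1 (fun v : R => (sigma / v) ^+ M) (- M%:R / sigma).
    have dsv : is_derive sigma 1 (fun v : R => sigma / v) (sigma * (- sigma ^- 2)).
      by apply: is_derive_eq; rewrite /GRing.scale/=; ring.
    have := is_deriveX M dsv; rewrite exprfctE => dX.
    apply: (is_derive_eq dX); rewrite /GRing.scale/= divff// expr1n.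
    by field.
  have q0 : 8 * sigma ^+ 2 != 0 by rewrite mulf_neq0.
  have dq : is_derive sigma 1 (fun v : R => 8 * v ^+ 2) (8 * (2 * sigma)).
    by apply: is_derive_eq; rewrite /GRing.scale/=; ring.
  have dqV := @is_deriveV _ (fun v : R => 8 * v ^+ 2) sigma _ 1 q0 dq.
  have d2 : is_derive sigma 1 (fun v : R =>
      expR (- (TT * (v ^+ 2 - sigma ^+ 2) ^+ 2 / (8 * v ^+ 2)))) 0.
    by apply: is_derive_eq; rewrite /GRing.scale/= subrr expr0n/=; ring.
  apply: (is_derive_eq (is_deriveM d1 d2)).
  rewrite /GRing.scale/= divff// expr1n subrr expr0n/= !(mulr0, mul0r, oppr0) expR0 mul1r.
  by rewrite add0r.
have dpF := is_deriveM dp dFk.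
apply: (@near_eq_is_derive _ _ _ (fun v => pref v * F (kap v))).
  near=> v; rewrite vol_change//.
  near: v; exact: lt_nbhsr.
apply: (is_derive_eq dpF); rewrite /GRing.scale/= kap0 pref1 mul1r.
have iH : itg P (fun w => H x (Z w)).
  have := tame_itg hW u0 uS (mH x) (price_gauss_itg x0) (tame_cst M (1 : R)).
  by under eq_fun do rewrite mulr1.
have -> : F 0 = \int[P]_w H x (Z w).
  by apply: eq_Rintegral => w _; rewrite mul0r expR0 mulr1.
have iHY := tilt_itg_mul c0 mHx mYx ic.
have vE z : vega_poly z = 2 / sigma * Yq z + - (M%:R / sigma).
  rewrite /vega_poly big_split/= sumr_const card_ord.
  have -> : \sum_(k < M) (tnth z k - sigma * dt u k) * tnth z k / dt u k = 2 * Yq z.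
    rewrite /Yq mulr_sumr; apply: eq_bigr => k _; field.
    by rewrite gt_eqF// dtp.
  by rewrite -(mulr_natr (-1)); field.
have k1 := itgZ (2 / sigma) iHY; have k2 := itgZ (- (M%:R / sigma)) iH.
transitivity (\int[P]_w (2 / sigma * (H x (Z w) * Yq (Z w)) + - (M%:R / sigma) * H x (Z w))).
  by rewrite RintegralD// !RintegralZl//; ring.
by apply: eq_Rintegral => w _; rewrite vE; ring.
Unshelve. all: by end_near. Qed.

Definition zeta0 (z : M.-tuple R) : R := nth 0 z 0 / dt u 0.

Let zeta0E z : zeta0 z = tnth z (Ordinal M0) / dt u 0.
Proof. by rewrite /zeta0 (tnth_nth 0). Qed.

Lemma tame_zeta0 : tame zeta0.
Proof.
have := tameM (tame_coord R (Ordinal M0)) (tame_cst M (dt u 0)^-1); congr tame.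
by apply/funext => z; rewrite zeta0E.
Qed.

Let shift0_incr a w :
  tup M (fun k w => (if k == 0%N then a else 0) + 1 * incr W u k w) w = shift0 a (Z w).
Proof. by apply: eq_from_tnth => k; rewrite !tnth_mktuple mul1r. Qed.

Let shift0K a z : shift0 (- a) (shift0 a z) = z.
Proof.
apply: eq_from_tnth => k; rewrite !tnth_mktuple; case: eqP => _; last by rewrite !add0r.
by rewrite addrA addNr add0r.
Qed.

Let measurable_shift0 a : measurable_fun [set: M.-tuple R] (shift0 a).
Proof.
apply/measurable_fun_tnthP => k.
rewrite (_ : _ \o _ = fun z => (if k == 0 :> nat then a else 0) + tnth z k); last first.
  by apply/funext => z /=; rewrite tnth_mktuple.
by apply: measurable_funD => //; exact: measurable_tnth.
Qed.

(** Cameron-Martin on the first increment: the shift leaves the payoff and goes to the polynomial,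
    with density exp (a zeta0 - a^2 / (2 dt u 0)). *)
Let price_shift x p a : 0 < x -> tame p ->
  \int[P]_w (H x (shift0 a (Z w)) * p (Z w)) =
  expR (- (a ^+ 2 / (2 * dt u 0))) *
  \int[P]_w (H x (Z w) * p (shift0 (- a) (Z w)) * expR (a * zeta0 (Z w))).
Proof.
move=> x0 tp; have [mp _] := tp.
pose K z := H x z * p (shift0 (- a) z).
have mK : measurable_fun [set: M.-tuple R] K.
  by apply: measurable_funM => //; exact: (measurableT_comp mp).
have xa : 0 < x * expR (a * sigma) by rewrite mulr_gt0 ?expR_gt0.
have iK : itg P (fun w => K (tup M (fun k w => (if k == 0%N then a else 0) + 1 * incr W u k w) w)).
  have := tame_itg hW u0 uS (mH _) (price_gauss_itg xa) tp; congr itg.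
  by apply/funext => w; rewrite shift0_incr /K shift0K Hshift mulfK// gt_eqF.
have [iK' EK] := itg_gaussian_affine gD (fun _ _ => ltr01) mK iK.
have -> : \int[P]_w (H x (shift0 a (Z w)) * p (Z w)) = \int[P]_w
    K (tup M (fun k w => (if k == 0%N then a else 0) + 1 * incr W u k w) w).
  by apply: eq_Rintegral => w _; rewrite shift0_incr /K shift0K.
have rE w : \prod_(k < M) gauss_ratio (if k == 0 :> nat then a else 0) 1 (dt u k) (incr W u k w) =
    expR (- (a ^+ 2 / (2 * dt u 0))) * expR (a * zeta0 (Z w)).
  have d0 := dtp M0.
  rewrite (bigD1 (Ordinal M0))//= [X in _ * X]big1 ?mulr1 => [|k k0].
    rewrite /gauss_ratio invr1 mul1r -expRD zeta0E tnth_tup; congr expR.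
    by field; rewrite gt_eqF.
  have -> : (k == 0 :> nat) = false.
    by apply/negbTE; move: k0; apply: contra => /eqP k0; apply/eqP/val_inj.
  by rewrite /gauss_ratio invr1 mul1r expr1n mulr1 subr0 subrr expR0.
rewrite EK -RintegralZl//.
  by apply: eq_Rintegral => w _; rewrite rE /K; ring.
have := itgZ (expR (a ^+ 2 / (2 * dt u 0))) iK'; congr itg; apply/funext => w.
rewrite rE /K !mulrA -expRD addrN expR0 mul1r; ring.
Qed.

Let zeta_tilt x p c : 0 < c -> 0 < x -> tame p ->
  itg P (fun w => `|H x (Z w) * p (Z w)| * expR (c * `|zeta0 (Z w)|)).
Proof.
move=> c0 x0 [mp hp]; have [e e0 ie] := price_gauss_itg x0.
have d0 := dtp M0.
have e2 : 0 < e / 2 by rewrite divr_gt0.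
have [C C0 hC] := hp _ e2.
have [mz _] := tame_zeta0.
have := itgZ (C * expR ((c ^+ 2 / (2 * e * dt u 0 ^+ 2)))) ie; apply: itg_le.
  apply: measurable_funM.
    apply: measurableT_comp => //; apply: measurable_funM; first exact: measurableT_comp.
    exact: (measurableT_comp mp).
  apply: measurableT_comp => //; apply: measurable_funM => //.
  by apply: measurableT_comp => //; exact: (measurableT_comp mz).
move=> w; rewrite ger0_norm ?mulr_ge0 ?expR_ge0// normrM.
have zb : c * `|zeta0 (Z w)| <= e / 2 * sqnorm (Z w) + (c ^+ 2 / (2 * e * dt u 0 ^+ 2)).
  rewrite zeta0E normrM (@ger0_norm _ (dt u 0)^-1) ?invr_ge0 ?(ltW d0)//.
  set y := tnth _ _; have yN : y ^+ 2 <= sqnorm (Z w) by exact: coord_le_sqnorm.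
  have h1 := ler_wpM2l (ltW e2) yN.
  have h2 : 0 <= (2 * e)^-1 * (e * `|y| - c / dt u 0) ^+ 2.
    by rewrite mulr_ge0 ?sqr_ge0// invr_ge0 mulr_ge0// ltW.
  have h3 : (2 * e)^-1 * (e * `|y| - c / dt u 0) ^+ 2 =
     e / 2 * y ^+ 2 - c * (`|y| / dt u 0) + (c ^+ 2 / (2 * e * dt u 0 ^+ 2)).
    by rewrite -[y ^+ 2]real_normK ?num_real//; field; rewrite !gt_eqF.
  rewrite h3 in h2; lra.
have -> : C * expR (c ^+ 2 / (2 * e * dt u 0 ^+ 2)) * (`|H x (Z w)| * expR (e * sqnorm (Z w))) =
   `|H x (Z w)| * ((C * expR (e / 2 * sqnorm (Z w))) *
     expR (e / 2 * sqnorm (Z w) + (c ^+ 2 / (2 * e * dt u 0 ^+ 2)))).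
  rewrite expRD.
  have -> : expR (e * sqnorm (Z w)) = expR (e / 2 * sqnorm (Z w)) * expR (e / 2 * sqnorm (Z w)).
    by rewrite -expRD; congr expR; field.
  by ring.
rewrite -[leLHS]mulrA ler_wpM2l//; apply: ler_pM => //.
by rewrite ler_expR.
Qed.

(** Gaussian integration by parts. A price y near x is x exp (a sigma) with a = ln (y / x) / sigma,
    so the expectation is a function of the shift [a]. At a = 0 its derivative is [zeta0] from the
    density minus [p1] from the polynomial, and da / dy is 1 / (sigma x). The polynomials in use
    become quadratic in [a] when shifted, hence the form of the last hypothesis. *)
Lemma price_delta (x : R) (p p1 p2 : M.-tuple R -> R) : 0 < x -> tame p -> tame p1 -> tame p2 ->
  (forall a z, p (shift0 (- a) z) = p z - a * p1 z + a ^+ 2 * p2 z) ->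
  is_derive x 1 (fun y => \int[P]_w (H y (Z w) * p (Z w)))
    ((sigma * x)^-1 * \int[P]_w (H x (Z w) * (p (Z w) * zeta0 (Z w) - p1 (Z w)))).
Proof.
move=> x0 tp tp1 tp2 pE; have sn : sigma != 0 by rewrite gt_eqF.
have xn : x != 0 by rewrite gt_eqF.
have [mz _] := tame_zeta0.
pose T (q : M.-tuple R -> R) a := \int[P]_w (H x (Z w) * q (Z w) * expR (a * zeta0 (Z w))).
have mHq q : tame q -> measurable_fun [set: Omega] (fun w => H x (Z w) * q (Z w)).
  by move=> [mq _]; apply: measurable_funM; exact: measurableT_comp.
have mzZ : measurable_fun [set: Omega] (fun w => zeta0 (Z w)) by exact: (measurableT_comp mz).
have dT q : tame q -> is_derive (0 : R) 1 (T q) (\int[P]_w (H x (Z w) * q (Z w) * zeta0 (Z w))).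
  by move=> tq; exact: (tilt_derive ltr01 (mHq _ tq) mzZ (zeta_tilt ltr01 x0 tq)).
pose F (y : R) := \int[P]_w (H y (Z w) * p (Z w)).
pose E (a : R) := expR (- (a ^+ 2 / (2 * dt u 0))).
pose ta (y : R) := ln (y / x) / sigma.
pose Q (a : R) := E a * (T p a - a * T p1 a + a ^+ 2 * T p2 a).
have FE y : 0 < y -> F y = Q (ta y).
  move=> y0; set a := ta y.
  have yE : y = x * expR (a * sigma).
    by rewrite /a /ta divfK// lnK ?posrE ?divr_gt0// mulrC divfK.
  have t0 : tame (fun z => p (shift0 (- a) z)).
    have := tameD (tameB tp (tameZ a tp1)) (tameZ (a ^+ 2) tp2); congr tame.
    by apply/funext => z; rewrite pE.
  have iT q : tame q -> itg P (fun w => H x (Z w) * q (Z w) * expR (a * zeta0 (Z w))).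
    move=> tq; have a1 : 0 < `|a| + 1 by rewrite ltr_wpDl.
    by apply: (tilt_itg (mHq _ tq) mzZ (zeta_tilt a1 x0 tq)); rewrite lerDl.
  have i0 := iT _ tp; have i1 := itgZ a (iT _ tp1); have i2 := itgZ (a ^+ 2) (iT _ tp2).
  have i01 := itgB i0 i1.
  transitivity (\int[P]_w (H x (shift0 a (Z w)) * p (Z w))).
    by apply: eq_Rintegral => w _; rewrite {1}yE Hshift mulfK.
  rewrite price_shift// /Q; congr (_ * _).
  rewrite /T -!RintegralZl//; [|exact: iT|exact: iT].
  rewrite -RintegralB// -RintegralD//.
  by apply: eq_Rintegral => w _; rewrite pE; ring.
have dQ : is_derive (0 : R) 1 Q (\int[P]_w (H x (Z w) * (p (Z w) * zeta0 (Z w) - p1 (Z w)))).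
  have d0 := dT p tp; have d1 := dT p1 tp1; have d2 := dT p2 tp2.
  rewrite /Q /E; apply: is_derive_eq.
  rewrite /GRing.scale/= expr0n/= !mul0r oppr0 expR0.
  have T10 : T p1 0 = \int[P]_w (H x (Z w) * p1 (Z w)).
    by apply: eq_Rintegral => w _; rewrite mul0r expR0 mulr1.
  have iz := tilt_itg_mul ltr01 (mHq _ tp) mzZ (zeta_tilt ltr01 x0 tp).
  have i1 : itg P (fun w => H x (Z w) * p1 (Z w)).
    exact: (tame_itg hW u0 uS (mH x) (price_gauss_itg x0) tp1).
  transitivity (\int[P]_w (H x (Z w) * p (Z w) * zeta0 (Z w)) - T p1 0); first by ring.
  rewrite T10 -RintegralB//; apply: eq_Rintegral => w _; ring.
have dta : is_derive x 1 ta (sigma * x)^-1.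
  have dl : is_derive x 1 (fun y : R => y / x) x^-1.
    by apply: is_derive_eq; rewrite /GRing.scale/=; ring.
  have x1 : 0 < x / x by rewrite divff.
  have dc := @is_derive1_comp _ (@ln R) (fun y => y / x) x _ _ (is_derive1_ln x1) dl.
  apply: (is_derive_eq (is_deriveM dc (is_derive_cst sigma^-1 x 1))).
  by rewrite /GRing.scale/=; field; rewrite ?sn ?xn.
have ta0 : ta x = 0 by rewrite /ta divff// ln1 mul0r.
have dQ' : is_derive (ta x) 1 Q (\int[P]_w (H x (Z w) * (p (Z w) * zeta0 (Z w) - p1 (Z w)))).
  by rewrite ta0.
apply: (@near_eq_is_derive _ _ _ (Q \o ta)).
  near=> y; rewrite /= -FE//; near: y; exact: lt_nbhsr.
by apply: (is_derive_eq (is_derive1_comp dQ' dta)); rewrite mulrC.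
Unshelve. all: by end_near. Qed.

End PriceFunctional.

(** * The operators of the first-order correction applied to a price *)

Section Greeks.
Context (R : realType) (d : measure_display) (Omega : measurableType d).
Variables (P : probability Omega R) (W : R -> Omega -> R).
Hypothesis hW : brownian_motion P W.
Variables (M : nat) (u : nat -> R).
Hypotheses (u0 : 0 <= u 0%N) (uS : forall k, (k < M)%N -> u k < u k.+1).
Hypothesis M0 : (0 < M)%N.
Local Notation Z := (tup M (incr W u)).
Variable sigma : R.
Hypothesis s0 : 0 < sigma.
Variable H : R -> M.-tuple R -> R.
Hypothesis mH : forall x, measurable_fun [set: M.-tuple R] (H x).
Hypothesis Hshift : forall x t z, H (x * expR t) z = H x (shift0 (t / sigma) z).
Hypothesis Hint : forall v x, 0 < v -> 0 < x ->
  itg P (fun w => H x (tup M (vol_incr W u sigma v) w)).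
Variable c : R.

Local Notation Phi p := (fun y : R => \int[P]_w (c * (H y (Z w) * p (Z w)))).
Local Notation zeta0 := (zeta0 u).
Local Notation S := (vega_poly u sigma).
Local Notation d0 := (dt u 0).

Let dp : d0 != 0. Proof. by rewrite gt_eqF// (dt_gt0 uS). Qed.
Let sn : sigma != 0. Proof. by rewrite gt_eqF. Qed.

Lemma price_tame_itg (x : R) (p : M.-tuple R -> R) : 0 < x -> tame p -> itg P (fun w => H x (Z w) * p (Z w)).
Proof.
move=> x0 tp.
exact: (tame_itg hW u0 uS (mH x) (price_gauss_itg hW u0 uS M0 s0 mH Hint x0) tp).
Qed.

Let PhiE (x : R) (p : M.-tuple R -> R) : 0 < x -> tame p -> Phi p x = c * \int[P]_w (H x (Z w) * p (Z w)).
Proof. by move=> x0 tp /=; have i := price_tame_itg x0 tp; rewrite RintegralZl. Qed.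

Let Phi_derive (x : R) (p p1 p2 : M.-tuple R -> R) : 0 < x -> tame p -> tame p1 -> tame p2 ->
  (forall a z, p (shift0 (- a) z) = p z - a * p1 z + a ^+ 2 * p2 z) ->
  is_derive x 1 (Phi p) ((sigma * x)^-1 * Phi (fun z => p z * zeta0 z - p1 z) x).
Proof.
move=> x0 tp tp1 tp2 pE.
have := price_delta hW u0 uS M0 s0 mH Hshift Hint x0 tp tp1 tp2 pE.
have tq : tame (fun z => p z * zeta0 z - p1 z).
  by apply: tameB => //; apply: tameM => //; exact: tame_zeta0.
rewrite (PhiE x0 tq) => /(is_deriveZ c) dE.
have : is_derive x 1 (fun y => c * \int[P]_w (H y (Z w) * p (Z w)))
    ((sigma * x)^-1 * (c * \int[P]_w (H x (Z w) * (p (Z w) * zeta0 (Z w) - p1 (Z w))))).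
  by apply: (is_derive_eq dE); rewrite /GRing.scale/=; ring.
apply: near_eq_is_derive; near=> y; rewrite PhiE//.
by near: y; exact: lt_nbhsr.
Unshelve. all: by end_near. Qed.

Let zeta0_shift (a : R) (z : M.-tuple R) : zeta0 (shift0 (- a) z) = zeta0 z - a / d0.
Proof.
rewrite /zeta0 -(tnth_nth 0 _ (Ordinal M0)) -(tnth_nth 0 _ (Ordinal M0)).
by rewrite tnth_mktuple /=; field.
Qed.

Let S_shift (a : R) (z : M.-tuple R) : S (shift0 (- a) z) =
  S z - a * (sigma^-1 * (2 * zeta0 z - sigma)) + a ^+ 2 * (sigma^-1 / d0).
Proof.
rewrite /vega_poly [in LHS](bigD1 (Ordinal M0))//= [in RHS](bigD1 (Ordinal M0))//= !tnth_mktuple/=.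
rewrite (eq_bigr (fun k : 'I_M =>
  -1 + (tnth z k - sigma * dt u k) * tnth z k / dt u k)); last first.
  move=> k k0; rewrite tnth_mktuple; have -> : (k == 0 :> nat) = false.
    by apply/negbTE; move: k0; apply: contra => /eqP k0; apply/eqP/val_inj.
  by rewrite add0r.
rewrite /zeta0 -(tnth_nth 0 _ (Ordinal M0)); set X := \sum_(_ < _ | _) _.
by field; rewrite sn dp.
Qed.

Definition vega_delta_poly (z : M.-tuple R) : R := sigma^-1 * (S z * zeta0 z - sigma^-1 * (2 * zeta0 z - sigma)).
(** With D = x d/dx, the operator D_1 D_2 is D^3 - D^2; the two brackets are the Hermite polynomials
    of degrees 3 and 2 in [zeta0], for the variance 1 / [d0]. *)
Definition gamma_delta_poly (z : M.-tuple R) : R :=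
  sigma ^- 3 * (zeta0 z ^+ 3 - 3 * zeta0 z / d0) - sigma ^- 2 * (zeta0 z ^+ 2 - d0^-1).

Let t1 (v : R) := tame_cst M v.
Let tz := tame_zeta0 u M0.
Let tS := tame_vega_poly M u sigma.

Lemma Dop_vega (x : R) : 0 < x -> Dop 1 (Phi S) x = Phi vega_delta_poly x.
Proof.
move=> x0; rewrite /Dop /= expr1.
have tp1 : tame (fun z : M.-tuple R => sigma^-1 * (2 * zeta0 z - sigma)).
  exact: (tameZ sigma^-1 (tameB (tameZ 2 tz) (t1 sigma))).
have tq := tameB (tameM tS tz) tp1.
have [_ D] := Phi_derive x0 tS tp1 (t1 (sigma^-1 / d0)) S_shift.
rewrite derive1E D (PhiE x0 tq) (PhiE x0 (tameZ sigma^-1 tq)).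
have i := price_tame_itg x0 tq.
have -> : \int[P]_w (H x (Z w) * vega_delta_poly (Z w)) =
    sigma^-1 * \int[P]_w (H x (Z w) * (S (Z w) * zeta0 (Z w) - sigma^-1 * (2 * zeta0 (Z w) - sigma))).
  by rewrite -RintegralZl//; apply: eq_Rintegral => w _; rewrite /vega_delta_poly; ring.
by field; rewrite sn gt_eqF.
Qed.

Lemma Dop_gamma (x : R) : 0 < x ->
  Dop 1 (Dop 2 (Phi (fun=> 1))) x = Phi gamma_delta_poly x.
Proof.
move=> x0.
have tz2 : tame (fun z : M.-tuple R => zeta0 z ^+ 2 - d0^-1).
  exact: (tameB (tameX 2 tz) (t1 d0^-1)).
(* Each derivative in the price raises the degree of the Hermite polynomial by one. The formulas
   hold for positive prices only, so iterated derivatives are taken after replacing functions on a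
   neighbourhood. *)
have D1 (y : R) : 0 < y -> is_derive y 1 (Phi (fun=> 1)) ((sigma * y)^-1 * Phi zeta0 y).
  move=> y0; have pE (a : R) (z : M.-tuple R) : 1 = 1 - a * 0 + a ^+ 2 * 0 :> R.
    by rewrite !mulr0 subr0 addr0.
  apply: (is_derive_eq (Phi_derive y0 (t1 1) (t1 0) (t1 0) pE)); congr (_ * _).
  by apply: eq_Rintegral => w _; rewrite mul1r subr0.
have D2 (y : R) : 0 < y -> is_derive y 1 (Phi zeta0)
    ((sigma * y)^-1 * Phi (fun z => zeta0 z ^+ 2 - d0^-1) y).
  move=> y0; have pE (a : R) (z : M.-tuple R) :
      zeta0 (shift0 (- a) z) = zeta0 z - a * d0^-1 + a ^+ 2 * 0.
    by rewrite zeta0_shift mulr0 addr0.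
  apply: (is_derive_eq (Phi_derive y0 tz (t1 d0^-1) (t1 0) pE)); congr (_ * _).
have D3 (y : R) : 0 < y -> is_derive y 1 (Phi (fun z => zeta0 z ^+ 2 - d0^-1))
    ((sigma * y)^-1 * Phi (fun z => (zeta0 z ^+ 2 - d0^-1) * zeta0 z - 2 * zeta0 z / d0) y).
  move=> y0; have tp1 : tame (fun z : M.-tuple R => 2 * zeta0 z / d0).
    exact: (tameM (tameZ 2 tz) (t1 d0^-1)).
  have pE (a : R) (z : M.-tuple R) : zeta0 (shift0 (- a) z) ^+ 2 - d0^-1 =
      zeta0 z ^+ 2 - d0^-1 - a * (2 * zeta0 z / d0) + a ^+ 2 * d0 ^- 2.
    by rewrite zeta0_shift; field.
  exact: Phi_derive y0 tz2 tp1 (t1 (d0 ^- 2)) pE.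
have D12 (y : R) : 0 < y -> derive1n 2 (Phi (fun=> 1)) y =
    (sigma * y)^-1 * ((sigma * y)^-1 * Phi (fun z => zeta0 z ^+ 2 - d0^-1) y)
    - sigma^-1 * y ^- 2 * Phi zeta0 y.
  move=> y0; have yn : y != 0 by rewrite gt_eqF.
  rewrite /= derive1E.
  have dV : is_derive y 1 (fun v : R => v^-1) (- y ^- 2).
    have := @is_deriveV _ (fun v : R => v) y _ 1 yn (is_derive_id _ _).
    by move=> dV; apply: (is_derive_eq dV); rewrite /GRing.scale/= mulr1.
  have dd : is_derive y 1 ((Phi (fun=> 1))^`())%classic
      ((sigma * y)^-1 * ((sigma * y)^-1 * Phi (fun z => zeta0 z ^+ 2 - d0^-1) y)
       - sigma^-1 * y ^- 2 * Phi zeta0 y).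
    apply: (@near_eq_is_derive R R R (fun v : R => sigma^-1 * v^-1 * Phi zeta0 v) _ y 1 _).
      near=> v; have v0 : 0 < v by near: v; exact: lt_nbhsr.
      by have [_ E] := D1 _ v0; rewrite derive1E E invfM.
    have dm := is_deriveM (is_deriveM (is_derive_cst sigma^-1 y 1) dV) (D2 _ y0).
    apply: (is_derive_eq dm); rewrite /GRing.scale/= mulrfctE/=.
    by field; rewrite sn yn.
  by have [_ ->] := dd.
rewrite {1}/Dop /= expr1 derive1E.
have dD : is_derive x 1 (Dop 2 (Phi (fun=> 1)))
    (sigma ^- 2 * ((sigma * x)^-1 * Phi (fun z => (zeta0 z ^+ 2 - d0^-1) * zeta0 z - 2 * zeta0 z / d0) x)
     - sigma^-1 * ((sigma * x)^-1 * Phi (fun z => zeta0 z ^+ 2 - d0^-1) x)).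
  apply: (@near_eq_is_derive R R R (fun v : R =>
     sigma ^- 2 * Phi (fun z => zeta0 z ^+ 2 - d0^-1) v - sigma^-1 * Phi zeta0 v) _ x 1 _).
    near=> v; have v0 : 0 < v by near: v; exact: lt_nbhsr.
    by rewrite /Dop D12//; field; rewrite sn gt_eqF.
  have dm := is_deriveB (is_deriveM (is_derive_cst (sigma ^- 2) x 1) (D3 _ x0))
    (is_deriveM (is_derive_cst (sigma^-1) x 1) (D2 _ x0)).
  by apply: (is_derive_eq dm); rewrite /GRing.scale/=; ring.
have [_ ->] := dD.
have t3 : tame (fun z : M.-tuple R => (zeta0 z ^+ 2 - d0^-1) * zeta0 z - 2 * zeta0 z / d0).
  exact: (tameB (tameM tz2 tz) (tameM (tameZ 2 tz) (t1 d0^-1))).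
have tg : tame gamma_delta_poly.
  exact: (tameB (tameZ (sigma ^- 3) (tameB (tameX 3 tz) (tameM (tameZ 3 tz) (t1 d0^-1))))
    (tameZ (sigma ^- 2) tz2)).
have := PhiE x0 tg; have := PhiE x0 t3; have := PhiE x0 tz2; move=> /= -> -> ->.
have i3 := itgZ (sigma ^- 3) (price_tame_itg x0 t3).
have i2 := itgZ (sigma ^- 2) (price_tame_itg x0 tz2).
have j3 := price_tame_itg x0 t3; have j2 := price_tame_itg x0 tz2.
have -> : \int[P]_w (H x (Z w) * gamma_delta_poly (Z w)) =
  sigma ^- 3 * \int[P]_w (H x (Z w) * ((zeta0 (Z w) ^+ 2 - d0^-1) * zeta0 (Z w) - 2 * zeta0 (Z w) / d0))
  - sigma ^- 2 * \int[P]_w (H x (Z w) * (zeta0 (Z w) ^+ 2 - d0^-1)).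
  rewrite -!RintegralZl// -RintegralB//; apply: eq_Rintegral => w _.
  by rewrite /gamma_delta_poly; ring.
by field; rewrite sn gt_eqF.
Unshelve. all: by end_near. Qed.

Lemma price_vega_eq (x : R) : 0 < x ->
  derive1 (fun v => \int[P]_w (c * H x (tup M (vol_incr W u sigma v) w))) sigma = Phi S x.
Proof.
move=> x0; have := price_vega hW u0 uS M0 s0 mH Hint x0.
rewrite PhiE// => /(is_deriveZ c) dE; rewrite derive1E.
have [_ D] : is_derive sigma 1 (fun v => \int[P]_w (c * H x (tup M (vol_incr W u sigma v) w)))
   (c * \int[P]_w (H x (Z w) * S (Z w))).
  apply: (near_eq_is_derive _ dE); near=> v; rewrite RintegralZl//.
  by apply: Hint => //; near: v; exact: lt_nbhsr.
exact: D.
Unshelve. all: by end_near. Qed.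

End Greeks.

(** * The payoff as a function of Brownian increments *)

Section PayoffOnIncrements.
Context (R : realType) (d : measure_display) (Omega : measurableType d).
Variables (P : probability Omega R) (W : R -> Omega -> R).
Hypothesis hW : brownian_motion P W.
Variables (n : nat) (tm : nat -> R) (r sigma : R).
Hypotheses (htm : monitoring_grid n tm) (s0 : 0 < sigma).
Variable h : n.-tuple R -> R.
Hypothesis hh : admissible_payoff P W tm r h.

Lemma grid_mono k l : (k <= l <= n)%N -> tm k <= tm l.
Proof.
move=> /andP[]; elim: l => [|l IH]; first by rewrite leqn0 => /eqP ->.
rewrite leq_eqVlt => /predU1P[->//|kl] ln; apply: (le_trans (IH _ (ltnW ln))) => //.
by case: htm => _ H; exact/ltW/H.
Qed.

Lemma grid_ge0 k : (k <= n)%N -> 0 <= tm k.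
Proof. by move=> kn; case: htm => <- _; exact: grid_mono. Qed.

(** The grid s, t_{j+1}, ..., t_n renumbered from 0, with n - j cells; its first cell starts at [s]
    instead of t_j. *)
Definition cell_grid (j : nat) (s : R) (k : nat) : R :=
  if k == 0%N then s else tm (k + j).

Lemma cell_grid0 j s : cell_grid j s 0 = s. Proof. by []. Qed.
Lemma cell_gridS j s k : cell_grid j s k.+1 = tm (k + j).+1.
Proof. by rewrite /cell_grid /= addSn. Qed.

Lemma cell_grid_incr j s k : (j < n)%N -> s < tm j.+1 -> (k < n - j)%N ->
  cell_grid j s k < cell_grid j s k.+1.
Proof.
move=> jn st; rewrite cell_gridS ltn_subRL => kn.
rewrite /cell_grid; case: eqP => [->//|_].
by case: htm => _; apply; rewrite addnC.
Qed.

Definition log_incr (u : nat -> R) (l : nat) (x : R) : R :=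
  (r - sigma ^+ 2 / 2) * dt u l + sigma * x.

(** The observation of index [k] is made at t_{k+1}, the end of cell k - j of the grid from [s],
    hence the k - j + 1 summands. They stay within the tuple, so the default 0 of [nth] is never
    reached. *)
Definition cell_payoff (j : nat) (s : R) (y : nat -> R) (x : R)
    (z : (n - j).-tuple R) : R :=
  h [tuple if (k < j)%N then y k else
    x * expR (\sum_(l < (k - j).+1) log_incr (cell_grid j s) l (nth 0 z l)) | k < n].

Lemma sum_incr (u : nat -> R) w m : \sum_(l < m) incr W u l w = W (u m) w - W (u 0%N) w.
Proof.
by rewrite -(big_mkord xpredT (fun l => incr W u l w)) telescope_sumr.
Qed.

Lemma sum_dt (u : nat -> R) m : \sum_(l < m) dt u l = u m - u 0%N.
Proof. by rewrite -(big_mkord xpredT (dt u)) telescope_sumr. Qed.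

Lemma nth_tup (X : nat -> Omega -> R) m w k : (k < m)%N -> nth 0 (tup m X w) k = X k w.
Proof. by move=> km; have := tnth_tup X w (Ordinal km); rewrite (tnth_nth 0). Qed.

Lemma fixings_vol (j : nat) (s : R) (y : nat -> R) (x v : R) (w : Omega) : (j < n)%N ->
  h (fixings n tm j y (fun u => gbm W r v s x u w)) =
  cell_payoff s y x (tup (n - j) (vol_incr W (cell_grid j s) sigma v) w).
Proof.
move=> jn; congr h; apply: eq_from_tnth => k; rewrite !tnth_mktuple /observed.
case: ltnP => // jk; rewrite /gbm; congr (_ * expR _).
have lM (l : 'I_(k - j).+1) : (l < n - j)%N.
  by rewrite (leq_ltn_trans (leq_ord l))// ltn_sub2r.
under eq_bigr => l _ do rewrite nth_tup//.
rewrite (eq_bigr (fun l : 'I_(k - j).+1 => (r - v ^+ 2 / 2) * dt (cell_grid j s) l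
    + v * incr W (cell_grid j s) l w)); last first.
  by move=> l _; rewrite /log_incr /vol_incr; field; rewrite gt_eqF.
by rewrite big_split/= -!mulr_sumr sum_dt sum_incr cell_gridS cell_grid0 subnK.
Qed.

Lemma fixings_incr (j : nat) (s : R) (y : nat -> R) (x : R) (w : Omega) : (j < n)%N ->
  h (fixings n tm j y (fun u => gbm W r sigma s x u w)) =
  cell_payoff s y x (tup (n - j) (incr W (cell_grid j s)) w).
Proof.
move=> jn; rewrite fixings_vol//; congr cell_payoff.
apply: eq_from_tnth => k; rewrite !tnth_tup /vol_incr subrr !mul0r add0r divff ?mul1r//.
by rewrite gt_eqF.
Qed.

Lemma measurable_nth m k : measurable_fun [set: m.-tuple R] (fun z => nth 0 z k).
Proof.
have [km|mk] := ltnP k m.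
  rewrite (_ : (fun _ => _) = fun z => tnth z (Ordinal km)); first exact: measurable_tnth.
  by apply/funext => z; rewrite (tnth_nth 0).
rewrite (_ : (fun _ => _) = cst 0); first exact: measurable_cst.
by apply/funext => z; rewrite nth_default// size_tuple.
Qed.

Lemma measurable_log_path (dT : measure_display) (T' : measurableType dT) m
    (f : T' -> m.-tuple R) (u : nat -> R) k : measurable_fun [set: T'] f ->
  measurable_fun [set: T'] (fun z => expR (\sum_(l < k) log_incr u l (nth 0 (f z) l))).
Proof.
move=> mf; apply: measurableT_comp => //; apply: measurable_sum => l.
apply: measurable_funD; first exact: measurable_cst.
apply: measurable_funM; first exact: measurable_cst.
exact: (measurableT_comp (@measurable_nth m l) mf).
Qed.

Lemma measurable_cell_payoff (j : nat) (s : R) (y : nat -> R) (x : R) :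
  measurable_fun [set: (n - j).-tuple R] (@cell_payoff j s y x).
Proof.
case: hh => mh _; apply: measurableT_comp => //; apply/measurable_fun_tnthP => k.
rewrite (_ : _ \o _ = fun z : (n - j).-tuple R => if (k < j)%N then y k else
    x * expR (\sum_(l < (k - j).+1) log_incr (cell_grid j s) l (nth 0 z l))).
  case: ltnP => _; first exact: measurable_cst.
  by apply: measurable_funM => //; exact: measurable_log_path.
by apply/funext => z /=; rewrite tnth_mktuple.
Qed.

Lemma nth_shift0 m (a : R) (z : m.-tuple R) l : (l < m)%N ->
  nth 0 (shift0 a z) l = (if l == 0%N then a else 0) + nth 0 z l.
Proof.
by move=> lm; have := tnth_mktuple (fun k : 'I_m => (if k == 0 :> nat then a else 0) + tnth z k)
  (Ordinal lm); rewrite !(tnth_nth 0).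
Qed.

Lemma cell_payoff_shift (j : nat) (s : R) (y : nat -> R) (x a : R) (z : (n - j).-tuple R) : (j < n)%N ->
  cell_payoff s y (x * expR a) z = cell_payoff s y x (shift0 (a / sigma) z).
Proof.
move=> jn; congr h; apply: eq_from_tnth => k; rewrite !tnth_mktuple.
case: ltnP => // jk; rewrite -mulrA -expRD; congr (_ * expR _).
have lM (l : 'I_(k - j).+1) : (l < n - j)%N.
  by rewrite (leq_ltn_trans (leq_ord l))// ltn_sub2r.
rewrite [in RHS](eq_bigr (fun l : 'I_(k - j).+1 => sigma * (if l == 0 :> nat then a / sigma else 0)
    + log_incr (cell_grid j s) l (nth 0 z l))); last first.
  move=> l _; rewrite nth_shift0// /log_incr; case: ifP => _ /=; ring.
rewrite [in RHS]big_split/=; congr (_ + _); rewrite big_ord_recl/= big1 => [|l _]; last by rewrite mulr0.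
by rewrite addr0; field; rewrite gt_eqF.
Qed.

Section Cell.
Variables (j : nat) (s : R) (y : nat -> R).
Hypotheses (jn : (j < n)%N) (js : tm j <= s < tm j.+1).
Hypothesis y0 : forall k, (k < j)%N -> 0 < y k.
Local Notation u := (cell_grid j s).
Local Notation M := (n - j)%N.

Lemma cell_grid_start_ge0 : 0 <= u 0%N.
Proof. by case/andP: js => + _; apply: le_trans; exact/grid_ge0/ltnW. Qed.

Lemma cell_gridP k : (k < M)%N -> u k < u k.+1.
Proof. by case/andP: js => _ st; exact: cell_grid_incr. Qed.

Lemma cell_payoff_itg (v x : R) : 0 < v -> 0 < x ->
  itg P (fun w => cell_payoff s y x (tup M (vol_incr W u sigma v) w)).
Proof.
move=> v0 x0; case: hh => _ /(_ v j s y x v0 jn js y0 x0).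
by congr (_.-integrable _ _); apply/funext => w /=; rewrite fixings_vol.
Qed.

Variables (V0 V1 V3 : R).

Definition greek_poly (z : M.-tuple R) : R :=
  2 * V0 * vega_poly u sigma z + 2 * V1 * vega_delta_poly u sigma z +
  V3 * gamma_delta_poly u sigma z.

Let M0 : (0 < M)%N. Proof. by rewrite subn_gt0. Qed.
Let tz := tame_zeta0 u M0.
Let tS := tame_vega_poly M u sigma.

Lemma tame_vega_delta_poly : tame (@vega_delta_poly R M u sigma).
Proof.
exact: (tameZ sigma^-1 (tameB (tameM tS tz)
  (tameZ sigma^-1 (tameB (tameZ 2 tz) (tame_cst M sigma))))).
Qed.

Lemma tame_gamma_delta_poly : tame (@gamma_delta_poly R M u sigma).
Proof.
have tc := tame_cst M (dt u 0)^-1.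
exact: (tameB (tameZ (sigma ^- 3) (tameB (tameX 3 tz) (tameM (tameZ 3 tz) tc)))
    (tameZ (sigma ^- 2) (tameB (tameX 2 tz) tc))).
Qed.

Lemma tame_greek_poly : tame greek_poly.
Proof.
exact: (tameD (tameD (tameZ (2 * V0) tS) (tameZ (2 * V1) tame_vega_delta_poly))
  (tameZ V3 tame_gamma_delta_poly)).
Qed.

Local Notation c := (expR (- r * (tm n - s))).
Local Notation Z := (tup M (incr W u)).
Local Notation Phi p := (fun x : R => \int[P]_w (c * (cell_payoff s y x (Z w) * p (Z w)))).
Let u0 := cell_grid_start_ge0.
Let uS := cell_gridP.
Let mH := @measurable_cell_payoff j s y.
Let Hshift (x a : R) (z : M.-tuple R) := cell_payoff_shift s y x a z jn.

Let P0E (v x : R) : P0 P W tm r h v j s y x =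
  \int[P]_w (c * cell_payoff s y x (tup M (vol_incr W u sigma v) w)).
Proof. by apply: eq_Rintegral => w _; rewrite fixings_vol. Qed.

Lemma P0_sigmaE (x : R) : P0 P W tm r h sigma j s y x =
  \int[P]_w (c * cell_payoff s y x (Z w)).
Proof. by apply: eq_Rintegral => w _; rewrite fixings_incr. Qed.

Let P0E1 : P0 P W tm r h sigma j s y = Phi (fun=> 1).
Proof.
by apply/funext => x; rewrite P0_sigmaE; apply: eq_Rintegral => w _; rewrite mulr1.
Qed.

Let vegaE (x : R) : 0 < x -> vega P W tm r sigma h j s y x = Phi (vega_poly u sigma) x.
Proof.
move=> x0; have := price_vega_eq hW u0 uS M0 s0 mH cell_payoff_itg c x0.
have <- : (fun v => P0 P W tm r h v j s y x) =
    fun v => \int[P]_w (c * cell_payoff s y x (tup M (vol_incr W u sigma v) w)).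
  by apply/funext => v; exact: P0E.
exact: id.
Qed.

Let vega_DopE (x : R) : 0 < x ->
  Dop 1 (vega P W tm r sigma h j s y) x = Phi (@vega_delta_poly R M u sigma) x.
Proof.
move=> x0; apply: etrans (Dop_vega hW u0 uS M0 s0 mH Hshift cell_payoff_itg c x0).
rewrite /Dop /=; congr (_ * _); rewrite !derive1E; apply: near_eq_derive.
by near=> z; apply: vegaE; near: z; exact: lt_nbhsr.
Unshelve. all: by end_near. Qed.

Lemma HP0E (x : R) : 0 < x -> HP0 P W tm r sigma V0 V1 V3 h j s y x =
  \int[P]_w (c * (cell_payoff s y x (Z w) * greek_poly (Z w))).
Proof.
move=> x0; rewrite /HP0 vegaE// vega_DopE// P0E1.
rewrite (Dop_gamma hW u0 uS M0 s0 mH Hshift cell_payoff_itg c x0).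
have I (p : M.-tuple R -> R) : tame p -> itg P (fun w => c * (cell_payoff s y x (Z w) * p (Z w))).
  by move=> tp; exact: (itgZ c (price_tame_itg hW u0 uS M0 s0 mH cell_payoff_itg x0 tp)).
have i1 := itgZ (2 * V0) (I _ tS); have i2 := itgZ (2 * V1) (I _ tame_vega_delta_poly).
have i3 := itgZ V3 (I _ tame_gamma_delta_poly); have i12 := itgD i1 i2.
rewrite -!RintegralZl//; [|exact: I tame_gamma_delta_poly|exact: I tame_vega_delta_poly
  |exact: I tS].
rewrite -!RintegralD//; apply: eq_Rintegral => w _; rewrite /greek_poly; ring.
Qed.

End Cell.
End PayoffOnIncrements.

(** * Wiener integrals over an interval, extended to the line *)

Section WienerIntegral.
Context (R : realType) (d : measure_display) (Omega : measurableType d).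
Variables (P : probability Omega R) (W : R -> Omega -> R).
Hypothesis hW : brownian_motion P W.
Local Notation mu := (@lebesgue_measure R).

(** Step functions are built on intervals open on the left; the left endpoint lost here is a null
    set. *)
Lemma integral_itv_indic (p q : R) (F : R -> R) : measurable_fun `[p, q] F ->
  (\int[mu]_(x in `[p, q]) (F x)%:E = \int[mu]_x (F x * \1_`]p, q] x)%:E)%E.
Proof.
move=> mF; rewrite -integral_itv_obnd_cbnd; last first.
  apply/measurable_EFinP; apply: measurable_funS mF => //.
  by apply: subset_itvr; rewrite bnd_simp.
rewrite integral_mkcond; apply: eq_integral => x _; rewrite /patch indicE.
by case: (x \in _); rewrite ?mulr1 ?mulr0.
Qed.

Lemma Rintegral_itv_mul_indic (p q : R) (F : R -> R) : measurable_fun `[p, q] F ->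
  \int[mu]_(x in `[p, q]) F x = \int[mu]_x (F x * \1_`]p, q] x).
Proof. by move=> mF; rewrite /Rintegral integral_itv_indic. Qed.

Lemma indic_idem (A : set R) x : \1_A x ^+ 2 = \1_A x :> R.
Proof. by rewrite indicE; case: (_ \in _); rewrite ?expr1n ?expr0n. Qed.

Lemma itv_indic_sub (p q p' q' x : R) : p' <= p -> q <= q' ->
  \1_`]p, q] x * \1_`]p', q'] x = \1_`]p, q] x :> R.
Proof.
move=> pp qq; rewrite !indicE; have [xpq|] := boolP (x \in `]p, q]%classic); last by rewrite mul0r.
rewrite mem_set ?mulr1//=; move: xpq; rewrite inE /= !in_itv/= => /andP[px xq].
by rewrite (le_lt_trans pp px) (le_trans xq qq).
Qed.

Lemma itv_indic_disj (p q p' q' x : R) : q <= p' -> \1_`]p, q] x * \1_`]p', q'] x = 0 :> R.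
Proof.
move=> qp; rewrite !indicE; have [xpq|] := boolP (x \in `]p, q]%classic); last by rewrite mul0r.
rewrite memNset ?mulr0//=; move: xpq; rewrite inE /= !in_itv/= => /andP[px xq].
by move=> /andP[p'x _]; have := le_lt_trans (le_trans xq qp) p'x; rewrite ltxx.
Qed.

Lemma itv_indic_meet (p q p' q' x : R) : p' <= p -> q' <= q ->
  \1_`]p, q] x * \1_`]p', q'] x = \1_`]p, q'] x :> R.
Proof.
move=> pp qq; rewrite !indicE !mem_setE !in_itv/= -natrM mulnb; congr (_%:R); congr nat_of_bool.
apply/idP/idP => [/andP[/andP[-> _] /andP[_ ->]]//|/andP[px xq]].
by rewrite px xq (le_trans xq qq) (le_lt_trans pp px).
Qed.

Lemma itv_indic_chain (p q v x : R) : p <= q -> q <= v ->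
  \1_`]q, v] x = \1_`]p, v] x - \1_`]p, q] x :> R.
Proof.
move=> pq qv; rewrite !indicE !mem_setE !in_itv/=.
have [xq|qx] := leP x q.
  by rewrite (le_trans xq qv) !andbT subrr.
by rewrite (le_lt_trans pq qx) /= subr0.
Qed.

Lemma square_integrable_L2 (lo hi : R) (f : R -> R) : square_integrable `[lo, hi] f ->
  L2 mu (fun x : R => f x * \1_`]lo, hi] x).
Proof.
move=> [mf foo]; have mf1 : measurable_fun [set: R] (fun x : R => f x * \1_`]lo, hi] x).
  have := @measurable_restrictT _ _ _ _ `]lo, hi]%classic f (measurable_itv _).
  rewrite patch_indic => -[+ _]; apply; apply: measurable_funS mf => //.
  by apply: subset_itvr; rewrite bnd_simp.
split => //; apply: ge0_itgP; first exact: measurable_funX.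
  by move=> x; exact: sqr_ge0.
under eq_integral => x _ do rewrite exprMn indic_idem.
by rewrite -integral_itv_indic//; exact: measurable_funX.
Qed.

Lemma square_integrable_sub (lo hi lo' hi' : R) (f : R -> R) : lo <= lo' -> hi' <= hi ->
  square_integrable `[lo, hi] f -> square_integrable `[lo', hi'] f.
Proof.
move=> l h [mf foo]; have sub : (`[lo', hi'] `<=` `[lo, hi])%classic.
  by apply: subset_itv; rewrite bnd_simp.
split; first exact: measurable_funS mf.
apply: le_lt_trans foo; apply: ge0_subset_integral => //.
  by apply/measurable_EFinP; exact: measurable_funX.
by move=> x _; rewrite lee_fin sqr_ge0.
Qed.

(** The approximating steps are supported in ]lo, hi], so their distance to [f] over the interval is
    the distance on the whole line to the extension of [f] by zero. *)
Lemma wiener_integral_wiener (lo hi : R) (f : R -> R) (I : Omega -> R) : 0 <= lo ->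
  square_integrable `[lo, hi] f -> wiener_integral P W lo hi f I ->
  wiener P W (fun x : R => f x * \1_`]lo, hi] x) I.
Proof.
move=> lo0 hf [mI [l [hl /fine_cvgP[_ cf] /fine_cvgP[finI cI]]]].
have f2 := square_integrable_L2 hf.
have wf m : step_wf (l m).
  by move=> c /(hl m)[l1 l2 _]; rewrite l2 (le_trans lo0 l1).
have supp m x : step_fun (l m) x = step_fun (l m) x * \1_`]lo, hi] x.
  rewrite /step_fun mulr_suml big_seq [RHS]big_seq; apply: eq_bigr => c /(hl m)[l1 _ l3].
  by rewrite -mulrA itv_indic_sub.
have distE m : L2dist2 mu (step_fun (l m)) (fun x : R => f x * \1_`]lo, hi] x) =
    fine (\int[mu]_(x in `[lo, hi]) ((step_fun (l m) x - f x) ^+ 2)%:E)%E.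
  rewrite integral_itv_indic.
    congr fine; apply: eq_integral => x _.
    by rewrite supp -mulrBl exprMn indic_idem -supp.
  apply: measurable_funX; apply: measurable_funB; last by case: hf.
  by case: (step_fun_L2 (l m)) => mm _; exact: measurable_funS mm.
split => //.
  (* Square integrability of [I] is deduced from one approximation at finite distance, the step
     integral being itself in L2. *)
  have [m [fm _]] : exists m, (\int[P]_w ((step_integral W (l m) w - I w) ^+ 2)%:E)%E \is a fin_num
      /\ True.
    by case: finI => N _ /(_ N (leqnn N)); exists N.
  have sm := step_integral_L2 hW (wf m).
  have dm : L2 P (fun w => step_integral W (l m) w - I w).
    have mm : measurable_fun [set: Omega] (fun w => step_integral W (l m) w - I w).
      by apply: measurable_funB => //; case: sm.
    split => //; apply: ge0_itgP; first exact: measurable_funX.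
      by move=> w; exact: sqr_ge0.
    by rewrite ltey_eq fm.
  by have := L2B sm dm; congr (L2 _ _); apply/funext => w; ring.
move=> e e0.
have := cvgr_lt _ cf e e0; have := cvgr_lt _ cI e e0 => HI Hf.
have [N _ H] : \forall m \near \oo,
    fine (\int[mu]_(x in `[lo, hi]) ((step_fun (l m) x - f x) ^+ 2)%:E)%E < e /\
    fine (\int[P]_w ((step_integral W (l m) w - I w) ^+ 2)%:E)%E < e.
  near=> m; split; near: m; [exact: Hf|exact: HI].
have [h1 h2] := H N (leqnn N).
by exists (l N); split; [exact: wf|rewrite distE ltW|exact/ltW].
Unshelve. all: by end_near. Qed.

End WienerIntegral.

Lemma cell_grid_cell_start (R : realType) (tm : nat -> R) (t : R) (i j : nat) :
  (i <= j)%N -> cell_grid tm i t (j - i) = cell_start tm t i j.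
Proof.
move=> ij; rewrite /cell_grid /cell_start subn_eq0 subnK//.
by rewrite [X in if X then _ else _](_ : _ = (j == i)) // eqn_leq ij andbT.
Qed.

(** * Integrals over adjacent intervals *)

Section SquareIntegrable.
Context (R : realType).
Local Notation mu := (@lebesgue_measure R).

Lemma square_integrable_itg (lo hi : R) (f : R -> R) : square_integrable `[lo, hi] f ->
  itg mu (fun x : R => f x * \1_`]lo, hi] x).
Proof.
move=> hf; have i2 : L2 mu (\1_`]lo, hi] : R -> R).
  have sq : square_integrable `[lo, hi] (fun=> 1 : R).
    split => //; rewrite expr1n integral_cst//= mul1e lebesgue_measure_itv/= lte_fin.
    by case: ifP => // _; rewrite -EFinB ltry.
  by have := square_integrable_L2 sq; under eq_fun do rewrite mul1r.
have := L2_mul (square_integrable_L2 hf) i2; congr itg; apply/funext => x.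
by rewrite -mulrA -expr2 indic_idem.
Qed.

Lemma Rintegral_itv_chain (lo hi p q v : R) (f : R -> R) : square_integrable `[lo, hi] f ->
  lo <= p -> p <= q -> q <= v -> v <= hi ->
  \int[mu]_x (f x * \1_`]q, v] x) =
  \int[mu]_(x in `[p, v]) f x - \int[mu]_(x in `[p, q]) f x.
Proof.
move=> hf lp pq qv vh.
have h1 := square_integrable_sub lp vh hf.
have h2 := square_integrable_sub lp (le_trans qv vh) hf.
rewrite !Rintegral_itv_mul_indic; [|by case: h2|by case: h1].
have i1 := square_integrable_itg h1; have i2 := square_integrable_itg h2.
rewrite -RintegralB//; apply: eq_Rintegral => x _.
by rewrite (@itv_indic_chain _ p)// mulrBr.
Qed.

End SquareIntegrable.

(** * The given weights and the Greeks seen from the grid of the date t *)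

Section WeightsOnGrid.
Context (R : realType) (d : measure_display) (Omega : measurableType d).
Variables (P : probability Omega R) (W : R -> Omega -> R).
Hypothesis hW : brownian_motion P W.
Local Notation mu := (@lebesgue_measure R).
Variables (n : nat) (tm : nat -> R) (r sigma : R).
Hypotheses (htm : monitoring_grid n tm) (s0 : 0 < sigma).
Variable h : n.-tuple R -> R.
Hypothesis hh : admissible_payoff P W tm r h.
Variables (i : nat) (t : R) (y : nat -> R) (x : R).
Hypotheses (hi : (i < n)%N) (ht : tm i <= t < tm i.+1).
Hypotheses (hy : forall k, (k < i)%N -> 0 < y k) (hx : 0 < x).
Variables (j : nat) (s : R).
Hypotheses (ij : (i <= j < n)%N) (hs : cell_start tm t i j <= s < tm j.+1).
Variables (V0 V1 V3 : R).

Local Notation u := (cell_grid tm i t).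
Local Notation M := (n - i)%N.
Local Notation J := (j - i)%N.
Local Notation H := (@cell_payoff R n tm r sigma h i t y x).
Local Notation Q := (@weight_poly R M u J sigma V0 V1 V3 (n - j)%:R (tm j.+1 - s)).

Let u0 : 0 <= u 0%N. Proof. exact (cell_grid_start_ge0 htm hi ht). Qed.
Let uS k : (k < M)%N -> u k < u k.+1. Proof. exact (@cell_gridP R n tm htm i t hi ht k). Qed.
Let M0 : (0 < M)%N. Proof. by rewrite subn_gt0. Qed.
Let mH : measurable_fun [set: M.-tuple R] H.
Proof. exact: (measurable_cell_payoff sigma hh t y x). Qed.
Let Gexp : exists2 e, 0 < e &
  itg P (fun w => `|H (tup M (incr W u) w)| * expR (e * sqnorm (tup M (incr W u) w))).
Proof.
exact: (price_gauss_itg hW u0 uS M0 s0 (measurable_cell_payoff sigma hh t y)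
  (cell_payoff_itg s0 hh hi ht hy) hx).
Qed.
Let sn : sigma != 0. Proof. by rewrite gt_eqF. Qed.
Let jn : (j < n)%N. Proof. by case/andP: ij. Qed.
Let JM : (J < M)%N. Proof. by rewrite ltn_sub2r. Qed.
Let Ji : (J + i)%N = j. Proof. by rewrite subnK//; case/andP: ij. Qed.

Let uE k : u k.+1 = tm (k + i).+1. Proof. exact: cell_gridS. Qed.
Let uJ1 : u J.+1 = tm j.+1. Proof. by rewrite uE Ji. Qed.
Let uJ : u J = cell_start tm t i j.
Proof. by apply: cell_grid_cell_start; case/andP: ij. Qed.

Lemma cell_start_itv : tm j <= s < tm j.+1.
Proof.
case/andP: hs => ts ->; rewrite andbT; apply: le_trans ts; rewrite /cell_start.
by case: eqP => [->|//]; case/andP: ht.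
Qed.

Lemma start_cell_start k : (J <= k)%N -> start u J s k = cell_start tm s j (k + i).
Proof.
move=> Jk; rewrite /start /cell_start -[X in (_ + _ == X)%N]Ji eqn_add2r.
case: eqP => // /eqP kJ; rewrite /cell_grid; have -> // : (k == 0%N) = false.
by apply/negbTE; rewrite -lt0n (leq_ltn_trans (leq0n J))// ltn_neqAle eq_sym kJ.
Qed.

Let us : u J <= s < u J.+1. Proof. by rewrite uJ uJ1. Qed.
Let sge0 : 0 <= s.
Proof. by case/andP: us => + _; apply: le_trans; apply: (u_ge0 u0 uS); exact: ltnW. Qed.

Lemma start_ge k : u k <= start u J s k.
Proof. by rewrite /start; case: eqP => [->|//]; case/andP: us. Qed.

Lemma start_lt k : (k < M)%N -> start u J s k < u k.+1.
Proof. by move=> kM; rewrite /start; case: eqP => [->|_]; [case/andP: us|exact: uS]. Qed.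

Lemma s_le_start k : (J <= k)%N -> (k < M)%N -> s <= start u J s k.
Proof.
rewrite /start leq_eqVlt => /predU1P[<-|Jk] kM; first by rewrite eqxx.
rewrite gtn_eqF//; case/andP: us => _ /ltW su; apply: (le_trans su).
by apply: (u_mono uS); rewrite Jk ltnW.
Qed.

Lemma startJ : start u J s J = s. Proof. by rewrite /start eqxx. Qed.

Lemma start_cell_mul k l (v : R) : (k < M)%N -> (l < M)%N ->
  \1_`]start u J s k, u k.+1] v * cell u l v =
  (k == l)%:R * \1_`]start u J s k, u k.+1] v :> R.
Proof.
move=> kM lM; have sk := start_ge k; case: eqP => [<-|/eqP kl].
  by rewrite mul1r; exact: itv_indic_sub.
rewrite mul0r; move: kl; rewrite neq_ltn => /orP[kl|lk].
  by apply: itv_indic_disj; apply: (u_mono uS); rewrite kl ltnW.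
rewrite mulrC; apply: itv_indic_disj; apply: (le_trans _ sk).
by apply: (u_mono uS); rewrite lk ltnW.
Qed.

Section FrozenWeights.
Variables (a b : R -> R -> R) (IA : R -> Omega -> R) (IB : R -> nat -> Omega -> R).
Hypotheses (hab : weight_functions n tm a b) (hI : wiener_versions P W n tm a b IA IB).

Let fa v := a s v * \1_`]s, tm n] v.
Let fb k v := b s v * \1_`]start u J s k, u k.+1] v.

Let tm_le k l : (k <= l <= n)%N -> tm k <= tm l. Proof. exact: grid_mono. Qed.

Let s_le k : (j < k <= n)%N -> s <= tm k.
Proof. by move=> jk; case/andP: hs => _ /ltW su; apply: (le_trans su); exact: tm_le. Qed.

(** Each of the n - j cells from [s] on contributes 1. This is the parameter [N] of [weight_poly],
    so the limit polynomial [Q] is free of [b]. *)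
Lemma Rintegral_b_count : \int[mu]_(v in `[s, tm n]) b s v = (n - j)%:R.
Proof.
have [_ hb _ hb1] := hab jn cell_start_itv.
have H m : (j < m <= n)%N -> \int[mu]_(v in `[s, tm m]) b s v = (m - j)%:R.
  elim: m => // m IH /andP[jm mn]; move: jm; rewrite ltnS leq_eqVlt => /predU1P[jm|jm].
    rewrite -jm subSnn; have := hb1 j; rewrite leqnn jn /cell_start eqxx; exact.
  have := hb1 m; rewrite (ltnW jm) mn /cell_start gtn_eqF// => /(_ isT).
  rewrite Rintegral_itv_mul_indic; last first.
    have [+ _] : square_integrable `[tm m, tm m.+1] (b s).
      by apply: square_integrable_sub hb; [apply: s_le; rewrite jm ltnW|apply: tm_le; rewrite mn leqnn].
    exact.
  rewrite (Rintegral_itv_chain hb (lexx s)).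
  - rewrite IH ?jm 1?ltnW// => /eqP; rewrite subr_eq => /eqP ->.
    by rewrite subSn 1?ltnW// -nat1r.
  - by apply: s_le; rewrite jm ltnW.
  - by apply: tm_le; rewrite leqnSn.
  - by apply: tm_le; rewrite mn leqnn.
by apply: H; rewrite jn leqnn.
Qed.

Let kin k : (k < M)%N -> (k + i < n)%N. Proof. by rewrite ltn_subRL addnC. Qed.

Let hfa : square_integrable `[s, tm n] (a s).
Proof. by have [] := hab jn cell_start_itv. Qed.

Let hfb k : (J <= k)%N -> (k < M)%N -> square_integrable `[start u J s k, u k.+1] (b s).
Proof.
move=> Jk kM; have [_ hb _ _] := hab jn cell_start_itv.
apply: square_integrable_sub hb; first exact: s_le_start.
by rewrite uE; apply: tm_le; rewrite leqnn kin.
Qed.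

Lemma wH_pi_H w :
  wH W M u J s sigma V0 V1 V3 (n - j)%:R (IA s) (fun k => IB s (k + i))
    (\int[mu]_v (fa v * fa v)) (fun k => \int[mu]_v (fa v * fb k v)) w =
  pi_H W n tm sigma V0 V1 V3 a b IA IB j s w.
Proof.
have [mA _] := hfa.
have sumE (F : nat -> R) : \sum_(j <= k < n) F k = \sum_(J <= k < M) F (k + i)%N.
  by rewrite -{1}Ji big_addn.
have FE k : (J <= k)%N -> Fincr W tm sigma j s (k + i) w = Fw W u J s sigma k w.
  by move=> Jk; rewrite /Fincr /Fw start_cell_start// uE.
have vE : \int[mu]_v (fa v * fa v) = \int[mu]_(v in `[s, tm n]) (a s v ^+ 2).
  rewrite Rintegral_itv_mul_indic; last exact: measurable_funX.
  apply: eq_Rintegral => v _; rewrite /fa.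
  by rewrite -[in RHS]indic_idem; ring.
have SE : wS W M u J s sigma (n - j)%:R (fun k => IB s (k + i)) w =
    pi_sigma W n tm sigma b IB j s w.
  rewrite /wS /pi_sigma Rintegral_b_count sumE; congr (_ * (_ + _)).
  by rewrite big_nat [RHS]big_nat; apply: eq_bigr => k /andP[Jk _]; rewrite FE.
rewrite /wH /pi_H SE /wDS SE /pi_Delta_sigma /w3 /pi_3 vE.
rewrite -/(pi_Delta sigma IA s w) -/(wD sigma (IA s) w) [wD _ _ _]/(pi_Delta sigma IA s w).
rewrite Ji sumE; congr (_ + 2 * V1 * (_ - _ * (_ + _)) + _).
rewrite big_nat [RHS]big_nat; apply: eq_bigr => k /andP[Jk kM]; rewrite FE//.
congr (_ * _); rewrite -start_cell_start// -uE Rintegral_itv_mul_indic.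
  apply: eq_Rintegral => v _; rewrite /fa /fb.
  have {2}<- := @itv_indic_sub _ (start u J s k) (u k.+1) s (tm n) v (s_le_start Jk kM).
    by ring.
  by rewrite uE; apply: tm_le; rewrite leqnn kin.
apply: measurable_funM; last by case: (hfb Jk kM).
apply: measurable_funS mA => //; apply: subset_itv; rewrite bnd_simp.
  exact: s_le_start.
by rewrite uE; apply: tm_le; rewrite leqnn kin.
Qed.

(** The constraints on [a] and [b] are turned into integrals over the cells of the grid from t,
    which is what [weight_cexp] requires. *)
Lemma cexp_pi_H : cexp P W u H (pi_H W n tm sigma V0 V1 V3 a b IA IB j s) Q.
Proof.
have [_ _ ha1 hb1] := hab jn cell_start_itv; have [wa wb] := hI jn cell_start_itv.
have tn k : (k < M)%N -> u k.+1 <= tm n.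
  by move=> kM; rewrite uE; apply: tm_le; rewrite leqnn kin.
have int_a k : (J <= k)%N -> (k < M)%N -> \int[mu]_(v in `[s, u k.+1]) a s v = 1.
  move=> Jk kM; rewrite uE; apply: ha1; rewrite kin// andbT ltnS -Ji.
  by rewrite leq_add2r.
have int_b k : (J <= k)%N -> (k < M)%N -> \int[mu]_v fb k v = 1.
  move=> Jk kM; have [mb _] := hfb Jk kM.
  rewrite -[LHS]Rintegral_itv_mul_indic// start_cell_start// uE; apply: hb1.
  by rewrite kin// andbT -{1}Ji leq_add2r.
have [mA _] := hfa.
have mAk k : (k < M)%N -> measurable_fun `[s, u k.+1] (a s).
  by move=> kM; apply: measurable_funS mA => //; apply: subset_itvl; rewrite bnd_simp tn.
rewrite -uJ1.
have hb2 k l : (J <= k)%N && (k < M)%N -> (l < M)%N ->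
    \int[mu]_v (fb k v * cell u l v) = (k == l)%:R.
  move=> /andP[Jk kM] lM.
  under eq_Rintegral => v _ do rewrite /fb -mulrA start_cell_mul// mulrCA.
  have [mfb i2] := (square_integrable_itg (hfb Jk kM), square_integrable_L2 (hfb Jk kM)).
  by rewrite RintegralZl// int_b// mulr1.
have haJ v : \1_`]s, u J.+1] v * fa v = a s v * \1_`]s, u J.+1] v.
  by rewrite /fa mulrCA itv_indic_sub// tn.
have heb : \int[mu]_v ((\1_`]s, u J.+1] : R -> R) v * fb J v) = 1.
  rewrite -[RHS](int_b J)//; apply: eq_Rintegral => v _.
  by rewrite /fb startJ mulrCA -expr2 indic_idem.
have hea : \int[mu]_v ((\1_`]s, u J.+1] : R -> R) v * fa v) = 1.
  under eq_Rintegral => v _ do rewrite haJ.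
  by rewrite -Rintegral_itv_mul_indic ?int_a//; exact: mAk.
have ha2 k : (k < M)%N -> \int[mu]_v (fa v * cell u k v) = (k == J)%:R.
  move=> kM; case: (ltngtP k J) => [kJ|Jk|->].
  - under eq_Rintegral => v _.
      rewrite /fa -mulrA [X in _ * X]mulrC itv_indic_disj ?mulr0; last first.
        by case/andP: us => + _; apply: le_trans; apply: (u_mono uS); rewrite kJ ltnW.
      over.
    by rewrite /Rintegral integral0.
  (* On a cell after that of [s], the integral of a(s, .) is the difference of two constraints, 1 -
     1 = 0. *)
  - have Jk1 : (J <= k.-1)%N by rewrite -ltnS prednK// (leq_ltn_trans _ Jk).
    have k1 : k.-1.+1 = k by rewrite prednK// (leq_ltn_trans _ Jk).
    have k1M : (k.-1 < M)%N by rewrite (leq_ltn_trans (leq_pred k)).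
    have suk : s <= u k.
      case/andP: us => _ /ltW su; apply: (le_trans su).
      by apply: (u_mono uS); rewrite Jk ltnW.
    transitivity (\int[mu]_v (a s v * \1_`]u k, u k.+1] v)).
      apply: eq_Rintegral => v _; rewrite /fa -mulrA [X in _ * X]mulrC.
      by rewrite itv_indic_sub// tn.
    have ukk : u k <= u k.+1 by exact/ltW/uS.
    rewrite (Rintegral_itv_chain hfa (lexx s) suk ukk (tn _ kM)).
    have -> : \int[mu]_(v in `[s, u k]) a s v = 1 by rewrite -k1 int_a.
    by rewrite (int_a _ (ltnW Jk) kM) subrr.
  - rewrite -hea; apply: eq_Rintegral => v _; rewrite haJ /fa -mulrA.
    by rewrite itv_indic_meet ?tn//; case/andP: us.
have Hc := weight_cexp hW u0 uS mH Gexp JM sge0 us sn V0 V1 V3 (n - j)%:R.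
have wfa : wiener P W fa (IA s) by exact: wiener_integral_wiener.
have wfb k : (J <= k)%N && (k < M)%N -> wiener P W (fb k) (IB s (k + i)).
  move=> /andP[Jk kM]; apply: wiener_integral_wiener => //.
  - exact: (le_trans sge0 (s_le_start Jk kM)).
  - exact: hfb.
  - rewrite start_cell_start// uE; apply: wb.
    by rewrite kin// andbT -{1}Ji leq_add2r.
have := Hc _ _ _ _ wfa ha2 wfb hb2 hea heb.
by apply: cexp_eq => //; apply/funext => w; rewrite wH_pi_H.
Qed.

End FrozenWeights.
Local Notation g := (cell_grid tm j s).
Local Notation len k := (u k.+1 - start u J s k).
Local Notation Wk k w := (W (u k.+1) w - W (start u J s k) w).

(** The second instance of [weight_cexp]: [fa] and [fb] are constant on the cells from [s] on, and
    [fa] vanishes after the first of them. Their Wiener integrals are multiples of the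
    increments. *)
Let fa v := (u J.+1 - s)^-1 * \1_`]s, u J.+1] v.
Let fb k v := (len k)^-1 * \1_`]start u J s k, u k.+1] v.

Let len_gt0 k : (k < M)%N -> 0 < len k.
Proof. by move=> kM; rewrite subr_gt0 start_lt. Qed.

Let lenJ : 0 < u J.+1 - s. Proof. by have := len_gt0 JM; rewrite startJ. Qed.

Let itg_ind (p q : R) : itg mu (\1_`]p, q] : R -> R).
Proof. by have := integrable_itv_indic p q 1; under eq_fun do rewrite mul1r. Qed.

Let int_b k : (k < M)%N -> \int[mu]_v fb k v = 1.
Proof.
move=> kM; rewrite /fb RintegralZl//.
  by rewrite Rintegral_itv_indic ?mulVf ?gt_eqF ?len_gt0//; exact/ltW/start_lt.
exact: itg_ind.
Qed.

Let itg_b k : itg mu (fb k).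
Proof. exact: (itgZ (len k)^-1 (itg_ind _ _)). Qed.

Let fbJ v : fa v = fb J v. Proof. by rewrite /fa /fb startJ. Qed.

Let fb_cell k l v : (k < M)%N -> (l < M)%N -> fb k v * cell u l v = (k == l)%:R * fb k v.
Proof. by move=> kM lM; rewrite /fb -mulrA start_cell_mul// mulrCA. Qed.

Let fb_indic k v : fb k v * \1_`]start u J s k, u k.+1] v = fb k v.
Proof. by rewrite /fb -mulrA -expr2 indic_idem. Qed.

Let fa_fb k : (k < M)%N -> \int[mu]_v (fa v * fb k v) = (J == k)%:R * (len k)^-1.
Proof.
move=> kM; rewrite -[RHS]mulr1 -[X in _ = _ * X](int_b kM) -RintegralZl//; last exact: itg_b.
apply: eq_Rintegral => v _; rewrite fbJ.
have fbk : fb k v * cell u k v = fb k v by rewrite fb_cell// eqxx mul1r.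
have -> : fb J v * fb k v = (J == k)%:R * fb J v * fb k v.
  by rewrite -[in LHS]fbk mulrCA mulrC -(fb_cell v JM kM) mulrAC mulrC; ring.
case: eqP => [<-|_]; last by rewrite !mul0r.
rewrite !mul1r; transitivity ((len J)^-1 * (fb J v * \1_`]start u J s J, u J.+1] v)).
  by rewrite {1}/fb; ring.
by rewrite fb_indic.
Qed.

Let start_grid k : start u J s (k + J) = g k.
Proof.
rewrite start_cell_start ?leq_addl// -addnA Ji /cell_start /cell_grid.
by rewrite -[X in (_ == X)%N]add0n eqn_add2r.
Qed.

Let u_grid k : u (k + J).+1 = g k.+1.
Proof. by rewrite uE -addnA Ji cell_gridS. Qed.

Let gridM : (M - J)%N = (n - j)%N.
Proof. by rewrite -subnDA subnKC//; case/andP: ij. Qed.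

(** For this choice the weight is exactly the polynomial of the Greeks on the grid from [s]. The
    term - (n - j) splits into one -1 per cell of [vega_poly], and the integral of [fa] squared is
    the inverse length of the first cell. *)
Lemma wH_greek w :
  wH W M u J s sigma V0 V1 V3 (n - j)%:R (fun w => (u J.+1 - s)^-1 * (W (u J.+1) w - W s w))
    (fun k w => (len k)^-1 * Wk k w)
    (\int[mu]_v (fa v * fa v)) (fun k => \int[mu]_v (fa v * fb k v)) w =
  greek_poly tm sigma s V0 V1 V3 (tup (n - j) (incr W g) w).
Proof.
have j0 : (0 < n - j)%N by rewrite subn_gt0.
have dl := lenJ; set D := u J.+1 - s in dl *; set B := W (u J.+1) w - W s w.
have vE : \int[mu]_v (fa v * fa v) = D^-1.
  have := fa_fb JM; rewrite eqxx mul1r startJ => <-.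
  by apply: eq_Rintegral => v _; rewrite fbJ.
have cE : \sum_(J <= k < M) Fw W u J s sigma k w * (\int[mu]_v (fa v * fb k v)) =
    - sigma + B / D.
  rewrite (big_ltn JM) big_nat big1 => [|k /andP[Jk kM]]; last first.
    by rewrite fa_fb// ltn_eqF// mul0r mulr0.
  rewrite fa_fb// eqxx /Fw startJ -/D /B /=; field.
  by rewrite gt_eqF.
have z0 : zeta0 g (tup (n - j) (incr W g) w) = B / D.
  rewrite /zeta0 nth_tup// /incr /dt -(start_grid 0) -(u_grid 0) add0n startJ.
  by [].
have d0 : dt g 0 = D by rewrite /dt -(start_grid 0) -(u_grid 0) add0n startJ.
have SE : wS W M u J s sigma (n - j)%:R (fun k w => (len k)^-1 * Wk k w) w =
    vega_poly g sigma (tup (n - j) (incr W g) w).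
  rewrite /wS /vega_poly big_split/= sumr_const card_ord -mulNrn; congr (_ * (_ + _)).
  rewrite -{1}[J]add0n big_addn gridM big_mkord; apply: eq_bigr => k _.
  rewrite tnth_tup /Fw /incr /dt start_grid u_grid; have kM : (k + J < M)%N.
    by rewrite addnC -ltn_subRL gridM.
  have := len_gt0 kM; rewrite start_grid u_grid => lk.
  by field; rewrite gt_eqF.
rewrite /wH /wDS SE /greek_poly /vega_delta_poly /gamma_delta_poly z0 d0 cE startJ -/D.
rewrite /w3 /wD vE -/B; set S := vega_poly _ _ _.
by field; rewrite sn gt_eqF.
Qed.

(** The same polynomial [Q] as in [cexp_pi_H]: the Greeks and the given weight cannot be told apart
    by the payoff. *)
Lemma cexp_greek : cexp P W u H
  (fun w => greek_poly tm sigma s V0 V1 V3 (tup (n - j) (incr W g) w)) Q.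
Proof.
rewrite -uJ1.
have Hc := weight_cexp hW u0 uS mH Gexp JM sge0 us sn V0 V1 V3 (n - j)%:R.
have wfa : wiener P W fa (fun w => (u J.+1 - s)^-1 * (W (u J.+1) w - W s w)).
  by apply: (wienerZ hW); apply: (wiener_interval hW) => //; exact/ltW/(andP us).2.
have wfb k : (J <= k)%N && (k < M)%N ->
    wiener P W (fb k) (fun w => (len k)^-1 * Wk k w).
  move=> /andP[Jk kM]; apply: (wienerZ hW); apply: (wiener_interval hW).
    exact: (le_trans sge0 (s_le_start Jk kM)).
  exact/ltW/start_lt.
have hb2 k l : (J <= k)%N && (k < M)%N -> (l < M)%N ->
    \int[mu]_v (fb k v * cell u l v) = (k == l)%:R.
  move=> /andP[Jk kM] lM; under eq_Rintegral => v _ do rewrite fb_cell//.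
  by rewrite RintegralZl ?int_b ?mulr1//; exact: itg_b.
have ha2 k : (k < M)%N -> \int[mu]_v (fa v * cell u k v) = (k == J)%:R.
  move=> kM; rewrite eq_sym -(hb2 J)//; last by rewrite leqnn JM.
  by apply: eq_Rintegral => v _; rewrite fbJ.
have heb : \int[mu]_v ((\1_`]s, u J.+1] : R -> R) v * fb J v) = 1.
  rewrite -[RHS](int_b JM); apply: eq_Rintegral => v _.
  by have := fb_indic J v; rewrite startJ mulrC.
have hea : \int[mu]_v ((\1_`]s, u J.+1] : R -> R) v * fa v) = 1.
  by rewrite -[RHS]heb; apply: eq_Rintegral => v _; rewrite fbJ.
have := Hc _ _ _ _ wfa ha2 wfb hb2 hea heb.
by apply: cexp_eq => //; apply/funext => w; rewrite wH_greek.
Qed.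

End WeightsOnGrid.

(** * The Markov property at the time s *)

Section MarkovProperty.
Context (R : realType) (d : measure_display) (Omega : measurableType d).
Variables (P : probability Omega R) (W : R -> Omega -> R).
Hypothesis hW : brownian_motion P W.
Variables (n : nat) (tm : nat -> R) (r sigma : R).
Hypotheses (htm : monitoring_grid n tm) (s0 : 0 < sigma).
Variable h : n.-tuple R -> R.
Hypothesis hh : admissible_payoff P W tm r h.
Variables (i : nat) (t : R) (y : nat -> R) (x : R).
Hypotheses (hi : (i < n)%N) (ht : tm i <= t < tm i.+1).
Hypotheses (hy : forall k, (k < i)%N -> 0 < y k) (hx : 0 < x).
Variables (j : nat) (s : R).
Hypotheses (ij : (i <= j < n)%N) (hs : cell_start tm t i j <= s < tm j.+1).
Variables (V0 V1 V3 : R).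

Local Notation u := (cell_grid tm i t).
Local Notation g := (cell_grid tm j s).
Local Notation J := (j - i)%N.
Local Notation p := J.+1.
Local Notation path w := (fun v => gbm W r sigma t x v w).

Let js : tm j <= s < tm j.+1. Proof. exact: (cell_start_itv ht hs). Qed.
Let jn : (j < n)%N. Proof. by case/andP: ij. Qed.
(* The monitoring dates after [t], with [s] inserted before [tm j.+1]. *)
Let fg (k : nat) : R := if (k < p)%N then u k else g (k - p).

Let fg_past k : (k < p)%N -> fg k = u k. Proof. by rewrite /fg => ->. Qed.
Let fg_future k : fg (p + k) = g k.
Proof. by rewrite /fg ltnNge leq_addr/= addKn. Qed.
Let fg_s : fg p = s. Proof. by rewrite -[p]addn0 fg_future. Qed.

Let uJs : u J <= s.
Proof. by rewrite cell_grid_cell_start ?(andP ij).1// (andP hs).1. Qed.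

(** Only a weak inequality: [s] may coincide with the start of its cell, in which case the inserted
    cell is degenerate. Independence of the increments is available for such grids. *)
Let fg_le k : (k < p + (n - j))%N -> fg k <= fg k.+1.
Proof.
move=> kM; have [kp|pk] := ltnP k p.
  move: (kp); rewrite ltnS leq_eqVlt => /predU1P[->|kJ]; first by rewrite fg_s fg_past.
  rewrite !fg_past//; apply/ltW/(@cell_gridP R n tm htm i t hi ht).
  by rewrite (ltn_trans kJ)// ltn_sub2r.
rewrite -(subnKC pk) -addnS !fg_future; apply/ltW/(@cell_gridP R n tm htm j s jn js).
by rewrite -(ltn_add2l p) subnKC.
Qed.

Let fg0 : 0 <= fg 0%N.
Proof. by rewrite fg_past//; exact (cell_grid_start_ge0 htm hi ht). Qed.

Let X := incr W fg.

Let fg_ge0 k : (k <= p + (n - j))%N -> 0 <= fg k.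
Proof. by elim: k => // k IH km; apply: le_trans (fg_le km); apply: IH; exact: ltnW. Qed.

Let mX k : (k < p + (n - j))%N -> measurable_fun [set: Omega] (X k).
Proof.
case: hW => mW _ _ _ _ km; apply: measurable_funB; apply: mW; apply: fg_ge0 => //.
exact: ltnW.
Qed.

Let indepX : indep_rv P (tup p X) (tup (n - j) (fun k => X (p + k)%N)).
Proof. by apply: tup_indep => //; case: hW => _ _ _ + _; apply. Qed.

Let futureE : tup (n - j) (fun k => X (p + k)%N) = tup (n - j) (incr W g).
Proof.
apply/funext => w; apply: eq_from_tnth => k; rewrite !tnth_tup /X /incr.
by rewrite -addnS !fg_future.
Qed.

(** [Y1] and [X1] are the prices observed before [s] and the price at [s], as functions of the
    increments preceding [s]. *)
Let Y1 (z : p.-tuple R) (k : nat) : R := if (k < i)%N then y k else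
  x * expR (\sum_(l < (k - i).+1) log_incr r sigma fg l (nth 0 z l)).
Let X1 (z : p.-tuple R) : R :=
  x * expR (\sum_(l < p) log_incr r sigma fg l (nth 0 z l)).

Let gbm_fg m w : (m <= p)%N -> gbm W r sigma t x (fg m) w =
  x * expR (\sum_(l < m) log_incr r sigma fg l (nth 0 (tup p X w) l)).
Proof.
move=> mp; have lp (l : 'I_m) : (l < p)%N by rewrite (leq_trans (ltn_ord l)).
under eq_bigr => l _ do rewrite nth_tup//.
by rewrite /log_incr big_split/= -!mulr_sumr sum_dt /X sum_incr /gbm (fg_past (ltn0Sn J)).
Qed.

Let Y1E w k : (k < j)%N -> Y1 (tup p X w) k = observed tm i y (path w) k.
Proof.
move=> kj; rewrite /Y1 /observed; case: ltnP => // ik.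
have kJ : (k - i < J)%N by rewrite ltn_sub2r// (leq_ltn_trans ik kj).
by rewrite -gbm_fg 1?ltnW// fg_past// cell_gridS subnK.
Qed.

Let X1E w : X1 (tup p X w) = gbm W r sigma t x s w.
Proof. by rewrite /X1 -gbm_fg// fg_s. Qed.

Let F (z : p.-tuple R * (n - j).-tuple R) : R :=
  cell_payoff tm r sigma h s (Y1 z.1) (X1 z.1) z.2 *
  greek_poly tm sigma s V0 V1 V3 z.2.

Let measurable_past m :
  measurable_fun [set: p.-tuple R * (n - j).-tuple R]
    (fun z => x * expR (\sum_(l < m) log_incr r sigma fg l (nth 0 z.1 l))).
Proof.
by apply: measurable_funM => //; apply: measurable_log_path; exact: measurable_fst.
Qed.

Let mF : measurable_fun [set: p.-tuple R * (n - j).-tuple R] F.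
Proof.
apply: measurable_funM; last first.
  have [mg _] := tame_greek_poly tm sigma s jn V0 V1 V3.
  exact: (measurableT_comp mg measurable_snd).
case: hh => mh _; apply: measurableT_comp => //; apply/measurable_fun_tnthP => k.
rewrite (_ : _ \o _ = fun z : p.-tuple R * (n - j).-tuple R =>
    if (k < j)%N then Y1 z.1 k else
    X1 z.1 * expR (\sum_(l < (k - j).+1) log_incr r sigma g l (nth 0 z.2 l))).
  case: ltnP => _.
    by rewrite /Y1; case: ltnP => _; [exact: measurable_cst|exact: measurable_past].
  apply: measurable_funM; first exact: measurable_past.
  by apply: measurable_log_path; exact: measurable_snd.
by apply/funext => z /=; rewrite tnth_mktuple.
Qed.

Let cell_payoff_observed (w : Omega) (z : (n - j).-tuple R) :
  cell_payoff tm r sigma h s (Y1 (tup p X w)) (X1 (tup p X w)) z =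
  cell_payoff tm r sigma h s (observed tm i y (path w)) (gbm W r sigma t x s w) z.
Proof.
rewrite X1E; congr h; apply: eq_from_tnth => k; rewrite !tnth_mktuple.
by case: ltnP => // kj; rewrite Y1E.
Qed.

(** Flow property of the geometric Brownian motion: restarting at time [s] from its current value
    continues the same path, so the fixings do not change. *)
Let fixings_flow w :
  fixings n tm j (observed tm i y (path w))
    (fun v => gbm W r sigma s (gbm W r sigma t x s w) v w) =
  fixings n tm i y (path w).
Proof.
apply: eq_from_tnth => k; rewrite !tnth_mktuple {1}/observed; case: ltnP => // jk.
rewrite /observed ltnNge (leq_trans _ jk) ?(andP ij).1//= /gbm -mulrA -expRD.
by congr (_ * expR _); ring.
Qed.

Let FE w : F (tup p X w, tup (n - j) (incr W g) w) =
  h (fixings n tm i y (path w)) *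
  greek_poly tm sigma s V0 V1 V3 (tup (n - j) (incr W g) w).
Proof.
by rewrite /F /= cell_payoff_observed -(fixings_flow w) (fixings_incr W tm r s0).
Qed.

Let itg_payoff_greek : itg P (fun w => h (fixings n tm i y (path w)) *
  greek_poly tm sigma s V0 V1 V3 (tup (n - j) (incr W g) w)).
Proof.
have [_ + _] := cexp_greek hW htm s0 hh hi ht hy hx ij hs V0 V1 V3.
by congr itg; apply/funext => w; rewrite fixings_incr.
Qed.

Let observed_gt0 w k : (k < j)%N -> 0 < observed tm i y (path w) k.
Proof.
rewrite /observed => _; case: ltnP => [ki|_]; first exact: hy.
by rewrite mulr_gt0// expR_gt0.
Qed.

(** With the increments before [s] frozen, [HP0E] applies at the positive prices reached at [s] and
    expresses [HP0] by an average over the later increments; these are independent of the earlier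
    ones, so the two averages merge. *)
Lemma Rintegral_HP0 :
  \int[P]_w HP0 P W tm r sigma V0 V1 V3 h j s (observed tm i y (path w))
    (gbm W r sigma t x s w) =
  expR (- r * (tm n - s)) * \int[P]_w (h (fixings n tm i y (path w)) *
    greek_poly tm sigma s V0 V1 V3 (tup (n - j) (incr W g) w)).
Proof.
rewrite -RintegralZl//.
have mX1 : measurable_fun [set: Omega] (tup p X).
  by apply: measurable_tup => k kp; apply: mX; rewrite (leq_trans kp)// leq_addr.
have mX2 : measurable_fun [set: Omega] (tup (n - j) (incr W g)).
  by rewrite -futureE; apply: measurable_tup => k kp; apply: mX; rewrite ltn_add2l.
have XY := indepX; rewrite futureE in XY.
pose cF z := expR (- r * (tm n - s)) * F z.
have mcF : measurable_fun [set: p.-tuple R * (n - j).-tuple R] cF.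
  exact: measurable_funM.
have icF : itg P (fun w => cF (tup p X w, tup (n - j) (incr W g) w)).
  by apply: itgZ; under eq_fun do rewrite FE.
rewrite [RHS](_ : _ = \int[P]_w cF (tup p X w, tup (n - j) (incr W g) w)); last first.
  by apply: eq_Rintegral => w _; rewrite /cF FE.
rewrite (indep_Rintegral mX1 mX2 XY mcF icF); apply: eq_Rintegral => w _.
rewrite (HP0E hW htm s0 hh jn js (observed_gt0 w)); last by rewrite mulr_gt0// expR_gt0.
by apply: eq_Rintegral => w' _; rewrite /cF /F /= cell_payoff_observed.
Qed.

End MarkovProperty.

(** * Fubini's theorem for a pathwise time integral *)

Section RandomIntegrand.
Context (R : realType) (d : measure_display) (Omega : measurableType d).
Variable P : probability Omega R.
Local Notation mu := (@lebesgue_measure R).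

(** For a measurable function that is not integrable, the extended integral is infinite, and [fine]
    sends it to 0. *)
Lemma Rintegral_not_integrable (d' : measure_display) (T : measurableType d')
    (nu : {measure set T -> \bar R}) (f : T -> R) :
  measurable_fun [set: T] f -> ~ itg nu f -> \int[nu]_x f x = 0.
Proof.
move=> mf nf; have mE : measurable_fun [set: T] (EFin \o f) by exact/measurable_EFinP.
rewrite /Rintegral; have [fin|] := boolP (\int[nu]_x (f x)%:E \is a fin_num)%E.
  exfalso; apply: nf; apply/integrableP; split => //.
  rewrite (@eq_integral _ _ _ nu setT ((EFin \o f)^\+ \+ (EFin \o f)^\-)%E); last first.
    by move=> x _; exact: (congr1 (fun g => g x) (fune_abse (EFin \o f))).
  rewrite ge0_integralD//; [|exact: measurable_funepos|exact: measurable_funeneg].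
  move: fin; rewrite integralE.
  have : (0 <= \int[nu]_x ((EFin \o f)^\+ x))%E by exact: integral_ge0.
  have : (0 <= \int[nu]_x ((EFin \o f)^\- x))%E by exact: integral_ge0.
  case: (\int[nu]_x ((EFin \o f)^\- x))%E => [B| |]; case: (\int[nu]_x ((EFin \o f)^\+ x))%E => [A| |] //= _ _ _.
  by rewrite -EFinD ltry.
by rewrite fin_numE negb_and !negbK => /orP[/eqP ->|/eqP ->].
Qed.

(** For exceptional [w] the integral in time may diverge; scalars still come out, since both sides
    are then 0 by default. *)
Lemma RintegralZl_measurable (d' : measure_display) (T : measurableType d')
    (nu : {measure set T -> \bar R}) (f : T -> R) (c : R) :
  measurable_fun [set: T] f -> \int[nu]_x (c * f x) = c * \int[nu]_x f x.
Proof.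
move=> mf; have [->|c0] := eqVneq c 0.
  by under eq_Rintegral do rewrite mul0r; rewrite /Rintegral integral0 mul0r.
have [fi|nfi] := pselect (itg nu f); first exact: RintegralZl.
rewrite !Rintegral_not_integrable ?mulr0//; first exact: measurable_funM.
move=> /(itgZ c^-1) fi; apply: nfi; move: fi; congr itg; apply/funext => x.
by rewrite mulKf.
Qed.

Lemma integrable_fubini_snd (f : R * Omega -> \bar R) :
  (mu \x P)%E.-integrable setT f -> P.-integrable setT (fun w => \int[mu]_s f (s, w))%E.
Proof.
move=> fi; have mf := measurable_int _ fi; apply/integrableP; split.
  exact: (measurable_fubini_G fi).
have /(integrable21ltyP _ _ mf) fin := fi; apply: le_lt_trans fin.
have maf := measurableT_comp (@abse_measurable R setT) mf.
apply: ge0_le_integral => //.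
- by apply: measurableT_comp => //; exact: (measurable_fubini_G fi).
- exact: (@measurable_fun_fubini_tonelli_G _ _ _ _ _ mu (abse \o f) maf (fun z => abse_ge0 (f z))).
- by move=> w _; apply: le_abse_integral => //; exact: (measurableT_comp mf (pair2_measurable w)).
Qed.

Variables (I : set R) (X : Omega -> R) (f : R -> Omega -> R).
Hypothesis mI : measurable I.
Hypothesis fi : (mu \x P)%E.-integrable (I `*` setT) (fun z => (X z.2 * f z.1 z.2)%:E).

Let G (z : R * Omega) : R := (X z.2 * f z.1 z.2) * \1_I z.1.

Let iG : (mu \x P)%E.-integrable setT (EFin \o G).
Proof.
move: fi; rewrite integrable_mkcond; last exact: measurableX.
congr (_.-integrable _ _); apply/funext => -[s w].
rewrite /patch /G /= indicE in_setX /= in_setT andbT.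
by case: (s \in I); rewrite ?mulr1 ?mulr0.
Qed.

Let innerE w : X w * \int[mu]_(s in I) f s w = fine (\int[mu]_s (G (s, w))%:E)%E.
Proof.
(* Measurability is known for the product of [X] and [f] only. Where X w = 0 both sides vanish;
   elsewhere f(., w) is recovered on [I] by division. *)
have [X0|X0] := eqVneq (X w) 0.
  by rewrite X0 mul0r integral0_eq// => s _; rewrite /G /= X0 !mul0r.
have mG : measurable_fun [set: R] (fun s => G (s, w)).
  have /measurable_EFinP mG : measurable_fun setT (EFin \o G) by exact: measurable_int iG.
  exact: measurableT_comp mG (pair2_measurable w).
have mf : measurable_fun [set: R] (fun s => f s w * \1_I s).
  have := measurable_funM (measurable_cst (X w)^-1) mG.
  congr measurable_fun; apply/funext => s /=.
  by rewrite /G /= -mulrA mulKf.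
rewrite Rintegral_mkcond patch_indic -RintegralZl_measurable//.
by apply: eq_Rintegral => s _; rewrite /G /= mulrA.
Qed.

Lemma itg_mul_Rintegral : itg P (fun w => X w * \int[mu]_(s in I) f s w).
Proof.
have iF := integrable_fubini_snd iG; apply/integrableP; split.
  apply/measurable_EFinP; under eq_fun do rewrite innerE.
  by apply: measurableT_comp => //; exact: measurable_int iF.
move/integrableP: (iF) => [mF]; apply: le_lt_trans; apply: ge0_le_integral => //.
- apply: measurableT_comp => //; apply/measurable_EFinP; under eq_fun do rewrite innerE.
  by apply: measurableT_comp.
- exact: measurableT_comp.
- move=> w _ /=; rewrite innerE; case: (\int[mu]_s (G (s, w))%:E)%E => [v| |] /=.
  + exact: lexx.
  + exact: leey.
  + exact: leey.
Qed.

Lemma Rintegral_mul_Rintegral :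
  \int[P]_w (X w * \int[mu]_(s in I) f s w) = \int[mu]_(s in I) \int[P]_w (X w * f s w).
Proof.
have iF := integrable_fubini_snd iG.
rewrite [RHS]Rintegral_mkcond [LHS]/Rintegral [RHS]/Rintegral; congr fine.
transitivity (\int[P]_w \int[mu]_s (G (s, w))%:E)%E.
  rewrite -(integral_fine iF); apply: eq_integral => w _; congr EFin.
  exact: innerE.
have := Fubini iG; rewrite /= => <-.
rewrite -(integral_fine (integrable_fubini_F iG)); apply: eq_integral => s _.
rewrite /patch /fubini_F /=; case: ifPn => sI; congr EFin.
  by congr fine; apply: eq_integral => w _; rewrite /G /= indicE sI mulr1.
by rewrite integral0_eq// => w _; rewrite /G /= indicE (negbTE sI) mulr0.
Qed.

End RandomIntegrand.

(** * Truncated integrals of affine functions *)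

Section Truncation.
Context (R : realType).
Local Notation mu := (@lebesgue_measure R).

Lemma integrable_affine (al be a b : R) (l l' : bool) :
  mu.-integrable [set` Interval (BSide l a) (BSide l' b)] (fun s => (al + be * s)%:E).
Proof.
apply: (@integrableS _ _ _ mu `[a, b]) => //.
  by apply: subset_itv; case: l l' => -[]; rewrite bnd_simp.
apply: continuous_compact_integrable; first exact: segment_compact.
apply: continuous_subspaceT => s; apply: cvgD; first exact: cvg_cst.
by apply: cvgM; [exact: cvg_cst|exact: cvg_id].
Qed.

Lemma cvg_Rintegral_truncated (al be a b : R) : a < b ->
  \int[mu]_(s in `[a, b - e[) (al + be * s) @[e --> 0^'+] -->
  \int[mu]_(s in `[a, b[) (al + be * s).
Proof.
move=> ab; have i := integrable_affine al be.
have E c : \int[mu]_(s in `[a, c[) (al + be * s) =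
    parameterized_integral mu a c (fun s => al + be * s).
  by rewrite /parameterized_integral Rintegral_itv_bndo_bndc//; exact: i.
rewrite E; under eq_fun do rewrite E.
have cvl : parameterized_integral mu a v (fun s => al + be * s) @[v --> b^'-] -->
    parameterized_integral mu a b (fun s => al + be * s).
  by apply: parameterized_integral_cvg_at_left => //; exact: i.
have cvb : b - e @[e --> 0^'+] --> b^'-.
  move=> A [eps /= e0 H]; have HA : \forall e \near 0^'+, A (b - e).
    near=> e; apply: H; last first.
      by rewrite gtrBl; near: e; exact: nbhs_right_gt.
    rewrite /ball_/= opprB addrC subrK ger0_norm; first by near: e; exact: nbhs_right_lt.
    by apply/ltW; near: e; exact: nbhs_right_gt.
  exact: HA.
exact (@cvg_comp _ _ _ (fun e : R => b - e)
  (fun v => parameterized_integral mu a v (fun s => al + be * s)) _ _ _ cvb cvl).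
Unshelve. all: by end_near. Qed.

End Truncation.

Lemma cvgr_sum (R : realType) (T : Type) (G : set_system T) (I : Type) (s : seq I)
    (Q : pred I) (F : I -> T -> R) (l : I -> R) : Filter G ->
  (forall i, Q i -> F i e @[e --> G] --> l i) ->
  \sum_(i <- s | Q i) F i e @[e --> G] --> \sum_(i <- s | Q i) l i.
Proof.
move=> FG Fl; elim: s => [|i s IH].
  by rewrite big_nil; under eq_fun do rewrite big_nil; exact: cvg_cst.
rewrite big_cons; under eq_fun do rewrite big_cons.
by case Qi : (Q i) => //; apply: cvgD => //; exact: Fl.
Qed.

(** * Both sides of the formula as sums over cells *)

Section PriceRepresentation.
Context (R : realType) (d : measure_display) (Omega : measurableType d).
Variables (P : probability Omega R) (W : R -> Omega -> R).
Hypothesis hW : brownian_motion P W.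
Local Notation mu := (@lebesgue_measure R).
Variables (n : nat) (tm : nat -> R) (r sigma V0 V1 V3 : R).
Hypotheses (htm : monitoring_grid n tm) (s0 : 0 < sigma).
Variable h : n.-tuple R -> R.
Hypothesis hh : admissible_payoff P W tm r h.
Variables (i : nat) (t : R) (y : nat -> R) (x : R).
Hypotheses (hi : (i < n)%N) (ht : tm i <= t < tm i.+1).
Hypotheses (hy : forall k, (k < i)%N -> 0 < y k) (hx : 0 < x).

Local Notation u := (cell_grid tm i t).
Local Notation M := (n - i)%N.
Local Notation Z := (tup M (incr W u)).
Local Notation payoff w := (h (fixings n tm i y (fun v => gbm W r sigma t x v w))).
Local Notation disc := (expR (- r * (tm n - t))).
Local Notation lo j := (cell_start tm t i j).
Local Notation up j := (tm j.+1).

Let u0 : 0 <= u 0%N. Proof. exact (cell_grid_start_ge0 htm hi ht). Qed.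
Let uS k : (k < M)%N -> u k < u k.+1. Proof. exact (@cell_gridP R n tm htm i t hi ht k). Qed.
Let M0 : (0 < M)%N. Proof. by rewrite subn_gt0. Qed.

Let payoff_tame_itg (q : M.-tuple R -> R) : tame q -> itg P (fun w => payoff w * q (Z w)).
Proof.
move=> tq; have := price_tame_itg hW u0 uS M0 s0 (measurable_cell_payoff sigma hh t y)
  (cell_payoff_itg s0 hh hi ht hy) hx tq.
by congr itg; apply/funext => w; rewrite (fixings_incr W tm r s0).
Qed.

Let itg_payoff : itg P (fun w => payoff w).
Proof.
by have := payoff_tame_itg (tame_cst M 1); congr itg; apply/funext => w; rewrite mulr1.
Qed.

Section Cell.
Variable j : nat.
Hypothesis ij : (i <= j < n)%N.
Local Notation J := (j - i)%N.
Local Notation wp del := (@weight_poly R M u J sigma V0 V1 V3 (n - j)%:R del).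

Let JM : (J < M)%N. Proof. by case/andP: ij => *; rewrite ltn_sub2r. Qed.

Lemma tame_weight_poly del : tame (wp del).
Proof.
have tz := tame_zeta u JM; have td := tame_drift u sigma JM del JM.
have tS : tame (fun z : M.-tuple R =>
    \sum_(J <= k < M) drift u J sigma del k z * zeta u k z).
  under eq_fun do rewrite big_nat.
  apply: tame_sum => k /andP[_ kM].
  exact: (tameM (tame_drift u sigma JM del kM) (tame_zeta u kM)).
have tc := tame_cst M (dt u J)^-1; have t1 := tame_cst M (1 - del / dt u J).
have tN := tame_cst M (- (n - j)%:R : R).
exact: (tameD (tameD
  (tameZ (2 * V0) (tameZ sigma^-1 (tameD (tameD tN tS) t1)))
  (tameZ (2 * V1) (tameZ (sigma ^- 2) (tameB (tameD (tameB (tameD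
    (tameZ (- (n - j)%:R) tz) (tameM tS tz)) (tameM td tc)) (tameM (tameZ 2 tz) t1)) tz))))
  (tameZ V3 (tameB (tameZ (sigma ^- 3) (tameB (tameX 3 tz) (tameM (tameZ 3 tz) tc)))
    (tameZ (sigma ^- 2) (tameB (tameX 2 tz) tc))))).
Qed.

(** Common expectation, at time t_{j+1} - del, of the payoff against the given weight and against
    the polynomial of the Greeks. The price correction and the weighted price both integrate it in
    time. *)
Definition cell_value (del : R) : R := \int[P]_w (payoff w * wp del (Z w)).

Lemma cell_value_affine del :
  cell_value del = cell_value 0 + del * (cell_value 1 - cell_value 0).
Proof.
have i0 := payoff_tame_itg (tame_weight_poly 0).
have i1 := payoff_tame_itg (tame_weight_poly 1).
have i2 := itgZ del (itgB i1 i0); have i3 := itgB i1 i0.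
rewrite /cell_value -RintegralB// -RintegralZl// -RintegralD//.
by apply: eq_Rintegral => w _; rewrite weight_poly_affine//; ring.
Qed.

Lemma cell_start_lt : lo j < up j.
Proof.
rewrite /cell_start; case: eqP => [->|_]; first by case/andP: ht.
by case: htm => _; apply; case/andP: ij.
Qed.

Section Time.
Variable s : R.
Hypothesis hs : lo j <= s < up j.

Let cexpE (X : Omega -> R) (q : M.-tuple R -> R) :
  cexp P W u (@cell_payoff R n tm r sigma h i t y x) X q ->
  \int[P]_w (payoff w * X w) = \int[P]_w (payoff w * q (Z w)).
Proof.
move=> [_ _ E]; under eq_Rintegral do rewrite (fixings_incr W tm r s0)//.
by rewrite E; apply: eq_Rintegral => w _; rewrite (fixings_incr W tm r s0).
Qed.

Lemma discounted_HP0 : expR (- r * (s - t)) *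
  \int[P]_w HP0 P W tm r sigma V0 V1 V3 h j s
    (observed tm i y (fun v => gbm W r sigma t x v w)) (gbm W r sigma t x s w) =
  disc * cell_value (up j - s).
Proof.
rewrite (Rintegral_HP0 hW htm s0 hh hi ht hy hx ij hs) mulrA -expRD.
rewrite (cexpE (cexp_greek hW htm s0 hh hi ht hy hx ij hs V0 V1 V3)).
by congr (expR _ * _); ring.
Qed.

Lemma Rintegral_payoff_pi_H a b IA IB : weight_functions n tm a b ->
  wiener_versions P W n tm a b IA IB ->
  \int[P]_w (payoff w * pi_H W n tm sigma V0 V1 V3 a b IA IB j s w) =
  cell_value (up j - s).
Proof.
by move=> hab hI; exact: cexpE (cexp_pi_H hW htm s0 hh hi ht hy hx ij hs V0 V1 V3 hab hI).
Qed.

End Time.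

Definition cell_integral (eta : R) : R :=
  \int[mu]_(s in `[lo j, up j - eta[) cell_value (up j - s).

Let cell_integralE eta : cell_integral eta =
  \int[mu]_(s in `[lo j, up j - eta[)
    ((cell_value 0 + up j * (cell_value 1 - cell_value 0)) +
     (cell_value 0 - cell_value 1) * s).
Proof. by apply: eq_Rintegral => s _; rewrite cell_value_affine; ring. Qed.

Lemma cvg_cell_integral : cell_integral eta @[eta --> 0^'+] --> cell_integral 0.
Proof.
rewrite cell_integralE subr0; under eq_fun do rewrite cell_integralE.
exact: cvg_Rintegral_truncated cell_start_lt.
Qed.

Lemma cell_integralZ eta c : c * cell_integral eta =
  \int[mu]_(s in `[lo j, up j - eta[) (c * cell_value (up j - s)).
Proof.
rewrite /cell_integral RintegralZl//.
set be := cell_value 0 - cell_value 1.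
have := integrable_affine (cell_value 0 + up j * (cell_value 1 - cell_value 0)) be
  (lo j) (up j - eta) true true.
congr (_.-integrable _ _); apply/funext => s; congr EFin.
by rewrite [RHS]cell_value_affine /be; ring.
Qed.

End Cell.

Lemma P1_cell_integral : P1 P W tm r sigma V0 V1 V3 h i t y x =
  disc * \sum_(i <= j < n) cell_integral j 0.
Proof.
rewrite /P1 mulr_sumr big_nat [RHS]big_nat; apply: eq_bigr => j ij.
rewrite cell_integralZ// subr0; apply: eq_Rintegral => s.
by rewrite inE /= in_itv/= => hs; exact: discounted_HP0.
Qed.

(** Joint integrability lets the expectation enter the time integral; as eta >= 0, every [s] of the
    truncated range lies in its cell, where the expectation is [cell_value]. *)
Lemma weighted_price_cell_integral a b IA IB eta : weight_functions n tm a b ->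
  wiener_versions P W n tm a b IA IB -> 0 <= eta ->
  weight_integrable P W tm r sigma V0 V1 V3 a b IA IB h eta i t y x ->
  weighted_price P W tm r sigma V0 V1 V3 a b IA IB h eta i t y x =
  disc * (\int[P]_w payoff w + \sum_(i <= j < n) cell_integral j eta).
Proof.
move=> hab hI eta0 wi; rewrite /weighted_price.
pose F j w := payoff w *
  \int[mu]_(s in `[lo j, up j - eta[) pi_H W n tm sigma V0 V1 V3 a b IA IB j s w.
have iF j : (i <= j < n)%N -> itg P (F j).
  by move=> ij; apply: (itg_mul_Rintegral _ (wi j ij)); exact: measurable_itv.
have iS : itg P (fun w => \sum_(i <= j < n | (i <= j < n)%N) F j w).
  by apply: itg_sum => j ij; exact: iF.
have iT := itgD itg_payoff iS.
transitivity (\int[P]_w (disc * (payoff w + \sum_(i <= j < n | (i <= j < n)%N) F j w))).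
  apply: eq_Rintegral => w _; rewrite /weight -mulrA; congr (_ * _).
  by rewrite mulrDr mulr1 mulr_sumr big_nat.
rewrite RintegralZl// RintegralD// Rintegral_sum; last exact: iF.
congr (_ * (_ + _)); rewrite [RHS]big_nat; apply: eq_bigr => j ij.
rewrite (Rintegral_mul_Rintegral _ (wi j ij)); last exact: measurable_itv.
apply: eq_Rintegral => s; rewrite inE /= in_itv/= => /andP[ls sh].
apply: Rintegral_payoff_pi_H => //; rewrite ls (lt_le_trans sh)//.
by rewrite gerBl.
Qed.

End PriceRepresentation.

(** Both sides reduce to the same [cell_integral], at truncation 0 or eta. Versions of Wiener
    integrals chosen separately for each time need not be jointly measurable in time and scenario;
    this enters through [weight_integrable], without truncation in the first claim and with every
    positive truncation in the second. *)
Theorem mainTheorem1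
  (R : realType) (d : measure_display) (Omega : measurableType d)
  (P : probability Omega R) (W : R -> Omega -> R)
  (n : nat) (tm : nat -> R)
  (r sigma V0 V1 V3 : R)
  (h : n.-tuple R -> R)
  (a b : R -> R -> R) (IA : R -> Omega -> R) (IB : R -> nat -> Omega -> R)
  (hW : brownian_motion P W)
  (htm : monitoring_grid n tm)
  (hsigma : 0 < sigma)
  (hh : admissible_payoff P W tm r h)
  (hab : weight_functions n tm a b)
  (hI : wiener_versions P W n tm a b IA IB)
  (i : nat) (t : R) (y : nat -> R) (x : R)
  (hi : (i < n)%N) (ht : tm i <= t < tm i.+1)
  (hy : forall k, (k < i)%N -> 0 < y k) (hx : 0 < x) :
  let P0t := P0 P W tm r h sigma i t y x in
  let P1t := P1 P W tm r sigma V0 V1 V3 h i t y x in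
  let wprice eta :=
    weighted_price P W tm r sigma V0 V1 V3 a b IA IB h eta i t y x in
  let wintegrable eta :=
    weight_integrable P W tm r sigma V0 V1 V3 a b IA IB h eta i t y x in
  (wintegrable 0 -> P0t + P1t = wprice 0) /\
  ((forall eta, 0 < eta -> wintegrable eta) ->
    wprice eta @[eta --> 0^'+] --> P0t + P1t).
Proof.
move=> P0t P1t wprice wintegrable.
have sumE : P0t + P1t = expR (- r * (tm n - t)) *
    (\int[P]_w h (fixings n tm i y (fun v => gbm W r sigma t x v w)) +
     \sum_(i <= j < n) cell_integral P W tm r sigma V0 V1 V3 h i t y x j 0).
  rewrite /P0t /P1t (P1_cell_integral hW V0 V1 V3 htm hsigma hh hi ht hy hx).
  have ip := hh.2 sigma i t y x hsigma hi ht hy hx.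
  by rewrite /P0 RintegralZl// -mulrDr.
have priceE eta : 0 <= eta -> wintegrable eta -> wprice eta =
    expR (- r * (tm n - t)) *
    (\int[P]_w h (fixings n tm i y (fun v => gbm W r sigma t x v w)) +
     \sum_(i <= j < n) cell_integral P W tm r sigma V0 V1 V3 h i t y x j eta).
  by move=> eta0; exact: weighted_price_cell_integral.
split=> [/(priceE 0 (lexx 0)) ->//|wi].
rewrite sumE; apply: (@cvg_trans _ (expR (- r * (tm n - t)) *
    (\int[P]_w h (fixings n tm i y (fun v => gbm W r sigma t x v w)) +
     \sum_(i <= j < n) cell_integral P W tm r sigma V0 V1 V3 h i t y x j eta)
    @[eta --> 0^'+])).
  (* The limit is taken along eta > 0, where the price equals its cell formula; convergence of each
     cell integral then concludes. *)
  apply: near_eq_cvg; near=> eta.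
  have eta0 : 0 < eta by near: eta; exact: nbhs_right_gt.
  by rewrite priceE ?ltW//; exact: wi.
apply: cvgM; first exact: cvg_cst.
apply: cvgD; first exact: cvg_cst.
rewrite big_nat; under eq_fun do rewrite big_nat.
by apply: cvgr_sum => j ij; exact: cvg_cell_integral.
Unshelve. all: by end_near. Qed.
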